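(* Let $(J,r,P)$ be a tree fluid network (defined in the context) satisfying: (T1) if $p_{ij}>0$, then $p_{ij}>r_j/r_i$; (T2) $J_j$ is nondecreasing for $j=2,\ldots,n$; (T3) $J$ is an $n$-dimensional Lévy process; (T4) $J$ is integrable and $(I-P')^{-1}\mathbb E J(1)<r$ (componentwise). Let $X(t)=(I-P')^{-1}J(t)-rt$. (i) For any initial condition $W(0)=w\in\mathbb R_+^n$, the triplet of vectors $(W(t),B(t),I(t))$ converges in distribution to $((I-P')\overline X,G^X,H^X)$ as $t\to\infty$. (ii) If in (T1) the inequality $p_{ij}>r_j/r_i$ is only required to hold weakly (i.e. $p_{ij}\ge r_j/r_i$ whenever $p_{ij}>0$), while (T2)–(T4) hold, then for any initial condition $W(0)=w\in\mathbb R^n_+$, the triplet of vectors $(W(t),\widetilde B(t),\widetilde I(t))$ converges in distribution to $((I-P')\overline X,G^X,H^X)$ as $t\to\infty$.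
   Context: Tree fluid network $(J,r,P)$: there are $n$ fluid queues; $J=(J_1,\ldots,J_n)'$ is a càdlàg Lévy process with $J(0)=0$ ($J_j(t)$ is the external input to queue $j$ in $[0,t]$); $r=(r_1,\ldots,r_n)'$ has strictly positive entries (drain rates); the routing matrix $P=(p_{ij})$ is nonnegative with $p_{ii}=0$, $\sum_jp_{ij}\le1$, $p_{ij}=0$ for $j<i$, and every column $j\in\{2,\ldots,n\}$ of $P$ has exactly one strictly positive entry (each station other than the root, station 1, is fed by exactly one station). $P'$ is the transpose of $P$. The buffer content $W$ and regulator $L$ are defined by the Skorokhod problem of $Y(t)=J(t)-(I-P')rt$ with initial condition $w$: the unique càdlàg pair with $W(t)=w+Y(t)+(I-P')L(t)$, $W(t)\ge0$, $W(0)=w$, $L(0)=0$, $L$ nondecreasing, and $\sum_j\int_0^\infty W_j(t)\,dL_j(t)=0$. Put $\widetilde W=(I-P')^{-1}W$. Ages of busy and idle periods: $B_j(t)=t-\sup\{s\le t:W_j(s)=0\}$, $I_j(t)=t-\sup\{s\le t:W_j(s)\ne0\}$, and $\widetilde B_j(t),\widetilde I_j(t)$ are defined in the same way with $W_j$ replaced by $\widetilde W_j$ (with $s\ge 0$, and the supremum of the empty set interpreted as $0$); $B(t)=(B_1(t),\ldots,B_n(t))'$ and similarly for $I,\widetilde B,\widetilde I$. For the process $X$: $\overline X_k=\sup_{t\ge0}X_k(t)$, $G_k^X=\inf\{t\ge0:X_k(t)=\overline X_k\text{ or }X_k(t-)=\overline X_k\}$, $H_k^X=\inf\{t\ge0:\sup_{s\ge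 t}X_k(s)\ne X_k(t)\}$, and $\overline X,G^X,H^X$ are the corresponding vectors. *)

(* Defs.v *)
(* Based on MathComp and MathComp-Analysis. *)
From HB Require Import structures.
From mathcomp Require Import all_boot all_order all_algebra.
From mathcomp Require Import all_classical all_reals all_analysis.

Set Implicit Arguments.
Unset Strict Implicit.
Unset Printing Implicit Defensive.

Import Order.TTheory GRing.Theory Num.Theory.
Import numFieldTopology.Exports numFieldNormedType.Exports.

Local Open Scope classical_set_scope.
Local Open Scope ring_scope.

(* Time is [0, +oo[.  Paths are total functions on R whose values at negative
   times are never used.  Stations are numbered from 0, so that the root is
   station 0 and "j in {2, ..., n}" reads (0 < j)%N for j : 'I_n. *)

Section paths.
Context {R : realType}.

Definition cadlag (V : topologicalType) (f : R -> V) : Prop :=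
  (forall t : R, 0 <= t -> f s @[s --> t^'+] --> f t) /\
  (forall t : R, 0 < t -> exists l : V, f s @[s --> t^'-] --> l).

Definition nondecreasing_path (f : R -> R) : Prop :=
  forall s t : R, 0 <= s -> s <= t -> f s <= f t.

(* sup set0 = 0 for the real-valued supremum, as the convention requires. *)
Definition age (A : set R) (t : R) : R :=
  t - sup [set s | [/\ 0 <= s, s <= t & A s]].

Definition busy_age (f : R -> R) (t : R) : R := age [set s | f s = 0] t.

Definition idle_age (f : R -> R) (t : R) : R := age [set s | f s <> 0] t.

(* The functionals X |-> \overline X_k, G^X_k and H^X_k of one coordinate of X.
   They are extended-real valued because the infimum of the empty set is +oo;
   this does occur for H^X_k, when X_k is nonincreasing. *)
Definition path_sup_from (f : R -> R) (t : R) : \bar R :=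
  ereal_sup [set (f s)%:E | s in [set s | t <= s]].

Definition path_sup (f : R -> R) : \bar R := path_sup_from f 0.

(* The left limit at time 0 is taken to be the value at 0. *)
Definition path_G (f : R -> R) : \bar R :=
  ereal_inf [set t%:E | t in [set t | 0 <= t /\
    ((f t)%:E = path_sup f \/
     (0 < t /\ (f s)%:E @[s --> t^'-] --> path_sup f))]].

Definition path_H (f : R -> R) : \bar R :=
  ereal_inf [set t%:E | t in [set t | 0 <= t /\
    path_sup_from f t <> (f t)%:E]].

End paths.

Section probability.
Context {R : realType} {d : measure_display} {Omega : measurableType d}.
Variable Pr : probability Omega R.

Definition borel_set (S : topologicalType) (A : set S) : Prop :=
  <<s (@open S) >> A.

Definition increment n (J : Omega -> R -> 'cV[R]_n) (s t : R) (w : Omega)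
  : 'cV[R]_n := J w t - J w s.

Definition independent_increments n (J : Omega -> R -> 'cV[R]_n) : Prop :=
  forall (k : nat) (t : nat -> R) (A : nat -> set 'cV[R]_n),
    0 <= t 0%N -> (forall i, t i <= t i.+1) -> (forall i, borel_set (A i)) ->
    Pr (\bigcap_(i < k) (increment J (t i) (t i.+1) @^-1` A i)) =
    (\prod_(i < k) Pr (increment J (t i) (t i.+1) @^-1` A i))%E.

Definition stationary_increments n (J : Omega -> R -> 'cV[R]_n) : Prop :=
  forall (s h : R) (A : set 'cV[R]_n), 0 <= s -> 0 <= h -> borel_set A ->
    Pr (increment J s (s + h) @^-1` A) = Pr ((fun w => J w h) @^-1` A).

Definition levy_process n (J : Omega -> R -> 'cV[R]_n) : Prop :=
  [/\ forall (t : R) (i : 'I_n), 0 <= t ->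
        measurable_fun setT (fun w => J w t i ord0),
      forall w, J w 0 = 0,
      forall w, cadlag (J w),
      independent_increments J &
      stationary_increments J].

Definition integrable_process n (J : Omega -> R -> 'cV[R]_n) : Prop :=
  forall (t : R) (i : 'I_n), 0 <= t ->
    Pr.-integrable setT (fun w => (J w t i ord0)%:E).

Definition mean_vector n (Z : Omega -> 'cV[R]_n) : 'cV[R]_n :=
  \col_i fine 'E_Pr[fun w => Z w i ord0]%E.

(* Convergence in distribution as t -> +oo, through bounded continuous test
   functions.  Z t need not be Borel for the given sigma-algebra: the last time
   at which a cadlag path vanishes is in general measurable only for the
   completion of Pr.  As the library's integral of a nonnegative function is the
   supremum of the integrals of the measurable simple functions below it, 'E_Pr
   is the expectation under the completion whenever f \o Z t is measurable for
   the completion.  In all cases the condition, applied to f + c and c - f, says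
   that the inner and the outer expectations of f \o Z t both converge. *)
Definition cvg_in_distribution (S : topologicalType)
    (Z : R -> Omega -> S) (Zoo : Omega -> S) : Prop :=
  forall f : S -> R, continuous f -> (exists M, forall x, `|f x| <= M) ->
    'E_Pr[f \o Z t]%E @[t --> +oo%R] --> 'E_Pr[f \o Zoo]%E.

End probability.

Section networks.
Context {R : realType} {n : nat}.
Implicit Types (r w : 'cV[R]_n) (P : 'M[R]_n).

Definition tree_routing r P : Prop :=
  [/\ (0 < n)%N,
      forall i, 0 < r i ord0,
      (forall i j, 0 <= P i j) /\ (forall i, P i i = 0),
      forall i, \sum_j P i j <= 1 &
      (forall i j : 'I_n, (j < i)%N -> P i j = 0) /\
      (forall j : 'I_n, (0 < j)%N -> exists! i : 'I_n, 0 < P i j)].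

Definition netmx P : 'M[R]_n := 1%:M - P^T.

Definition net_input r P (J : R -> 'cV[R]_n) (t : R) : 'cV[R]_n :=
  J t - t *: (netmx P *m r).

(* X(t) = (I - P')^-1 J(t) - r t *)
Definition free_process r P (J : R -> 'cV[R]_n) (t : R) : 'cV[R]_n :=
  invmx (netmx P) *m J t - t *: r.

(* \sum_j \int_0^oo W_j dL_j = 0, with the Lebesgue-Stieltjes measure of L_j
   extended by 0 to negative times (there is no mass at 0 since L_j 0 = 0). *)
Definition complementarity (W L : R -> 'cV[R]_n) : Prop :=
  exists F : 'I_n -> cumulative R R,
    (forall j t, F j t = if 0 <= t then L t j ord0 else 0) /\
    (\sum_(j < n) \int[lebesgue_stieltjes_measure (F j)]_(t in `[0%R, +oo[)
       (W t j ord0)%:E = 0)%E.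

Definition skorokhod_solution P w (Y W L : R -> 'cV[R]_n) : Prop :=
  [/\ cadlag W /\ cadlag L,
      forall t : R, 0 <= t -> W t = w + Y t + netmx P *m L t,
      forall (t : R) (j : 'I_n), 0 <= t -> 0 <= W t j ord0,
      W 0 = w /\ L 0 = 0 &
      (forall j, nondecreasing_path (fun t => L t j ord0)) /\
      complementarity W L].

Definition component (f : R -> 'cV[R]_n) (j : 'I_n) : R -> R :=
  fun t => f t j ord0.

Definition age_triple (W V : R -> 'cV[R]_n) (t : R) :
    'cV[R]_n * 'cV[\bar R]_n * 'cV[\bar R]_n :=
  (W t, \col_j (busy_age (component V j) t)%:E,
   \col_j (idle_age (component V j) t)%:E).

(* \overline X_k is almost surely finite when X drifts to -oo, so that [fine]
   only fixes a value on a null set. *)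
Definition limit_triple P (X : R -> 'cV[R]_n) :
    'cV[R]_n * 'cV[\bar R]_n * 'cV[\bar R]_n :=
  (netmx P *m \col_k fine (path_sup (component X k)),
   \col_k path_G (component X k), \col_k path_H (component X k)).

End networks.

(* Main.v *)
(* Put V = (I - P')^-1 W and v = (I - P')^-1 w, and let i feed j.  By (T1) and
   (T2), as long as L_i is constant W_j is nondecreasing and grows with L_j; so
   L_j cannot increase while V_i > 0, and since V_j = W_j + p_ij V_i it follows
   along the tree that L_j increases only when V_j = 0: each V_j is the
   one-dimensional Skorokhod reflection of v_j + X_j.  If (T1) is strict, W_j grows
   while V_i > 0, so that W_j(s) = 0 < V_j(s) for s > 0 only when V_j(s-) = 0, and
   almost surely such times do not affect the ages.

   For a reflection, V_j(t), the age of its busy period and the age of its idle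
   period are the supremum, the place of the supremum and the first time off the
   future supremum of the reversed path u |-> X_j(t) - X_j(t-u), with a jump v_j
   added at u = t.  Jointly in j this path has the law of X on [0, t], and as X
   drifts to -oo the same functionals of X on [0, t] converge almost surely to
   those of X on [0, +oo[.  Two facts on Levy processes are needed: at a fixed
   time t, X is almost surely continuous, and X almost surely does not jump
   upwards at the end of an excursion of V_j at which V_j(s-) = 0.

   The drift is proved without the strong law of large numbers: if M_k is the
   maximum of the first k partial sums of the integer skeleton and D the event
   that they are unbounded, E[M_(k+1) - M'_k; D] >= 0 for the shifted maximum M',
   and the integrand tends to the first step on D, so that P(D) = 0 when the mean
   is negative.  No measurability of W is available; all the expectations are
   transferred to functionals of countably many values of X. *)
Require Import Defs.
From HB Require Import structures.
From mathcomp Require Import all_boot all_order all_algebra.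
From mathcomp Require Import all_classical all_reals all_analysis.
From mathcomp Require Import measurable_realfun.
From mathcomp Require Import ring lra zify.

Set Implicit Arguments.
Unset Strict Implicit.
Unset Printing Implicit Defensive.

Import Order.TTheory GRing.Theory Num.Theory.
Import numFieldTopology.Exports numFieldNormedType.Exports.

Local Open Scope classical_set_scope.
Local Open Scope ring_scope.

(** * Almost everywhere equality without measurability, and path spaces *)

(** The Lévy property enters only through [walk_process]: on every mesh the increments of [X] are
    i.i.d. vectors. No filtration and no stopping time in continuous time appears. The strong Markov
    property is used at first hitting indices of mesh walks, and right-continuity carries the
    conclusions to real time. A hitting index on a mesh need not approach the time that it should
    detect; this is the reason for the reduction to the first creeping time and for the limits
    inferior over levels and meshes.

    Time reversal is an exchange of finitely many i.i.d. steps. The functionals compared must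
    therefore be measurable for the product sigma-algebra over countably many times, any finite
    number of which lie on one mesh: the times [t * grid i], with [grid] dyadic in [0, 1]. For a
    fixed [t] these times determine the content and the ages exactly, because paths are càdlàg; only
    for the busy age must upward jumps at the end of excursions be excluded as well. *)

Section nonmeasurable_integrals.
Context {R : realType} {d : measure_display} {T : measurableType d}.
Variable mu : {measure set T -> \bar R}.
Local Open Scope ereal_scope.

Import HBNNSimple.

(** The integral is a supremum over simple functions below the integrand. Cutting such a function
    off on the null set where [f] and [g] may differ keeps its integral and puts it below [g]
    everywhere, so measurability of [f] and [g] is never invoked. *)
Let ge0_le_integral_ae (f g : T -> \bar R) :
  (forall x, 0 <= f x) -> (forall x, 0 <= g x) ->
  {ae mu, forall x, f x = g x} -> \int[mu]_x f x <= \int[mu]_x g x.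
Proof.
move=> f0 g0 [N [mN N0 fgN]]; rewrite [leLHS]ge0_integralTE//.
apply: ge_ereal_sup => _ [h /= hf <-].
have mCN : measurable (~` N) by exact: measurableC.
pose h' := proj_nnsfun h mCN.
have -> : sintegral mu h = sintegral mu h'.
  rewrite -2!integralT_nnsfun; apply: ge0_ae_eq_integral => //.
  - exact/measurable_EFinP.
  - exact/measurable_EFinP.
  - by move=> x _ ; rewrite lee_fin.
  - by move=> x _ ; rewrite lee_fin.
  exists N; split => // x /= /not_implyP[_ hx].
  apply: contrapT => nNx; apply: hx.
  by rewrite /= mindicE mem_set// mulr1.
rewrite ge0_integralTE//; apply: ereal_sup_ubound; exists h' => //= x.
rewrite mindicE; case: (boolP (x \in ~` N)) => xN; last by rewrite mulr0 g0.
rewrite mulr1; apply: le_trans (hf x) _.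
have -> // : f x = g x.
by apply: contrapT => fgx; move: xN; rewrite inE; apply; exact: fgN.
Qed.

Lemma ge0_ae_eq_integral_any (f g : T -> \bar R) :
  (forall x, 0 <= f x) -> (forall x, 0 <= g x) ->
  {ae mu, forall x, f x = g x} -> \int[mu]_x f x = \int[mu]_x g x.
Proof.
move=> f0 g0 fg; apply/eqP; rewrite eq_le !ge0_le_integral_ae//.
by apply: filterS fg.
Qed.

Lemma ae_eq_integral_any (f g : T -> \bar R) :
  {ae mu, forall x, f x = g x} -> \int[mu]_x f x = \int[mu]_x g x.
Proof.
move=> fg; rewrite integralE [RHS]integralE.
by congr (_ - _); apply: ge0_ae_eq_integral_any => //; apply: filterS fg => x e;
  rewrite ?funeposE ?funenegE e.
Qed.

End nonmeasurable_integrals.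

Section cylinders.
Context {R : realType} {I : eqType}.

(** [A] is total but only the indices in [s] constrain, so that an intersection of cylinders is
    again one: they form a pi-system generating the product sigma-algebra. *)
Definition cylinder (s : seq I) (A : I -> set R) : set (I -> R) :=
  [set x | forall i, i \in s -> A i (x i)].

Definition cylinders : set (set (I -> R)) :=
  [set B | exists s A, (forall i, measurable (A i)) /\ B = cylinder s A].

Definition path_space := g_sigma_algebraType cylinders.

HB.instance Definition _ := Measurable.on path_space.

Lemma cylinder_setI s1 A1 s2 A2 : cylinder s1 A1 `&` cylinder s2 A2 =
  cylinder (s1 ++ s2) (fun i => (if i \in s1 then A1 i else setT) `&`
                                (if i \in s2 then A2 i else setT)).
Proof.
apply/seteqP; split => [x [h1 h2] i|x h].
  rewrite mem_cat => _; split; case: ifP => // ?; [exact: h1|exact: h2].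
split => i si; have := h i; rewrite mem_cat si ?orbT => /(_ isT)[]; by rewrite ?si.
Qed.

Lemma measurable_cylinder s A : (forall i, measurable (A i)) ->
  measurable (cylinder s A : set path_space).
Proof. by move=> mA; apply: sub_sigma_algebra; exists s, A. Qed.

Lemma measurable_coord (i : I) :
  measurable_fun setT (fun x : path_space => x i).
Proof.
move=> _ A mA; rewrite setTI.
have -> : (fun x : path_space => x i) @^-1` A = cylinder [:: i] (fun=> A).
  apply/seteqP; split => x /=; first by move=> xA j; rewrite inE => /eqP ->.
  by apply; rewrite inE.
exact: measurable_cylinder.
Qed.

Lemma measurable_path d (T : measurableType d) (f : T -> path_space) :
  (forall i, measurable_fun setT (fun t => f t i)) -> measurable_fun setT f.
Proof.
move=> mf; apply: (@measurability _ _ _ path_space setT f cylinders) => // _ [_ [s [A [mA ->]] <-]].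
rewrite setTI.
have -> : f @^-1` cylinder s A =
    \bigcap_(i in [set` s]) ((fun t => f t i) @^-1` A i).
  by apply/seteqP; split => x /= h i si; exact: h.
apply: fin_bigcap_measurable => // i _.
by rewrite -[_ @^-1` _]setTI; exact: mf.
Qed.

Lemma path_measure_unique (m1 m2 : {measure set path_space -> \bar R}) :
  (m1 setT < +oo)%E ->
  (forall s A, (forall i, measurable (A i)) ->
     m1 (cylinder s A) = m2 (cylinder s A)) ->
  forall B, measurable B -> m1 B = m2 B.
Proof.
move=> m1oo m12 B mB.
apply: (@g_sigma_algebra_measure_unique _ R path_space cylinders _ (fun=> setT)) => //.
- by move=> _ [s [A [mA ->]]]; exact: measurable_cylinder.
- by move=> _; exists [::], (fun=> setT); split => //; apply/seteqP; split.
- by rewrite bigcup_const//; exists 0%N.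
- move=> _ _ [s [A [mA ->]]] [s' [A' [mA' ->]]]; rewrite cylinder_setI.
  eexists _, _; split; last by [].
  by move=> i; apply: measurableI; case: ifP.
- by move=> _ [s [A [mA ->]]]; exact: m12.
Qed.

End cylinders.
Arguments path_space R I : clear implicits.

(** * Random walks embedded in a Levy process *)

Section stationary_walk.
Context {R : realType} {d : measure_display} {Omega : measurableType d}.
Variables (Pr : probability Omega R) (n : nat) (X : Omega -> R -> 'I_n -> R).

Local Notation walk := (path_space R (nat * 'I_n)%type).

Definition steps (h : R) (w : Omega) : walk :=
  fun p => X w (p.1.+1%:R * h) p.2 - X w (p.1%:R * h) p.2.

Definition walk_head (k : nat) (x : walk) : walk :=
  fun p => if (p.1 < k)%N then x p else 0.

Definition walk_tail (k : nat) (x : walk) : walk :=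
  fun p => x ((p.1 + k)%N, p.2).

Definition box_prob (h : R) (B : 'I_n -> set R) : \bar R :=
  Pr [set w | forall l, B l (X w h l)].

(** All that is used of the Lévy property. A box constrains all stations at one step, so steps are
    independent across [i] while stations stay dependent within a step. Stationarity is contained in
    [box_prob], which looks at the first step only. *)
Definition walk_process : Prop :=
  [/\ forall t l, 0 <= t -> measurable_fun setT (fun w => X w t l),
      forall w l, X w 0 l = 0 &
      forall h N (A : nat -> 'I_n -> set R), 0 <= h ->
        (forall i l, measurable (A i l)) ->
        Pr [set w | forall i, (i < N)%N -> forall l, A i l (steps h w (i, l))] =
        (\prod_(i < N) box_prob h (A i))%E].

Hypothesis walkX : walk_process.

Lemma measurable_walk_head k : measurable_fun setT (walk_head k).
Proof.
apply: measurable_path => p; rewrite /walk_head; case: (_ < _)%N.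
  exact: (measurable_coord p).
exact: measurable_cst.
Qed.

Lemma measurable_walk_tail k : measurable_fun setT (walk_tail k).
Proof.
by apply: measurable_path => p; exact: (measurable_coord ((p.1 + k)%N, p.2)).
Qed.

Lemma measurable_steps h : 0 <= h -> measurable_fun setT (steps h).
Proof.
move=> h0; apply: measurable_path => p; case: walkX => mX _ _.
by apply: measurable_funB; apply: mX; rewrite mulr_ge0.
Qed.

Lemma measurable_preimage d1 d2 (T1 : measurableType d1) (T2 : measurableType d2)
  (f : T1 -> T2) A : measurable_fun setT f -> measurable A ->
  measurable (f @^-1` A).
Proof. by move=> mf mA; rewrite -[_ @^-1` _]setTI; exact: mf. Qed.

Let sel (s : seq (nat * 'I_n)) (A : nat * 'I_n -> set R) i l : set R :=
  if (i, l) \in s then A (i, l) else setT.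

Lemma steps_cylinder h s A N : 0 <= h -> (forall p, measurable (A p)) ->
  (forall p, p \in s -> (p.1 < N)%N) ->
  Pr (steps h @^-1` cylinder s A) = (\prod_(i < N) box_prob h (sel s A i))%E.
Proof.
move=> h0 mA sN; case: walkX => _ _ <-//; last first.
  by move=> i l; rewrite /sel; case: ifP.
congr (Pr _); apply/seteqP; split => w /= H.
  by move=> i iN l; rewrite /sel; case: ifP => // /H.
move=> [i l] ps; have := H i (sN _ ps) l; by rewrite /sel ps.
Qed.

Lemma ub_indices (s : seq (nat * 'I_n)) :
  exists N, forall p, p \in s -> (p.1 < N)%N.
Proof.
elim: s => [|p s [N HN]]; first by exists 0%N.
exists (maxn N p.1.+1) => q; rewrite inE => /orP[/eqP -> |/HN].
  by rewrite leq_max ltnSn orbT.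
by move=> ?; rewrite leq_max; apply/orP; left.
Qed.

(** Exchangeability: on a cylinder both sides are products of the same factors in a different order.
    Beyond [K], every initial segment of indices is permuted by [s]; the reversal of a finite block
    is the case needed. *)
Lemma steps_law_perm h (s : nat -> nat) K : 0 <= h -> involutive s ->
  (forall N, (K <= N)%N -> forall i, (s i < N)%N = (i < N)%N) ->
  forall B, measurable B ->
  Pr ((fun w => (fun p => steps h w (s p.1, p.2)) : walk) @^-1` B) =
  Pr (steps h @^-1` B).
Proof.
move=> h0 ss sN B mB.
pose perm (x : walk) : walk := fun p => x (s p.1, p.2).
have mperm : measurable_fun setT perm.
  by apply: measurable_path => p; exact: (measurable_coord (s p.1, p.2)).
have mst := measurable_steps h0.
have mst' : measurable_fun setT (perm \o steps h) by exact: measurableT_comp.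
apply: (@path_measure_unique _ _
  (measure_function_pushforward__canonical__measure_function_Measure Pr mst')
  (measure_function_pushforward__canonical__measure_function_Measure Pr mst)) => //.
  by rewrite /= /pushforward preimage_setT probability_setT ltry.
move=> r A mA; rewrite /= /pushforward.
have -> : (perm \o steps h) @^-1` cylinder r A = steps h @^-1`
    cylinder [seq (s p.1, p.2) | p <- r] (fun p => A (s p.1, p.2)).
  apply/seteqP; split => w /= H.
    by move=> _ /mapP[p pr ->] /=; rewrite ss; have := H p pr; rewrite -surjective_pairing.
  move=> p pr; rewrite /perm; have := H (s p.1, p.2).
  by rewrite /= ss -surjective_pairing; apply; apply/mapP; exists p.
have [N0 HN0] := ub_indices r.
pose N := maxn N0 K.
have HN p : p \in r -> (p.1 < N)%N.
  by move=> /HN0 pN; rewrite leq_max pN.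
have KN : (K <= N)%N by rewrite leq_maxr.
rewrite (@steps_cylinder _ _ _ N)//; last first.
  by move=> _ /mapP[p /HN pr ->] /=; rewrite sN.
rewrite (@steps_cylinder _ _ _ N)//.
have -> : (\prod_(i < N) box_prob h (sel r A i) =
          \prod_(i <- map s (index_iota 0 N)) box_prob h (sel r A i))%E.
  rewrite -(big_mkord xpredT (fun i => box_prob h (sel r A i))) .
  apply: perm_big; apply: uniq_perm; rewrite ?map_inj_uniq ?iota_uniq//.
    exact: inv_inj.
  move=> i; rewrite mem_index_iota/=; apply/idP/mapP => [iN|[j]].
    by exists (s i); rewrite ?ss// mem_index_iota/= sN.
  by rewrite mem_index_iota/= => jN ->; rewrite sN.
rewrite big_map -(big_mkord xpredT (fun i => box_prob h (sel _ _ i))).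
apply: eq_bigr => i _; congr (box_prob h _); apply/funext => l.
rewrite /sel /=.
have -> : ((i, l) \in [seq (s p.1, p.2) | p <- r]) = ((s i, l) \in r) => //.
apply/mapP/idP => [[[j m] pr] /= [-> ->]|pr].
  by rewrite ss.
by exists (s i, l) => //=; rewrite ss.
Qed.

(** The product formula holds on cylinders and extends one factor at a time, by uniqueness of a
    finite measure. Besides independence it contains that the tail has the law of the whole walk. *)
Lemma steps_indep h k A B : 0 <= h -> measurable A -> measurable B ->
  Pr [set w | A (walk_head k (steps h w)) /\ B (walk_tail k (steps h w))] =
  (Pr [set w | A (walk_head k (steps h w))] * Pr [set w | B (steps h w)])%E.
Proof.
move=> h0 mA mB.
have mst := measurable_steps h0.
have mhd : measurable_fun setT (walk_head k \o steps h).
  by apply: measurableT_comp => //; exact: measurable_walk_head.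
have mtl : measurable_fun setT (walk_tail k \o steps h).
  by apply: measurableT_comp => //; exact: measurable_walk_tail.
have fin U : measurable U -> Pr U \is a fin_num by move=> mU; exact: fin_num_measure.
have cyl s1 A1 s2 A2 : (forall p, measurable (A1 p)) -> (forall p, measurable (A2 p)) ->
  Pr (((walk_head k \o steps h) @^-1` cylinder s1 A1) `&`
      ((walk_tail k \o steps h) @^-1` cylinder s2 A2)) =
  (Pr ((walk_head k \o steps h) @^-1` cylinder s1 A1) *
   Pr (steps h @^-1` cylinder s2 A2))%E.
  move=> mA1 mA2.
  (* The head is padded with zeros, so a constraint on an index from [k] on either fails everywhere
     or is void. *)
  have [[p [ps kp Ap]]|good] := pselect
      (exists p, [/\ p \in s1, (k <= p.1)%N & ~ A1 p 0]).
    have -> : (walk_head k \o steps h) @^-1` cylinder s1 A1 = set0.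
      apply/seteqP; split => // w /= /(_ p ps).
      by rewrite /walk_head ltnNge kp.
    by rewrite set0I measure0 mul0e.
  pose s1' := [seq p <- s1 | (p.1 < k)%N].
  have -> : (walk_head k \o steps h) @^-1` cylinder s1 A1 =
            steps h @^-1` cylinder s1' A1.
    apply/seteqP; split => w /= H p.
      rewrite mem_filter => /andP[pk ps].
      by have := H p ps; rewrite /walk_head pk.
    move=> ps; rewrite /walk_head; case: ifPn => pk.
      by apply: H; rewrite mem_filter pk.
    apply: contrapT => nA; apply: good; exists p; split => //.
    by rewrite leqNgt.
  pose s := s1' ++ [seq ((p.1 + k)%N, p.2) | p <- s2].
  pose A' p := if (p.1 < k)%N then A1 p else A2 ((p.1 - k)%N, p.2).
  have mA' p : measurable (A' p) by rewrite /A'; case: ifP.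
  have [N HN] := ub_indices s2.
  have -> : (steps h @^-1` cylinder s1' A1) `&`
      ((walk_tail k \o steps h) @^-1` cylinder s2 A2) = steps h @^-1` cylinder s A'.
    apply/seteqP; split => [w [/= H1 H2] p|w /= H].
      rewrite mem_cat => /orP[ps|/mapP[q qs ->]] /=.
        move: (ps); rewrite mem_filter /A' => /andP[-> _]; exact: H1.
      rewrite /A' /= ltnNge leq_addl /= addnK.
      by have := H2 q qs; rewrite /walk_tail -surjective_pairing.
    split => [p ps|q qs] /=.
      have := H p; rewrite mem_cat ps => /(_ isT).
      by move: ps; rewrite mem_filter /A' => /andP[-> _].
    have := H ((q.1 + k)%N, q.2); rewrite mem_cat.
    rewrite (_ : _ \in map _ _) ?orbT; last by apply/mapP; exists q.
    by move/(_ isT); rewrite /A' /= ltnNge leq_addl /= addnK -surjective_pairing.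
  rewrite (@steps_cylinder _ _ _ (k + N)%N)//; last first.
    move=> p; rewrite mem_cat => /orP[|/mapP[q /HN qN ->] /=].
      by rewrite mem_filter => /andP[pk _]; rewrite ltn_addr.
    by rewrite addnC ltn_add2l.
  rewrite (@steps_cylinder _ _ _ k)//; last first.
    by move=> p; rewrite mem_filter => /andP[].
  rewrite (@steps_cylinder _ _ _ N)// big_split_ord/=; congr (_ * _)%E.
    apply: eq_bigr => i _; congr (box_prob h _); apply/funext => l.
    rewrite /sel /A' /= ltn_ord mem_cat.
    have -> : ((i : nat, l) \in [seq ((p.1 + k)%N, p.2) | p <- s2]) = false.
      apply/negbTE/mapP => -[q _ [iq _]].
      by have := ltn_ord i; rewrite iq ltnNge leq_addl.
    by rewrite orbF.
  apply: eq_bigr => i _; congr (box_prob h _); apply/funext => l.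
  rewrite /sel /A' /= mem_cat mem_filter /= ltnNge leq_addr /= [(k + i)%N]addnC addnK.
  have -> : ((i + k, l)%N \in [seq ((p.1 + k)%N, p.2) | p <- s2]) = ((i : nat, l) \in s2) => //.
  apply/mapP/idP => [[[j m] qs /= [/addIn -> ->]] //|H].
  by exists (i : nat, l).
have gen1 s1 A1 : (forall p, measurable (A1 p)) -> forall B, measurable B ->
  Pr (((walk_head k \o steps h) @^-1` cylinder s1 A1) `&`
      ((walk_tail k \o steps h) @^-1` B)) =
  (Pr ((walk_head k \o steps h) @^-1` cylinder s1 A1) * Pr (steps h @^-1` B))%E.
  move=> mA1 B' mB'.
  set U := (walk_head k \o steps h) @^-1` cylinder s1 A1.
  have mU : measurable U.
    by apply: measurable_preimage => //; exact: measurable_cylinder.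
  have U0 : (0 <= fine (Pr U))%R by rewrite fine_ge0.
  (* [Pr] restricted to [U] and pushed along the tail is compared with the law of the walk scaled by
     [Pr U]; below, the head and the tail exchange roles. *)
  pose m1 := measure_function_pushforward__canonical__measure_function_Measure
               (measure_function_mrestr__canonical__measure_function_Measure Pr mU) mtl.
  pose m2 := measure_function_mscale__canonical__measure_function_Measure
     (NngNum U0)
     (measure_function_pushforward__canonical__measure_function_Measure Pr mst).
  have := @path_measure_unique _ _ m1 m2.
  rewrite /= /pushforward /mscale /mrestr /= => H.
  rewrite setIC H//.
  - by rewrite fineK//; exact: fin.
  - by rewrite preimage_setT setTI (le_lt_trans (probability_le1 _ _)) ?ltry.
  - move=> s A0 mA0; rewrite setIC cyl// fineK//; exact: fin.
set V := steps h @^-1` B.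
have mV : measurable V by apply: measurable_preimage.
set V' := (walk_tail k \o steps h) @^-1` B.
have mV' : measurable V' by apply: measurable_preimage.
have V0 : (0 <= fine (Pr V))%R by rewrite fine_ge0.
pose m1 := measure_function_pushforward__canonical__measure_function_Measure
               (measure_function_mrestr__canonical__measure_function_Measure Pr mV') mhd.
pose m2 := measure_function_mscale__canonical__measure_function_Measure
     (NngNum V0)
     (measure_function_pushforward__canonical__measure_function_Measure Pr mhd).
have := @path_measure_unique _ _ m1 m2.
rewrite /= /pushforward /mscale /mrestr /= => H.
have -> : [set w | A (walk_head k (steps h w)) /\ B (walk_tail k (steps h w))] =
  ((walk_head k \o steps h) @^-1` A) `&` V' by [].
rewrite H//.
- by rewrite fineK ?fin_num_measure//; exact: muleC.
- by rewrite preimage_setT setTI (le_lt_trans (probability_le1 _ _)) ?ltry.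
- move=> s A0 mA0; by rewrite gen1// fineK ?fin_num_measure//; exact: muleC.
Qed.

End stationary_walk.

(** * Cadlag paths *)

Section cadlag_paths.
Context {R : realType}.
Implicit Types (f : R -> R) (a b t e : R).

(** The supremum of the times up to which [Q] holds is such a time by the last hypothesis and cannot
    lie below [b] by the one before. This stands in for compactness of [a, b]: right-continuity and
    left limits supply the two rules. *)
Lemma real_induction a b (Q : R -> Prop) : a <= b -> Q a ->
  (forall t, a <= t < b -> (forall s, a <= s <= t -> Q s) ->
     exists2 e, 0 < e & forall s, t < s < t + e -> Q s) ->
  (forall t, a < t <= b -> (forall s, a <= s < t -> Q s) -> Q t) ->
  forall t, a <= t <= b -> Q t.
Proof.
move=> ab Qa Qr Ql.
pose A := [set t | a <= t <= b /\ forall s, a <= s <= t -> Q s].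
have Aa : A a.
  by split; rewrite ?lexx// => s /andP[as_ sa]; rewrite (_ : s = a)//; lra.
have supA : has_sup A by split; [exists a|exists b => t [/andP[]]].
pose c := sup A.
have Ac t : A t -> t <= c by move=> At; apply: ub_le_sup => //; case: supA.
have ac : a <= c by exact: Ac.
have cb : c <= b by apply: ge_sup; [exists a|move=> t [/andP[]]].
have Qc s : a <= s < c -> Q s.
  move=> /andP[as_ sc]; have cs : 0 < c - s by rewrite subr_gt0.
  have [t [At Qt] st] := sup_adherent cs supA.
  by apply: Qt; rewrite as_ ltW//; move: st; rewrite subKr.
have {}Qc s : a <= s <= c -> Q s.
  move=> /andP[as_]; rewrite le_eqVlt => /orP[/eqP ->|sc]; last first.
    by apply: Qc; rewrite as_.
  have [<-//|acn] := eqVneq a c.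
  by apply: Ql => //; rewrite lt_neqAle acn ac cb.
have cbE : c = b.
  apply/eqP; rewrite eq_le cb /= leNgt; apply/negP => cltb.
  have [|e e0 He] := Qr c _ Qc; first by rewrite ac.
  pose u := Num.min b (c + e / 2).
  have cu : c < u by rewrite lt_min cltb ltrDl divr_gt0.
  have : A u.
    split; first by rewrite (le_trans ac (ltW cu)) ge_min lexx.
    move=> s /andP[as_ su]; have [sc|cs] := leP s c; first by apply: Qc; rewrite as_.
    apply: He; rewrite cs (le_lt_trans su)// gt_min; apply/orP; right.
    by rewrite ltrD2l; lra.
  by move=> /Ac; rewrite leNgt cu.
by move=> t; rewrite -cbE; exact: Qc.
Qed.

Lemma cadlag_right f t e : cadlag f -> 0 <= t -> 0 < e ->
  exists2 d, 0 < d & forall s, t <= s < t + d -> `|f s - f t| < e.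
Proof.
move=> [rf _] t0 e0; have /cvgrPdist_lt/(_ e e0) := rf t t0.
rewrite near_withinE => -[d /= d0 H]; exists d => // s /andP[].
rewrite le_eqVlt => /orP[/eqP <- _|ts std]; first by rewrite subrr normr0.
rewrite distrC; apply: H => //=.
by rewrite ltr_norml; apply/andP; split; lra.
Qed.

Lemma cadlag_left f t : cadlag f -> 0 < t -> exists l, forall e, 0 < e ->
  exists2 d, 0 < d <= t & forall s, t - d <= s < t -> `|f s - l| < e.
Proof.
move=> [_ lf] t0; have [l fl] := lf t t0; exists l => e e0.
have /cvgrPdist_lt/(_ e e0) := fl.
rewrite near_withinE => -[d /= d0 H].
exists (Num.min (d / 2) t); first by rewrite lt_min t0 ge_min lexx orbT divr_gt0.
move=> s /andP[ts st]; rewrite distrC; apply: H => //=.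
have td : Num.min (d / 2) t <= d / 2 by rewrite ge_min lexx.
by rewrite ltr_norml; apply/andP; split; lra.
Qed.

Lemma cadlag_bounded f b : cadlag f -> 0 <= b ->
  exists C, forall s, 0 <= s <= b -> `|f s| <= C.
Proof.
move=> cf b0.
pose Q t := exists C, forall s, 0 <= s <= t -> `|f s| <= C.
suff : Q b by [].
apply: (@real_induction 0 b Q) => //; last by rewrite b0 lexx.
- exists `|f 0| => s /andP[s0 s0']; rewrite (_ : s = 0)//; lra.
- move=> t /andP[t0 tb] /(_ t); rewrite t0 lexx => /(_ isT)[C HC].
  have [e e0 He] := cadlag_right cf t0 ltr01.
  exists e => // s /andP[ts se]; exists (Num.max C (`|f t| + 1)) => u /andP[u0 us].
  rewrite le_max; have [ut|tu] := leP u t; first by rewrite HC// u0.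
  apply/orP; right.
  have := He u; rewrite (ltW tu) (le_lt_trans us se) => /(_ isT) H.
  have := ler_normD (f u - f t) (f t); rewrite subrK; lra.
- move=> t /andP[t0 tb] HQ.
  have [l Hl] := cadlag_left cf t0; have [e /andP[e0 et] He] := Hl 1 ltr01.
  have [|C HC] := HQ (t - e); first by apply/andP; split; lra.
  exists (Num.max C (Num.max (`|l| + 1) `|f t|)) => u /andP[u0 ut].
  rewrite !le_max; have [ut'|tu] := leP u (t - e); first by rewrite HC// u0.
  apply/orP; right; move: ut; rewrite le_eqVlt => /orP[/eqP ->|ut].
    by rewrite lexx orbT.
  apply/orP; left; have := He u; rewrite (ltW tu) ut => /(_ isT) H.
  have := ler_normD (f u - l) l; rewrite subrK; lra.
Qed.

(** If [m] is neither a value nor a left limit, being bounded away from [m] on [a, t] propagates by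
    [real_induction] up to [t = b], against the approximation hypothesis. *)
Lemma cadlag_inf_attained f a b m : cadlag f -> 0 <= a <= b ->
  (forall e, 0 < e -> exists2 s, a <= s <= b & f s < m + e) ->
  (forall s, a <= s <= b -> m <= f s) ->
  exists2 v, a <= v <= b & f v = m \/
    (a < v /\ forall e, 0 < e ->
      exists2 d, 0 < d <= v - a & forall s, v - d <= s < v -> `|f s - m| < e).
Proof.
move=> cf /andP[a0 ab] Hm mf; apply: contrapT => no.
pose Q t := exists2 e, 0 < e & forall s, a <= s <= t -> m + e <= f s.
suff [e e0 He] : Q b.
  by have [s sab] := Hm e e0; rewrite ltNge He.
have pos v : a <= v <= b -> m < f v.
  move=> vab; rewrite lt_neqAle mf// andbT eq_sym; apply/eqP => fv; apply: no.
  by exists v => //; left.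
apply: (@real_induction a b Q) => //; last by rewrite ab lexx.
- exists (f a - m); first by rewrite subr_gt0 pos// lexx ab.
  by move=> s /andP[as_ sa]; rewrite (_ : s = a); lra.
- move=> t /andP[at_ tb] /(_ t); rewrite at_ lexx => /(_ isT)[e e0 He].
  have ft : m < f t by rewrite pos// at_ ltW.
  have ft0 : 0 < (f t - m) / 2 by rewrite divr_gt0// subr_gt0.
  have [d d0 Hd] := cadlag_right cf (le_trans a0 at_) ft0.
  exists d => // s /andP[ts sd]; exists (Num.min e ((f t - m) / 2)).
    by rewrite lt_min e0.
  move=> u /andP[au us].
  have m1 : Num.min e ((f t - m) / 2) <= e by rewrite ge_min lexx.
  have m2 : Num.min e ((f t - m) / 2) <= (f t - m) / 2 by rewrite ge_min lexx orbT.
  have [ut|tu] := leP u t.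
    by have := He u; rewrite au ut => /(_ isT); lra.
  have := Hd u; rewrite (ltW tu) (le_lt_trans us sd) => /(_ isT).
  rewrite ltr_norml => /andP[]; lra.
- move=> t /andP[at_ tb] HQ.
  have [l Hl] := cadlag_left cf (le_lt_trans a0 at_).
  have Hl' e : 0 < e -> exists2 d, 0 < d <= t - a & forall s, t - d <= s < t -> `|f s - l| < e.
    move=> /Hl[d /andP[d0 dt] Hd]; exists (Num.min d (t - a)).
      by rewrite lt_min d0 subr_gt0 at_ ge_min lexx orbT.
    move=> s /andP[ts st]; apply: Hd; rewrite st andbT.
    by apply: le_trans ts; rewrite lerD2l lerN2 ge_min lexx.
  have ml : m < l.
    rewrite lt_neqAle; apply/andP; split.
      apply/eqP => lm; apply: no; exists t; first by rewrite (ltW at_).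
      by right; split=> //; rewrite lm.
    rewrite leNgt; apply/negP => lm.
    have [|d /andP[d0 dt] Hd] := Hl' (m - l); first by rewrite subr_gt0.
    have /Hd : t - d <= t - d < t by rewrite lexx ltrBlDr ltrDl d0.
    have /mf : a <= t - d <= b by apply/andP; split; lra.
    by rewrite ltr_norml => ? /andP[]; lra.
  have [|d /andP[d0 dt] Hd] := Hl' ((l - m) / 2); first by rewrite divr_gt0// subr_gt0.
  have [|e e0 He] := HQ (t - d); first by apply/andP; split; lra.
  have ft : m < f t by rewrite pos// (ltW at_).
  exists (Num.min e (Num.min ((l - m) / 2) (f t - m))).
    by rewrite !lt_min e0 subr_gt0 ft divr_gt0// subr_gt0.
  set x := Num.min _ _.
  have m1 : x <= e by rewrite ge_min lexx.
  have m2 : x <= (l - m) / 2 by rewrite !ge_min lexx orbT.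
  have m3 : x <= f t - m by rewrite !ge_min lexx !orbT.
  move=> u /andP[au]; rewrite le_eqVlt => /orP[/eqP ->|ut]; first by lra.
  have [ut'|tu] := leP u (t - d).
    by have := He u; rewrite au ut' => /(_ isT); lra.
  have := Hd u; rewrite (ltW tu) ut => /(_ isT); rewrite ltr_norml => /andP[]; lra.
Qed.

Lemma cadlag_add_linear f (a : R) :
  cadlag f -> cadlag (fun t => f t + a * t).
Proof.
move=> [rf lf]; split => [s s0|s s0].
  apply: cvgD; first exact: rf.
  by apply: cvgM; [exact: cvg_cst|exact: cvg_at_right_filter].
have [y Hy] := lf s s0; exists (y + a * s); apply: cvgD => //.
by apply: cvgM; [exact: cvg_cst|exact: cvg_at_left_filter].
Qed.

Definition dyadic (m k : nat) : R := k%:R / (2 ^ m)%:R.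

Lemma dyadic_dense t e : 0 <= t -> 0 < e -> exists m0, forall m, (m0 <= m)%N ->
  exists k, t < dyadic m k < t + e.
Proof.
move=> t0 e0.
have [m0 Hm0] : exists m0, e^-1 < (2 ^ m0)%:R :> R.
  exists (Num.truncn e^-1).+1.
  apply: lt_trans (truncnS_gt _) _; rewrite ltr_nat; exact: ltn_expl.
exists m0 => m m0m.
have m2 : 0 < (2 ^ m)%:R :> R by rewrite ltr0n expn_gt0.
have em : 1 < e * (2 ^ m)%:R.
  rewrite mulrC -ltr_pdivrMr// div1r; apply: lt_le_trans Hm0 _.
  by rewrite ler_nat leq_pexp2l.
have tm : 0 <= t * (2 ^ m)%:R by rewrite mulr_ge0// ltW.
exists (Num.truncn (t * (2 ^ m)%:R)).+1; rewrite /dyadic.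
rewrite ltr_pdivlMr// truncnS_gt ltr_pdivrMr// mulrDl -natr1.
by have := truncn_le (t * (2 ^ m)%:R); rewrite tm; lra.
Qed.

End cadlag_paths.

(** * First passage times of random walks *)

Section first_passage.
Context {R : realType} {d : measure_display} {Omega : measurableType d}.
Variables (Pr : probability Omega R) (n : nat) (X : Omega -> R -> 'I_n -> R).
Hypothesis walkX : walk_process Pr X.
Variables (h : R) (h0 : 0 <= h).

Local Notation walk := (path_space R (nat * 'I_n)%type).
Variables (C B : nat -> set walk).
Hypotheses (mC : forall k, measurable (C k)) (mB : forall k, measurable (B k)).

(** [C k] is tested on the first [k] steps only, so that the hitting index is a stopping time. *)
Definition first_hit (k : nat) : set Omega :=
  [set w | C k (walk_head k (steps X h w)) /\
    forall i, (i < k)%N -> ~ C i (walk_head i (steps X h w))].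

Definition hit_then (K : nat) : set Omega :=
  \bigcup_(k < K) (first_hit k `&`
                   [set w | B k (walk_tail k (steps X h w))]).

(** Turns a first hit at [k] into one event of [walk_head k], the form to which [steps_indep]
    applies. *)
Let C' k : set walk := C k `\` \bigcup_(i < k) (walk_head i @^-1` C i).

Let mC' k : measurable (C' k).
Proof.
apply: measurableD => //; apply: bigcup_measurable => i _.
by apply: measurable_preimage => //; exact: measurable_walk_head.
Qed.

Let walk_headK i k (x : walk) : (i <= k)%N ->
  walk_head i (walk_head k x) = walk_head i x.
Proof.
move=> ik; apply/funext => p; rewrite /walk_head; case: ifPn => // pi.
by rewrite (leq_trans pi).
Qed.

Let first_hitE k :
  first_hit k = [set w | C' k (walk_head k (steps X h w))].
Proof.
apply/seteqP; split => w /= [Ck Ci]; split => //.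
  by move=> [i /= ik]; rewrite walk_headK; [exact: Ci|exact: ltnW].
move=> i ik Cw; apply: Ci; exists i => //=.
by rewrite walk_headK// ltnW.
Qed.

Let mst := measurable_steps walkX h0.

Lemma measurable_first_hit k : measurable (first_hit k).
Proof.
rewrite first_hitE.
rewrite [X in measurable X](_ : _ = (walk_head k \o steps X h) @^-1` C' k)//.
apply: measurable_preimage => //; apply: measurableT_comp => //.
exact: measurable_walk_head.
Qed.

Let mBt k : measurable [set w | B k (walk_tail k (steps X h w))].
Proof.
rewrite [X in measurable X](_ : _ = (walk_tail k \o steps X h) @^-1` B k)//.
apply: measurable_preimage => //; apply: measurableT_comp => //.
exact: measurable_walk_tail.
Qed.

Lemma measurable_hit_then K : measurable (hit_then K).
Proof.
by apply: bigcup_measurable => k _; apply: measurableI => //; exact: measurable_first_hit.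
Qed.

Let triv : trivIset setT first_hit.
Proof.
apply/trivIsetP => i j _ _ ij; apply/seteqP; split => // w [[Ci Hi] [Cj Hj]].
by case: (ltngtP i j) ij => // ij _; [apply: Hj Ci|apply: Hi Cj].
Qed.

(** The strong Markov property at a discrete stopping time: the events are disjoint in [k] and each
    factors into past and future. [B] varies with [k] because in Ottaviani's inequality the time
    left until the next integer does. *)
Lemma prob_hit_then K : Pr (hit_then K) =
  (\sum_(k < K) Pr (first_hit k) * Pr [set w | B k (steps X h w)])%E.
Proof.
rewrite /hit_then bigcup_mkord.
pose F k := first_hit k `&` [set w | B k (walk_tail k (steps X h w))].
have mF k : measurable (F k) by apply: measurableI => //; exact: measurable_first_hit.
have tF : trivIset setT F.
  apply/trivIsetP => i j _ _ ij; move/trivIsetP : triv => /(_ i j Logic.I Logic.I ij).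
  by rewrite /F setIACA => ->; rewrite set0I.
rewrite -/F (measure_bigsetU Pr mF tF); apply: eq_bigr => k _.
by rewrite /F first_hitE -(steps_indep walkX).
Qed.

Lemma bigcup_first_hit K : \bigcup_(k < K) first_hit k =
  \bigcup_(k < K) [set w | C k (walk_head k (steps X h w))].
Proof.
apply/seteqP; split => w [k /= kK]; first by move=> [Ck _]; exists k.
elim/ltn_ind: k kK => k IH kK Ck.
have [[i [ik Ci]]|no] := pselect (exists i, (i < k)%N /\
    C i (walk_head i (steps X h w))).
  by apply: (IH i) => //; exact: ltn_trans kK.
exists k => //; split => // i ik Ci; apply: no; by exists i.
Qed.

Lemma prob_first_hit_sum K : (\sum_(k < K) Pr (first_hit k))%E =
  Pr (\bigcup_(k < K) [set w | C k (walk_head k (steps X h w))]).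
Proof.
rewrite -bigcup_first_hit bigcup_mkord.
by rewrite (measure_bigsetU Pr measurable_first_hit triv).
Qed.

Lemma prob_hit_then_le K (p : \bar R) : (0 <= p)%E ->
  (forall k, (k < K)%N -> Pr [set w | B k (steps X h w)] <= p)%E ->
  (Pr (hit_then K) <= p)%E.
Proof.
move=> p0 Bp; rewrite prob_hit_then.
apply: (@le_trans _ _ (\sum_(k < K) p * Pr (first_hit k))%E).
  by apply: lee_sum => k _; rewrite muleC lee_wpmul2r// Bp.
rewrite -ge0_sume_distrr// prob_first_hit_sum.
rewrite -[leRHS]mule1 lee_wpmul2l// probability_le1//.
rewrite -bigcup_first_hit; apply: bigcup_measurable => k _.
exact: measurable_first_hit.
Qed.

Lemma prob_hit_then_ge K (p : \bar R) : (0 <= p)%E ->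
  (forall k, (k < K)%N -> p <= Pr [set w | B k (steps X h w)])%E ->
  (p * Pr (\bigcup_(k < K) [set w | C k (walk_head k (steps X h w))])
   <= Pr (hit_then K))%E.
Proof.
move=> p0 Bp; rewrite prob_hit_then -prob_first_hit_sum ge0_sume_distrr//.
by apply: lee_sum => k _; rewrite [leRHS]muleC lee_wpmul2r// Bp.
Qed.

End first_passage.

(** * Drift to minus infinity *)

Section walk_functionals.
Context {R : realType} {n : nat} (l : 'I_n) (e : R).
Local Notation walk := (path_space R (nat * 'I_n)%type).

Definition walk_sum (k : nat) (x : walk) : R := \sum_(i < k) (x (i : nat, l) + e).

(** The maximum of the partial sums up to index [k], the empty one included, as a Lindley recursion
    from the front: the maximum of the shifted walk then stands next to the first step. *)
Fixpoint walk_max (k : nat) (x : walk) : R :=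
  if k is k'.+1 then Num.max 0 (x (0%N, l) + e + walk_max k' (walk_tail 1 x))
  else 0.

Lemma walk_sumS k x :
  walk_sum k.+1 x = x (0%N, l) + e + walk_sum k (walk_tail 1 x).
Proof.
rewrite /walk_sum big_ord_recl; congr (_ + _); apply: eq_bigr => i _.
by rewrite /walk_tail /= addn1.
Qed.

Lemma walk_sum_head k x : walk_sum k (walk_head k x) = walk_sum k x.
Proof. by apply: eq_bigr => i _; rewrite /walk_head /= ltn_ord. Qed.

Lemma walk_sum_head_le k j x : (j <= k)%N ->
  walk_sum j (walk_head k x) = walk_sum j x.
Proof.
move=> jk; apply: eq_bigr => i _.
by rewrite /walk_head /= (leq_trans (ltn_ord i) jk).
Qed.

Lemma walk_sum_tail k j x :
  walk_sum j (walk_tail k x) = walk_sum (k + j) x - walk_sum k x.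
Proof.
rewrite /walk_sum big_split_ord /= addrAC subrr add0r.
by apply: eq_bigr => i _; rewrite /walk_tail /= addnC.
Qed.

Lemma measurable_walk_sum k : measurable_fun setT (walk_sum k).
Proof.
apply: measurable_sum => i; apply: measurable_funD => //.
exact: (measurable_coord (i : nat, l)).
Qed.

Lemma measurable_walk_max k : measurable_fun setT (walk_max k).
Proof.
elim: k => [|k IH]; first exact: measurable_cst.
apply: measurable_maxr => //; apply: measurable_funD.
  by apply: measurable_funD => //; exact: (measurable_coord (0%N, l)).
by apply: measurableT_comp => //; exact: measurable_walk_tail.
Qed.

Lemma walk_max_ge0 k x : 0 <= walk_max k x.
Proof. by case: k => //= k; rewrite le_max lexx. Qed.

Lemma walk_sum_le_max j k x : (j <= k)%N -> walk_sum j x <= walk_max k x.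
Proof.
elim: k j x => [|k IH] [|j] x //=; rewrite ?/walk_sum ?big_ord0//.
  by rewrite le_max lexx.
by move=> jk; rewrite -/(walk_sum j.+1 x) walk_sumS le_max lerD2l IH// orbT.
Qed.

Lemma walk_max_nondecreasing j k x : (j <= k)%N -> walk_max j x <= walk_max k x.
Proof.
elim: k j x => [|k IH] [|j] x //=; first by rewrite le_max lexx.
by move=> jk; rewrite ge_max le_max lexx /= le_max lerD2l IH// orbT.
Qed.

Definition walk_unbounded : set walk :=
  [set x | forall c : nat, exists k, c%:R < walk_max k x].

Lemma measurable_walk_unbounded : measurable walk_unbounded.
Proof.
rewrite (_ : walk_unbounded = \bigcap_(c in [set: nat]) \bigcup_(k in [set: nat])
   (walk_max k @^-1` `]c%:R, +oo[)).
  apply: bigcapT_measurable => c; apply: bigcupT_measurable => k.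
  by apply: measurable_preimage => //; exact: measurable_walk_max.
apply/seteqP; split => x /= H c.
  by move=> _; have [k ck] := H c; exists k => //=; rewrite in_itv /= ck.
by have [k _ /=] := H c I; rewrite in_itv /= andbT => ck; exists k.
Qed.

Lemma walk_unbounded_tail x :
  walk_unbounded (walk_tail 1 x) <-> walk_unbounded x.
Proof.
have bnd (y : R) : exists c : nat, y <= c%:R.
  exists (Num.truncn y).+1; apply: ltW; exact: truncnS_gt.
split => H c.
  have [c' Hc'] := bnd (c%:R - (x (0%N, l) + e)).
  have [k Hk] := H c'; exists k.+1 => /=; rewrite lt_max; apply/orP; right; lra.
have [c' Hc'] := bnd (`|c%:R + (x (0%N, l) + e)|).
have [[|k] /= Hk] := H c'; first by move: Hk; rewrite ltNge ler0n.
exists k; move: Hk; rewrite lt_max ltNge ler0n /=.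
have := ler_norm (c%:R + (x (0%N, l) + e)); lra.
Qed.

End walk_functionals.

Section drift.
Context {R : realType} {d : measure_display} {Omega : measurableType d}.
Variables (Pr : probability Omega R) (n : nat) (X : Omega -> R -> 'I_n -> R).
Hypothesis walkX : walk_process Pr X.
Variables (l : 'I_n).
Local Notation walk := (path_space R (nat * 'I_n)%type).

Lemma walk_sum_steps h e k w :
  walk_sum l (e * h) k (steps X h w) = X w (k%:R * h) l + e * (k%:R * h).
Proof.
case: walkX => _ X0 _.
elim: k => [|k IH]; first by rewrite /walk_sum big_ord0 mul0r mulr0 X0 addr0.
rewrite /walk_sum big_ord_recr /= -/(walk_sum _ _ _ _) IH /steps /= -natr1; ring.
Qed.

Lemma law_tail h (D : set walk) (g : walk -> \bar R) : 0 <= h -> measurable D ->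
  measurable_fun setT g -> (forall x, 0 <= g x)%E ->
  (\int[Pr]_(w in (walk_tail 1 \o steps X h) @^-1` D) g (walk_tail 1 (steps X h w))
   = \int[Pr]_(w in steps X h @^-1` D) g (steps X h w))%E.
Proof.
move=> h0 mD mg g0; have mst := measurable_steps walkX h0.
have mtl : measurable_fun setT (walk_tail 1 \o steps X h).
  by apply: measurableT_comp => //; exact: measurable_walk_tail.
have mgD : measurable_fun D g by exact: measurable_funTS.
rewrite -[LHS](ge0_integral_pushforward mtl Pr mD mgD)//.
rewrite -[RHS](ge0_integral_pushforward mst Pr mD mgD)//.
apply: eq_measure_integral => A mA _; rewrite /= /pushforward.
have := steps_indep walkX 1 h0 (@measurableT _ _) mA.
rewrite (_ : [set w | _ /\ _] = (walk_tail 1 \o steps X h) @^-1` A); last first.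
  by apply/seteqP; split => w //= [].
rewrite (_ : [set w | [set: walk] _] = setT); last by apply/seteqP; split.
by rewrite probability_setT mul1e.
Qed.

(** By independence, pushing [Pr] restricted to [D] along [f] gives [Pr D] times the law of [f]. *)
Lemma ge0_indep_integral (f : Omega -> R) (D : set Omega) (g : R -> R) :
  measurable D -> measurable_fun setT f -> measurable_fun setT g ->
  (forall x, 0 <= g x) ->
  (forall U, measurable U -> Pr (f @^-1` U `&` D) = (Pr (f @^-1` U) * Pr D)%E) ->
  (\int[Pr]_(w in D) (g (f w))%:E = Pr D * \int[Pr]_w (g (f w))%:E)%E.
Proof.
move=> mD mf mg g0 indep.
pose PD := measure_function_mrestr__canonical__measure_function_Measure Pr mD.
have mg' : measurable_fun setT (EFin \o g) by exact/measurable_EFinP.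
have mgf : measurable_fun setT (fun w => (g (f w))%:E).
  exact: (measurableT_comp mg' mf).
have g0' x : (0 <= (EFin \o g) x)%E by rewrite lee_fin.
have PD0 : 0 <= fine (Pr D) by rewrite fine_ge0.
transitivity (\int[PD]_w (g (f w))%:E)%E.
  rewrite (@ge0_negligible_integral _ _ _ PD setT (~` D))//.
  - rewrite setTD setCK; apply: eq_measure_integral => A mA AD.
    by rewrite /= /mrestr setIidl.
  - exact: measurableC.
  - by move=> w _; rewrite lee_fin.
  - by rewrite /= /mrestr setICl measure0.
rewrite -[LHS](ge0_integral_pushforward mf PD measurableT mg')//.
rewrite -[X in (_ * X)%E](ge0_integral_pushforward mf Pr measurableT mg')//.
rewrite -[Pr D]fineK ?fin_num_measure//.
rewrite -[RHS](ge0_integral_mscale _ _ (NngNum PD0))//.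
apply: eq_measure_integral => A mA _.
by rewrite /= /pushforward /mscale /mrestr /= indep// fineK ?fin_num_measure// muleC.
Qed.

Lemma indep_integral (f : Omega -> R) (D : set Omega) :
  measurable D -> Pr.-integrable setT (EFin \o f) ->
  (forall U, measurable U -> Pr (f @^-1` U `&` D) = (Pr (f @^-1` U) * Pr D)%E) ->
  (\int[Pr]_(w in D) (f w)%:E = Pr D * \int[Pr]_w (f w)%:E)%E.
Proof.
move=> mD intf indep.
have mf : measurable_fun setT f.
  by apply/measurable_EFinP; exact: measurable_int intf.
have mp : measurable_fun [set: R] (fun x : R => Num.max x 0) by exact: measurable_maxr.
have mn : measurable_fun [set: R] (fun x : R => Num.max (- x) 0).
  by apply: measurable_maxr => //; exact: measurable_funN.
have pos := ge0_indep_integral mD mf mp.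
have neg := ge0_indep_integral mD mf mn.
have Ep w : ((EFin \o f)^\+ w = (Num.max (f w) 0)%:E)%E by rewrite funeposE /= EFin_max.
have En w : ((EFin \o f)^\- w = (Num.max (- f w) 0)%:E)%E by rewrite funenegE /= EFin_max.
rewrite integralE [X in (_ = _ * X)%E]integralE.
under [X in (X - _ = _)%E]eq_integral do rewrite Ep.
under [X in (_ - X = _)%E]eq_integral do rewrite En.
under [X in (_ = _ * (X - _))%E]eq_integral do rewrite Ep.
under [X in (_ = _ * (_ - X))%E]eq_integral do rewrite En.
rewrite pos//; last by move=> x; rewrite le_max lexx orbT.
rewrite neg//; last by move=> x; rewrite le_max lexx orbT.
have fin : (\int[Pr]_w (Num.max (- f w) 0)%:E)%E \is a fin_num.
  have := integrable_fin_num measurableT (integrable_funeneg measurableT intf).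
  by under eq_integral do rewrite En.
rewrite [RHS]muleBr ?fin_num_measure//.
by rewrite fin_num_adde_defl// fin_numN.
Qed.

End drift.

Section drift_bound.
Context {R : realType} {d : measure_display} {Omega : measurableType d}.
Variables (Pr : probability Omega R) (n : nat) (X : Omega -> R -> 'I_n -> R).
Hypothesis walkX : walk_process Pr X.
Variables (l : 'I_n) (e : R).
Local Notation walk := (path_space R (nat * 'I_n)%type).
Hypothesis intX : Pr.-integrable setT (fun w => (X w 1 l)%:E).
Hypothesis meanX : (\int[Pr]_w (X w 1 l)%:E + e%:E < 0)%E.

Local Notation A := (walk_unbounded l e).
Local Notation D := (steps X 1 @^-1` A).

Let mA : measurable A. Proof. exact: measurable_walk_unbounded. Qed.

Let mst := measurable_steps walkX (@ler01 R).

Let mD : measurable D. Proof. exact: measurable_preimage. Qed.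

Let xi w := X w 1 l + e.

Let mxi : measurable_fun setT xi.
Proof.
by apply: measurable_funD => //; apply/measurable_EFinP; exact: measurable_int intX.
Qed.

Let intxi : Pr.-integrable setT (EFin \o xi).
Proof.
rewrite (_ : EFin \o xi = (fun w => (X w 1 l)%:E + (cst e%:E) w)%E)//.
by apply: integrableD => //; exact: finite_measure_integrable_cst.
Qed.

Let Exi : (\int[Pr]_w (xi w)%:E < 0)%E.
Proof.
rewrite (_ : (fun w => (xi w)%:E) = (fun w => (X w 1 l)%:E + (cst e%:E) w)%E)//.
rewrite integralD//; last exact: finite_measure_integrable_cst.
rewrite integral_cst//= probability_setT mule1; exact: meanX.
Qed.

Let mx k w := walk_max l e k (steps X 1 w).
Let mx' k w := walk_max l e k (walk_tail 1 (steps X 1 w)).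

Let mxS k w : mx k.+1 w = Num.max 0 (xi w + mx' k w).
Proof.
case: walkX => _ X0 _.
by rewrite /mx /= /mx' /xi {1}/steps /= !mulr1 X0 subr0.
Qed.

Let mmx k : measurable_fun setT (mx k).
Proof. by apply: measurableT_comp => //; exact: measurable_walk_max. Qed.

Let mmx' k : measurable_fun setT (mx' k).
Proof.
apply: measurableT_comp; first exact: measurable_walk_max.
by apply: measurableT_comp => //; exact: measurable_walk_tail.
Qed.

Let DE : (walk_tail 1 \o steps X 1) @^-1` A = D.
Proof.
by apply/seteqP; split => w /=; rewrite walk_unbounded_tail.
Qed.

Let law k : (\int[Pr]_(w in D) (mx' k w)%:E = \int[Pr]_(w in D) (mx k w)%:E)%E.
Proof.
rewrite -{1}DE; apply: (law_tail walkX ler01 mA (g := EFin \o walk_max l e k)).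
  by apply/measurable_EFinP; exact: measurable_walk_max.
by move=> x; rewrite lee_fin walk_max_ge0.
Qed.

(** By induction from the bound [|xi| + mx' k] on the next maximum; over [D], which is
    shift-invariant, [mx' k] has the same mean as [mx k]. *)
Let mx_lty k : (\int[Pr]_(w in D) (mx k w)%:E < +oo)%E.
Proof.
elim: k => [|k IH].
  by rewrite /mx /= integral0 ltry.
apply: (@le_lt_trans _ _
   (\int[Pr]_(w in D) (`|xi w|%:E + (mx' k w)%:E))%E).
  apply: ge0_le_integral => //.
  - by move=> w _; rewrite lee_fin walk_max_ge0.
  - by apply: measurable_funTS; apply/measurable_EFinP.
  - apply: measurable_funTS; apply: emeasurable_funD; apply/measurable_EFinP => //.
    exact: measurableT_comp.
  - move=> w _; rewrite mxS -EFinD lee_fin ge_max addr_ge0 ?walk_max_ge0//=.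
    by rewrite lerD2r ler_norm.
rewrite ge0_integralD//.
- rewrite law lte_add_pinfty//.
  have /integrableP[_] := integrableS measurableT mD (@subsetT _ _) intxi.
  by [].
- by apply: measurable_funTS; apply/measurable_EFinP; exact: measurableT_comp.
- by move=> w _; rewrite lee_fin walk_max_ge0.
- by apply: measurable_funTS; apply/measurable_EFinP.
Qed.

Let mx_int k : Pr.-integrable D (fun w => (mx k w)%:E).
Proof.
apply/integrableP; split.
  by apply: measurable_funTS; apply/measurable_EFinP.
under eq_integral do rewrite gee0_abs ?lee_fin ?walk_max_ge0//.
exact: mx_lty.
Qed.

Let mx'_int k : Pr.-integrable D (fun w => (mx' k w)%:E).
Proof.
apply/integrableP; split.
  by apply: measurable_funTS; apply/measurable_EFinP.
under eq_integral do rewrite gee0_abs ?lee_fin ?walk_max_ge0//.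
by rewrite law.
Qed.

(* On [D], [mx k.+1 - mx' k] tends to the first step [xi], and it has a
   nonnegative mean since [mx' k] is distributed like [mx k]; so
   [E[xi; D] >= 0].  As [xi] is independent of [D], this forces [Pr D = 0]. *)
Let incr_ge0 k : (0 <= \int[Pr]_(w in D) ((mx k.+1 w)%:E - (mx' k w)%:E))%E.
Proof.
rewrite integralB// law sube_ge0; last first.
  by rewrite (integrable_fin_num mD (mx_int k)).
apply: ge0_le_integral => //.
- by move=> w _; rewrite lee_fin walk_max_ge0.
- by apply: measurable_funTS; apply/measurable_EFinP.
- by apply: measurable_funTS; apply/measurable_EFinP.
- by move=> w _; rewrite lee_fin walk_max_nondecreasing.
Qed.

Let xi_ge0 : (0 <= \int[Pr]_(w in D) (xi w)%:E)%E.
Proof.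
have [|||||_ _] := @dominated_convergence _ _ _ Pr D mD
   (fun k w => (mx k.+1 w)%:E - (mx' k w)%:E)%E (EFin \o xi) (fun w => `|xi w|%:E).
- move=> k; apply: measurable_funTS.
  by apply: emeasurable_funB; apply/measurable_EFinP.
- by apply: measurable_funTS; apply/measurable_EFinP.
(* On [D] the shifted maxima end up above [- xi w]; from then on the maximum with 0 is inactive and
   the difference equals [xi w]. *)
- apply: aeW => w Dw; apply: cvg_near_cst.
  have [c Hc] : exists c : nat, - xi w <= c%:R.
    exists (Num.truncn (- xi w)).+1; apply: ltW; exact: truncnS_gt.
  move: (Dw); rewrite -DE => /(_ c)[k Hk].
  near=> j.
  rewrite /= mxS -EFinB; congr EFin.
  have jk : (k <= j)%N by near: j; exists k.
  have H : c%:R < mx' j w by apply: lt_le_trans Hk _; exact: walk_max_nondecreasing.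
  by rewrite max_r; lra.
- exact: (integrable_abse (integrableS measurableT mD (@subsetT _ _) intxi)).
(* The difference is the maximum of [- mx' k] and [xi], and [mx' k] is nonnegative, so it lies
   between [- |xi|] and [|xi|]. *)
- apply: aeW => w k _; rewrite -EFinB abse_EFin lee_fin mxS.
  have := walk_max_ge0 l e k (walk_tail 1 (steps X 1 w)); rewrite -/(mx' k w).
  have := ler_norm (xi w); have := ler_norm (- xi w); rewrite normrN.
  by move=> ? ? ?; rewrite ler_norml; case: (leP 0 (xi w + mx' k w)) => ?; apply/andP; split; lra.
move=> H; rewrite -(cvg_lim _ H)//; apply: lime_ge; first by apply/cvg_ex; eexists; exact: H.
by apply: nearW => k; exact: incr_ge0.
Unshelve. all: by end_near. Qed.

Lemma prob_walk_unbounded : Pr D = 0%E.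
Proof.
have := xi_ge0; rewrite (indep_integral mD intxi); last first.
  move=> U mU.
  pose U' := (fun x : walk => x (0%N, l) + e) @^-1` U.
  have mU' : measurable U'.
    apply: measurable_preimage => //; apply: measurable_funD => //.
    exact: (measurable_coord (0%N, l)).
  (* [D] is also the event that the tail is unbounded, hence independent of the first step. *)
  have := steps_indep walkX 1 (@ler01 R) mU' mA.
  have E1 : [set w | U' (walk_head 1 (steps X 1 w))] = xi @^-1` U.
    case: walkX => _ X0 _.
    by apply/seteqP; split => w;
      rewrite /U' /= /walk_head /= /steps /= !mulr1 X0 subr0.
  rewrite E1 (_ : [set w | A (steps X 1 w)] = D)// => <-.
  by congr (Pr _); rewrite -E1 -[in LHS]DE.
have := measure_ge0 Pr D; rewrite le_eqVlt => /orP[/eqP <-//|D0].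
by rewrite leNgt mule_gt0_lt0.
Qed.

End drift_bound.

(** * From integer times to continuous time *)

Section continuous_drift.
Context {R : realType} {d : measure_display} {Omega : measurableType d}.
Variables (Pr : probability Omega R) (n : nat) (X : Omega -> R -> 'I_n -> R).
Hypothesis walkX : walk_process Pr X.
Variables (l : 'I_n) (e : R).
Local Notation walk := (path_space R (nat * 'I_n)%type).
Hypothesis Xcadlag : forall w, cadlag (fun t => X w t l).
Hypothesis intX : Pr.-integrable setT (fun w => (X w 1 l)%:E).
Hypothesis meanX : (\int[Pr]_w (X w 1 l)%:E + e%:E < 0)%E.

Let x w t := X w t l + e * t.

Let mx t : 0 <= t -> measurable_fun setT (x^~ t).
Proof. by case: walkX => mX _ _ t0; apply: measurable_funD => //; exact: mX. Qed.

Let mgt t c : 0 <= t -> measurable [set w | c < x w t].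
Proof.
move=> t0; rewrite (_ : [set w | _] = x^~ t @^-1` `]c, +oo[).
  by apply: measurable_preimage => //; exact: mx.
by apply/seteqP; split => w /=; rewrite in_itv /= andbT.
Qed.

Let mge t c : 0 <= t -> measurable [set w | c <= x w t].
Proof.
move=> t0; rewrite (_ : [set w | _] = x^~ t @^-1` `[c, +oo[).
  by apply: measurable_preimage => //; exact: mx.
by apply/seteqP; split => w /=; rewrite in_itv /= andbT.
Qed.

Let dyadic_ge0 m k : 0 <= dyadic m k :> R.
Proof. by rewrite /dyadic divr_ge0. Qed.

Let U (c : nat) := \bigcup_(j in [set: nat]) [set w | c%:R < x w j%:R].

Let mU c : measurable (U c).
Proof. by apply: bigcupT_measurable => j; exact: mgt. Qed.

Let walk_sum_grid h k w : walk_sum l (e * h) k (steps X h w) = x w (k%:R * h).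
Proof. exact: (walk_sum_steps walkX). Qed.

Let U_cvg0 : Pr \o U @ \oo --> 0%E.
Proof.
have -> : 0%E = Pr (\bigcap_c U c).
  apply/esym/eqP; rewrite eq_le measure_ge0 andbT.
  rewrite -(prob_walk_unbounded walkX intX meanX).
  apply: le_measure; rewrite ?inE.
  - exact: bigcapT_measurable.
  - apply: measurable_preimage; last exact: measurable_walk_unbounded.
    exact: (measurable_steps walkX (@ler01 R)).
  - move=> w Uw c; have [j _ /= Hj] := Uw c I; exists j.
    apply: lt_le_trans (walk_sum_le_max l e (steps X 1 w) (leqnn j)).
    by have := walk_sum_grid 1 j w; rewrite !mulr1 => ->.
apply: nonincreasing_cvg_mu => //.
- by rewrite (le_lt_trans (probability_le1 _ _)) ?ltry.
- exact: bigcapT_measurable.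
- move=> a b ab; apply/subsetPset => w [j _ /= Hj]; exists j => //=.
  by apply: le_lt_trans Hj; rewrite ler_nat.
Qed.

Let F (b : nat) := \bigcap_(m in [set: nat]) \bigcap_(j in [set j | (j <= 2 ^ m)%N])
  [set w | - b%:R <= x w (dyadic m j)].

Let mF b : measurable (F b).
Proof.
apply: bigcapT_measurable => m; apply: bigcap_measurable; first by exists 0%N.
by move=> j _; exact: mge.
Qed.

(** A càdlàg path is bounded on [0, 1], so the sets [F b] increase to the whole space. *)
Let F_half : exists b, (2^-1%:E <= Pr (F b))%E.
Proof.
have FT : \bigcup_b F b = setT.
  apply/seteqP; split => // w _.
  have [C HC] := cadlag_bounded (Xcadlag w) (@ler01 R).
  have [b Hb] : exists b : nat, C + `|e| <= b%:R.
    exists (Num.truncn (C + `|e|)).+1; apply: ltW; exact: truncnS_gt.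
  exists b => // m _ j /= jm.
  have t1 : 0 <= (dyadic m j : R) <= 1.
    have m2 : 0 < (2 ^ m)%:R :> R by rewrite ltr0n expn_gt0.
    by rewrite dyadic_ge0 /dyadic ler_pdivrMr// mul1r ler_nat.
  have := HC _ t1; rewrite ler_norml => /andP[H _].
  have : `|e * dyadic m j| <= `|e|.
    by case/andP: t1 => ? ?; rewrite normrM ler_piMr// ger0_norm.
  by rewrite ler_norml => /andP[]; rewrite /x; lra.
have ndF : nondecreasing_seq F.
  move=> a b ab; apply/subsetPset => w Fw m _ j jm.
  apply: le_trans (Fw m I j jm); by rewrite lerN2 ler_nat.
have mFT : measurable (\bigcup_b F b) by exact: bigcupT_measurable.
have F1 : Pr \o F @ \oo --> 1%E.
  rewrite -(probability_setT Pr) -FT.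
  exact: (nondecreasing_cvg_mu (mu := Pr) mF mFT ndF).
apply: contrapT => no.
have : (1 <= 2^-1%:E :> \bar R)%E.
  rewrite -(cvg_lim _ F1)//; apply: lime_le; first by apply/cvg_ex; eexists; exact: F1.
  apply: nearW => b /=; rewrite leNgt; apply/negP => /ltW H.
  by apply: no; exists b.
by rewrite lee_fin; lra.
Qed.

(** Mesh and horizon are refined together, so that the union over [m] runs through all dyadic
    times. *)
Let V (a m : nat) := \bigcup_(k in [set k | (k < m * 2 ^ m)%N])
  [set w | a%:R < x w (dyadic m k)].

Let mV a m : measurable (V a m).
Proof. by apply: bigcup_measurable => k _; exact: mgt. Qed.

Let ndV a : nondecreasing_seq (V a).
Proof.
apply/nondecreasing_seqP => m; apply/subsetPset => w [k /= km Hk].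
exists (2 * k)%N => /=.
  rewrite expnS mulnCA ltn_pmul2l//; apply: (leq_trans km).
  by rewrite leq_mul2r leqnSn orbT.
rewrite (_ : dyadic _ _ = dyadic m k)// /dyadic expnS !natrM.
by rewrite -mulf_div divff ?mul1r// pnatr_eq0.
Qed.

(* Ottaviani's inequality: once the path exceeds [a], it stays above [a - b]
   until the next integer time with probability at least 1/2. *)
Let ottaviani (b a m : nat) : (2^-1%:E <= Pr (F b))%E ->
  (2^-1%:E * Pr (V (a + b) m) <= Pr (U a))%E.
Proof.
move=> Fb; set h : R := (2 ^ m)%:R^-1.
have h0 : 0 <= h by rewrite invr_ge0.
pose N := (2 ^ m)%N.
have N0 : (0 < N)%N by rewrite expn_gt0.
have Nh : N%:R * h = 1 by rewrite divff// pnatr_eq0 -lt0n.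
(* The first multiple of [N] from [k] on: the index of the next integer time. *)
pose c k := ((k + N.-1) %/ N * N)%N.
have kc k : (k <= c k)%N.
  rewrite /c; have := divn_eq (k + N.-1) N; have := ltn_pmod (k + N.-1) N0; lia.
have ck k : (c k - k <= N)%N.
  by rewrite /c; have := divn_eq (k + N.-1) N; lia.
pose C k : set walk := [set y | (a + b)%:R < walk_sum l (e * h) k y].
pose B k : set walk := [set y | - b%:R <= walk_sum l (e * h) (c k - k) y].
have mC k : measurable (C k).
  rewrite (_ : C k = walk_sum l (e * h) k @^-1` `](a + b)%:R, +oo[).
    by apply: measurable_preimage => //; exact: measurable_walk_sum.
  by apply/seteqP; split => y /=; rewrite /C /= in_itv /= andbT.
have mB k : measurable (B k).
  rewrite (_ : B k = walk_sum l (e * h) (c k - k) @^-1` `[- b%:R, +oo[).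
    by apply: measurable_preimage => //; exact: measurable_walk_sum.
  by apply/seteqP; split => y /=; rewrite /B /= in_itv /= andbT.
pose K := (m * 2 ^ m)%N.
have := prob_hit_then_ge walkX h0 mC mB (K := K) (_ : (0 <= 2^-1%:E)%E).
have -> : \bigcup_(k < K) [set w | C k (walk_head k (steps X h w))] = V (a + b) m.
  by apply: eq_bigcupr => k _; apply/seteqP; split => w /=;
     rewrite /C /= walk_sum_head walk_sum_grid.
move=> H; apply: le_trans (H _ _) _.
- by rewrite lee_fin invr_ge0.
- move=> k _; apply: (le_trans Fb); apply: le_measure; rewrite ?inE//.
    rewrite (_ : [set w | _] = [set w | - b%:R <= x w ((c k - k)%:R * h)]).
      by apply: mge; rewrite mulr_ge0.
    by apply/seteqP; split => w /=; rewrite /B /= walk_sum_grid.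
  move=> w Fw; rewrite /= /B /= walk_sum_grid.
  exact: (Fw m I (c k - k)%N (ck k)).
- apply: le_measure; rewrite ?inE//; first exact: (measurable_hit_then walkX h0 mC mB).
  move=> w [k /= kK [[Ck _] Bk]].
  move: Ck Bk; rewrite /C /B /= walk_sum_head walk_sum_tail subnKC// !walk_sum_grid.
  move=> Ck Bk; exists ((k + N.-1) %/ N)%N => //=.
  move: Bk; rewrite {1}/c natrM -mulrA Nh mulr1; rewrite natrD in Ck; lra.
Qed.

(** By Ottaviani's inequality, half the probability of exceeding every level at dyadic times is at
    most the probability of exceeding [a] at an integer time, which tends to 0 as [a] grows. *)
Lemma drift : {ae Pr, forall w, exists c, forall t, 0 <= t -> X w t l + e * t <= c}.
Proof.
pose N := \bigcap_(a in [set: nat]) \bigcup_m V a m.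
have mN : measurable N.
  by apply: bigcapT_measurable => a; exact: bigcupT_measurable.
have [b Hb] := F_half.
have NU a : (2^-1%:E * Pr N <= Pr (U a))%E.
  apply: (@le_trans _ _ (2^-1%:E * Pr (\bigcup_m V (a + b) m))%E).
    rewrite lee_wpmul2l ?lee_fin ?invr_ge0//; apply: le_measure; rewrite ?inE//.
      exact: bigcupT_measurable.
    by move=> w; apply.
  have H := nondecreasing_cvg_mu (mu := Pr) (mV (a + b)) (bigcupT_measurable _ (mV (a + b))) (@ndV (a + b)%N).
  have H' : (2^-1%:E * Pr (V (a + b) m) @[m --> \oo] -->
             2^-1%:E * Pr (\bigcup_m V (a + b) m))%E.
    by apply: cvgeZl.
  rewrite -(cvg_lim _ H')//; apply: lime_le; first by apply/cvg_ex; eexists; exact: H'.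
  by apply: nearW => m; exact: ottaviani.
have N0 : Pr N = 0%E.
  apply/eqP; rewrite eq_le measure_ge0 andbT.
  have : (2^-1%:E * Pr N <= 0)%E.
    rewrite -(cvg_lim _ U_cvg0)//; apply: lime_ge.
      by apply/cvg_ex; eexists; exact: U_cvg0.
    by apply: nearW => a; exact: NU.
  by rewrite pmule_rle0// lte_fin invr_gt0.
exists N; split => // w /= noC a _; apply: contrapT => Va; apply: noC.
(* The 1 is what may be lost between [t] and a dyadic time just after it. *)
exists (a%:R + 1) => t t0.
have xcad : cadlag (x w) by exact: cadlag_add_linear.
have [dl dl0 Hdl] := cadlag_right xcad t0 ltr01.
have [m0 Hm0] := dyadic_dense t0 dl0.
have [k0 Hk0] := Hm0 m0 (leqnn _).
rewrite leNgt; apply/negP => Hx; apply: Va.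
suff [m [k [km Hk]]] : exists m k, (k < m * 2 ^ m)%N /\ a%:R < x w (dyadic m k).
  by exists m => //; exists k.
pose m := maxn m0 (Num.truncn (t + dl)).+1.
have [k /andP[tk kt]] := Hm0 m (leq_maxl _ _).
exists m, k; split.
  have m2 : 0 < (2 ^ m)%:R :> R by rewrite ltr0n expn_gt0.
  rewrite -(ltr_nat R) natrM -ltr_pdivrMr//; apply: (lt_trans kt).
  apply: lt_le_trans (truncnS_gt _) _; by rewrite ler_nat leq_maxr.
have := Hdl (dyadic m k); rewrite (ltW tk) kt => /(_ isT).
by rewrite ltr_norml => /andP[]; rewrite -/(x w t) in Hx; lra.
Qed.

End continuous_drift.

(** * Quasi-left-continuity at the end of excursions *)

Section creeping_paths.
Context {R : realType}.
Implicit Types (x : R -> R) (q c s : R).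

Definition left_lim x s c : Prop :=
  forall e, 0 < e -> exists2 d, 0 < d <= s & forall u, s - d <= u < s -> `|x u - c| < e.

(* [c] is the infimum of the path on [0, q], where time 0 counts with the value
   [- v0]; after [q] the path stays above [c] and tends to [c] at [s-].  For the
   reflected path started from [v0], this means that its left limit is 0 at the
   end [s] of an excursion away from 0. *)
Definition creeps_to x (v0 : R) q c s : Prop :=
  [/\ 0 <= q < s, (forall u, 0 <= u <= q -> c <= x u) /\ c <= - v0,
      forall e, 0 < e -> - v0 < c + e \/ exists2 u, 0 <= u <= q & x u < c + e,
      forall u, q <= u < s -> c < x u &
      left_lim x s c].

(** Let [s'] be the infimum of the times after [q] with left limit [c]. The path is above [c] at
    [s'], so right-continuity excludes such times just after [s'], and [s'] is one itself. Before
    [s'] the path keeps its distance from [c], since [cadlag_inf_attained] would otherwise give an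
    earlier one. A mesh hitting time of a level near [c] is thereby forced close to [s']. *)
Lemma first_creep x v0 q c s : cadlag x -> creeps_to x v0 q c s -> c < x s ->
  exists s', [/\ creeps_to x v0 q c s', c < x s' &
    forall t, q <= t < s' ->
      exists2 e, 0 < e & forall u, q <= u <= t -> c + e <= x u].
Proof.
move=> cx [/andP[q0 qs] cq cap up ll] cs.
pose A := [set v | q < v <= s /\ left_lim x v c].
have As : A s by split => //; rewrite qs lexx.
have infA : has_inf A by split; [exists s|exists q => v [/andP[/ltW]]].
pose s' := inf A.
have s's : s' <= s by apply: ge_inf => //; case: infA.
have qs' : q <= s' by apply: lb_le_inf; [exists s|move=> v [/andP[/ltW]]].
have xs' : c < x s'.
  have [->//|ns] := eqVneq s' s.
  by apply: up; rewrite qs' lt_neqAle ns.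
have g0 : 0 < (x s' - c) / 2 by rewrite divr_gt0// subr_gt0.
have [e e0 He] := cadlag_right cx (le_trans q0 qs') g0.
have A_ge v : A v -> s' <= v by move=> Av; apply: ge_inf => //; case: infA.
have As' : A s'.
  apply: contrapT => nA.
  have [v Av vs] := inf_adherent e0 infA.
  have s'v : s' < v.
    rewrite lt_neqAle A_ge// andbT; apply/eqP => E; apply: nA; by rewrite E.
  case: (Av) => /andP[qv vs0] /(_ _ g0)[dd /andP[d0 dv] Hd].
  pose u := Num.max (v - dd) s'.
  have uv : u < v by rewrite gt_max s'v andbT; lra.
  have u1 : v - dd <= u by rewrite le_max lexx.
  have u2 : s' <= u by rewrite le_max lexx orbT.
  have := Hd u; rewrite u1 uv => /(_ isT).
  have := He u; rewrite u2 (lt_trans uv vs) => /(_ isT).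
  by rewrite !ltr_norml => /andP[? ?] /andP[? ?]; lra.
case: As' => /andP[qs'' _] ll'.
exists s'; split => //.
  split => //; first by rewrite q0.
  by move=> u /andP[qu us]; apply: up; rewrite qu (lt_le_trans us).
move=> t /andP[qt ts]; apply: contrapT => no.
have [||u /andP[qu ut]|v /andP[qv vt] [xv|[qv' Hv]]] :=
    @cadlag_inf_attained _ x q t c cx.
- by rewrite q0.
- move=> e' e'0; apply: contrapT => no'; apply: no; exists e' => // u uqt.
  by rewrite leNgt; apply/negP => xu; apply: no'; exists u.
- by apply/ltW/up; rewrite qu (le_lt_trans ut)// (lt_le_trans ts).
- have : c < x v by apply: up; rewrite qv (le_lt_trans vt)// (lt_le_trans ts).
  by rewrite xv ltxx.
have : A v.
  split; first by rewrite qv' (le_trans vt)// (le_trans (ltW ts)).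
  move=> e' /Hv[dd /andP[d0 dv] Hd]; exists dd => //.
  by rewrite d0 (le_trans dv)// gerBl.
by move=> /A_ge; rewrite leNgt (le_lt_trans vt).
Qed.

End creeping_paths.

Section liminf_sets.
Context {R : realType} {d : measure_display} {T : measurableType d}.
Variable Pr : probability T R.

Definition lim_inf_sets (E : nat -> set T) : set T :=
  \bigcup_m \bigcap_(k in [set k | (m <= k)%N]) E k.

Lemma measurable_lim_inf_sets E : (forall k, measurable (E k)) ->
  measurable (lim_inf_sets E).
Proof.
move=> mE; apply: bigcupT_measurable => m.
by apply: bigcap_measurable => //; exists m => /=.
Qed.

Lemma prob_lim_inf_sets_le E p : (forall k, measurable (E k)) ->
  (exists m, forall k, (m <= k)%N -> (Pr (E k) <= p)%E) ->
  (Pr (lim_inf_sets E) <= p)%E.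
Proof.
move=> mE [m Ep].
pose F j := \bigcap_(k in [set k | (j <= k)%N]) E k.
have mF j : measurable (F j).
  by apply: bigcap_measurable => //; exists j => /=.
have ndF : nondecreasing_seq F.
  by move=> a b ab; apply/subsetPset => w Fw k /= bk; apply: Fw; exact: leq_trans bk.
have mFT : measurable (\bigcup_j F j) by exact: bigcupT_measurable.
have H := nondecreasing_cvg_mu (mu := Pr) mF mFT ndF.
rewrite /lim_inf_sets -/F -(cvg_lim _ H)//.
apply: lime_le; first by apply/cvg_ex; eexists; exact: H.
exists m => // j /= mj; apply: le_trans (Ep j mj).
by apply: le_measure; rewrite ?inE// => w; apply => /=.
Qed.

End liminf_sets.

Section quasi_left_continuity.
Context {R : realType} {d : measure_display} {Omega : measurableType d}.
Variables (Pr : probability Omega R) (n : nat) (X : Omega -> R -> 'I_n -> R).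
Hypothesis walkX : walk_process Pr X.
Variables (l : 'I_n) (v0 : R).
Local Notation walk := (path_space R (nat * 'I_n)%type).
Hypothesis Xcadlag : forall w, cadlag (fun t => X w t l).

Let x w t := X w t l.
Let S k (y : walk) := walk_sum l 0 k y.

Let dyadic_ge0 m k : 0 <= dyadic m k :> R.
Proof. by rewrite /dyadic divr_ge0. Qed.

Let S_grid m k w : S k (steps X (2 ^ m)%:R^-1 w) = x w (dyadic m k).
Proof.
have := walk_sum_steps walkX l (2 ^ m)%:R^-1 0 k w.
by rewrite !mul0r addr0.
Qed.

Let mlt (f g : walk -> R) : measurable_fun setT f -> measurable_fun setT g ->
  measurable [set y | f y < g y].
Proof.
move=> mf mg.
rewrite (_ : [set y | _] = (g \- f) @^-1` `]0, +oo[).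
  by apply: measurable_preimage => //; exact: measurable_funB.
by apply/seteqP; split => w /=; rewrite in_itv /= andbT subr_gt0.
Qed.

Let mS k : measurable_fun setT (S k). Proof. exact: measurable_walk_sum. Qed.

(** At most [2 ^ m] steps of length [2 ^ -(m + r)]: the path exceeds [e] at a dyadic time up to
    [2 ^ -r]. *)
Let U (e : R) r := \bigcup_m \bigcup_(i in [set i | (i <= 2 ^ m)%N])
  [set w | e < x w (dyadic (m + r) i)].

Let mgt t c : 0 <= t -> measurable [set w | c < x w t].
Proof.
case: walkX => mX _ _ t0.
rewrite (_ : [set w | _] = x^~ t @^-1` `]c, +oo[).
  by apply: measurable_preimage => //; exact: mX.
by apply/seteqP; split => w /=; rewrite in_itv /= andbT.
Qed.

Let mU e r : measurable (U e r).
Proof.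
by apply: bigcupT_measurable => m; apply: bigcup_measurable => i _; exact: mgt.
Qed.

Let U_cvg0 e : 0 < e -> (Pr \o U e) @ \oo --> 0%E.
Proof.
move=> e0.
have U0 : \bigcap_r U e r = set0.
  apply/seteqP; split => // w Uw; case: walkX => _ X0 _.
  have [dl dl0 Hdl] := cadlag_right (Xcadlag w) (lexx 0) e0.
  have [r Hr] : exists r, dl^-1 < (2 ^ r)%:R :> R.
    exists (Num.truncn dl^-1).+1.
    apply: lt_trans (truncnS_gt _) _; rewrite ltr_nat; exact: ltn_expl.
  have [m _ [i /= im]] := Uw r I.
  have : 0 <= (dyadic (m + r) i : R) < 0 + dl.
    rewrite dyadic_ge0 add0r /dyadic expnD natrM.
    have m0 : 0 < (2 ^ m)%:R :> R by rewrite ltr0n expn_gt0.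
    have r0 : 0 < (2 ^ r)%:R :> R by rewrite ltr0n expn_gt0.
    rewrite invfM mulrA; apply: (@le_lt_trans _ _ (2 ^ r)%:R^-1).
      by rewrite ler_piMl ?invr_ge0// ler_pdivrMr// mul1r ler_nat.
    by rewrite -[dl]invrK ltf_pV2// posrE invr_gt0.
  move=> /Hdl; rewrite X0 subr0 => H1 H2.
  by have := ler_norm (X w (dyadic (m + r) i) l); rewrite /x in H2; lra.
have <- : Pr (\bigcap_r U e r) = 0%E by rewrite U0 measure0.
apply: nonincreasing_cvg_mu => //.
- by rewrite (le_lt_trans (probability_le1 _ _)) ?ltry.
- exact: bigcapT_measurable.
- apply/nonincreasing_seqP => r; apply/subsetPset => w [m _ [i /= im Hi]].
  exists m.+1 => //; exists i => /=; last by rewrite addSnnS.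
  by rewrite (leq_trans im)// leq_exp2l.
Qed.

Variables (mq kq : nat).
Let q : R := dyadic mq kq.
Let gq m := (kq * 2 ^ (m - mq))%N.

Let gqE m : (mq <= m)%N -> dyadic m (gq m) = q.
Proof.
move=> qm; rewrite /dyadic /gq /q /dyadic -[in (2 ^ m)%N](subnK qm) expnD !natrM.
have nz a : (2 ^ a)%:R != 0 :> R by rewrite pnatr_eq0 -lt0n expn_gt0.
by have := nz (m - mq)%N; have := nz mq => ? ?; field; apply/andP.
Qed.

Section events.
Variables (j r T N m : nat).
Let h : R := (2 ^ m)%:R^-1.
Let e : R := j.+1%:R^-1.

(* On the mesh [h], the first time [k] after [q] at which the walk is close to its
   minimum before [q] is a stopping time, so that an upward jump of size [e] right after
   it is as unlikely as such a jump at time 0. *)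
Definition creep_level (k : nat) : set walk :=
  [set y | [/\ (gq m <= k)%N, S k y < N.+1%:R^-1 - v0 &
    forall i, (i <= gq m)%N -> S k y < N.+1%:R^-1 + S i y]].

Definition creep_jump (k : nat) : set walk :=
  [set y | exists2 i, (i <= 2 ^ (m - r))%N & e < S i y].

Definition creep_event : set Omega :=
  hit_then X h creep_level creep_jump (T * 2 ^ m).

Lemma measurable_creep_level k : measurable (creep_level k).
Proof.
have [gk|gk] := leqP (gq m) k; last first.
  rewrite (_ : creep_level k = set0)//; apply/seteqP; split => // y [].
  by rewrite leqNgt gk.
rewrite (_ : creep_level k = [set y | S k y < N.+1%:R^-1 - v0] `&`
  \bigcap_(i in [set i | (i <= gq m)%N]) [set y | S k y < N.+1%:R^-1 + S i y]).
  apply: measurableI; first exact: mlt.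
  apply: bigcap_measurable; first by exists 0%N.
  by move=> i _; apply: mlt => //; exact: measurable_funD.
apply/seteqP; split => y; first by move=> [_ ? H]; split => // i; exact: H.
by move=> [? H]; split => // i ig; exact: H.
Qed.

Lemma measurable_creep_jump k : measurable (creep_jump k).
Proof.
rewrite (_ : creep_jump k = \bigcup_(i in [set i | (i <= 2 ^ (m - r))%N])
   [set y | e < S i y]).
  by apply: bigcup_measurable => i _; exact: mlt.
by apply/seteqP; split => y [i /= ? ?]; exists i.
Qed.

Let h0 : 0 <= h. Proof. by rewrite invr_ge0. Qed.

Lemma measurable_creep_event : measurable creep_event.
Proof.
exact: (measurable_hit_then walkX h0 measurable_creep_level measurable_creep_jump).
Qed.

Lemma prob_creep_event : (r <= m)%N -> (Pr creep_event <= Pr (U e r))%E.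
Proof.
move=> rm.
apply: (prob_hit_then_le walkX h0 measurable_creep_level measurable_creep_jump) => //.
move=> k _; apply: le_measure; rewrite ?inE//.
  apply: (measurable_preimage _ (measurable_creep_jump k)).
  exact: (measurable_steps walkX h0).
move=> w [i im]; rewrite S_grid => ei.
by exists (m - r)%N => //; exists i => //=; rewrite subnK.
Qed.

End events.

(** The factor 3 leaves room for discretisation: with [e = 1 / (j + 1)], the mesh catches the path
    below [c + e] before [s] and above [c + 2 * e] after it, so a rise by more than [e] is still
    seen. The last clause is what [first_creep] provides. *)
Definition bad_creep (j T : nat) : set Omega :=
  [set w | exists c s, [/\ creeps_to (x w) v0 q c s, c + 3 * j.+1%:R^-1 < x w s,
     s < T%:R & forall t, q <= t < s ->
       exists2 e, 0 < e & forall u, q <= u <= t -> c + e <= x w u]].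

(** The infimum up to [q] is [c], so a hit means being below [c + 2 * e1]. The path is above this
    level until [s - d1], but its left limit [c] forces a hit before [s]. The hit thus falls into
    the last [d1] before [s], and the jump at [s] is seen within [2 ^ -r] of it. [N] depends on the
    distance kept from [c], and the mesh on [N], whence the nesting of the limits inferior. *)
Let bad_creep_sub (j r T : nat) : bad_creep j T `<=`
  lim_inf_sets (fun N => lim_inf_sets (fun m => creep_event j r T N m)).
Proof.
move=> w [c [s [[/andP[q0 qs] [cx cv] cap up ll] cs sT far]]].
set e : R := j.+1%:R^-1 in cs.
have e0 : 0 < e by rewrite invr_gt0.
have r0 : 0 < (2 ^ r)%:R :> R by rewrite ltr0n expn_gt0.
pose dl : R := (2 ^ r)%:R^-1.
have dl0 : 0 < dl by rewrite invr_gt0.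
(* Half of the window [dl] is spent before [s], the other half after it. *)
pose d1 := Num.min (dl / 2) (s - q).
have d10 : 0 < d1 by rewrite lt_min subr_gt0 qs divr_gt0.
have d1l : d1 <= dl / 2 by rewrite ge_min lexx.
have d1q : d1 <= s - q by rewrite ge_min lexx orbT.
clearbody d1.
have [|eta eta0 Heta] := far (s - d1); first by apply/andP; split; lra.
pose e1 := Num.min eta e / 2.
have e10 : 0 < e1 by rewrite divr_gt0// lt_min eta0.
have e1eta : e1 <= eta / 2 by rewrite ler_pM2r ?invr_gt0// ge_min lexx.
have e1e : e1 <= e / 2 by rewrite ler_pM2r ?invr_gt0// ge_min lexx orbT.
clearbody e1.
have [N0 HN0] : exists N0 : nat, N0.+1%:R^-1 < e1.
  exists (Num.truncn e1^-1); rewrite -[ltRHS]invrK ltf_pV2 ?posrE ?invr_gt0//.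
  exact: truncnS_gt.
exists N0 => // N /= N0N.
have HN : N.+1%:R^-1 < e1.
  by apply: le_lt_trans HN0; rewrite lef_pV2 ?posrE// ler_nat.
have N1 : 0 < N.+1%:R^-1 :> R by rewrite invr_gt0.
(* The infimum up to [q] has to be nearly reached by [- v0] or at a mesh time not after [q];
   right-continuity gives the latter, except at [q] itself, which is on the mesh because it is
   dyadic. *)
have [m1 Hm1] : exists m1, forall m, (m1 <= m)%N -> (mq <= m)%N ->
    - v0 < c + e1 \/ exists2 i, (i <= gq m)%N & x w (dyadic m i) < c + e1.
  have [H|[u /andP[u0 uq] xu]] := cap e1 e10; first by exists 0%N => *; left.
  move: uq; rewrite le_eqVlt => /orP[/eqP uq|uq].
    by exists 0%N => m _ qm; right; exists (gq m); rewrite ?leqnn// gqE// -uq.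
  have g0 : 0 < c + e1 - x w u by rewrite subr_gt0.
  have [e2 e20 He2] := cadlag_right (Xcadlag w) u0 g0.
  have [|m1 Hm1] := @dyadic_dense R u (Num.min e2 (q - u)) u0.
    by rewrite lt_min e20 subr_gt0.
  exists m1 => m mm qm; right; have [i /andP[ui iu]] := Hm1 m mm.
  have ie : dyadic m i < u + e2 by apply: lt_le_trans iu _; rewrite lerD2l ge_min lexx.
  have iq : dyadic m i < q.
    by apply: lt_le_trans iu _; rewrite -lerBrDl ge_min lexx orbT.
  exists i; last first.
    have := He2 (dyadic m i); rewrite (ltW ui) ie => /(_ isT).
    by rewrite ltr_norml => /andP[_]; rewrite /x; lra.
  rewrite -(ler_nat R); move: iq; rewrite -(gqE qm) /dyadic ltr_pM2r.
    exact: ltW.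
  by rewrite invr_gt0 ltr0n expn_gt0.
have [d2 /andP[d20 d2s] Hd2] := ll _ N1.
have qd2 : q <= Num.max q (s - d2) by rewrite le_max lexx.
have sd2 : s - d2 <= Num.max q (s - d2) by rewrite le_max lexx orbT.
have [|m2 Hm2] := @dyadic_dense R (Num.max q (s - d2)) (s - Num.max q (s - d2))
    (le_trans q0 qd2).
  by rewrite subr_gt0 gt_max qs; lra.
have [e3 e30 He3] := cadlag_right (Xcadlag w) (le_trans q0 (ltW qs)) e0.
have [|m3 Hm3] := @dyadic_dense R s (Num.min e3 (dl / 2)) (le_trans q0 (ltW qs)).
  by rewrite lt_min e30 divr_gt0.
exists (maxn (maxn mq r) (maxn m1 (maxn m2 m3))) => // m /=.
rewrite !geq_max => /andP[/andP[qm rm] /and3P[mm1 mm2 mm3]].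
have [k /andP[k1 k2]] := Hm2 m mm2.
have {}k2 : dyadic m k < s by move: k2; rewrite addrC subrK.
have m0 : 0 < (2 ^ m)%:R :> R by rewrite ltr0n expn_gt0.
have dy a b : (dyadic m a < dyadic m b :> R) = (a < b)%N.
  by rewrite /dyadic ltr_pM2r ?invr_gt0// ltr_nat.
have dyle a b : (dyadic m a <= dyadic m b :> R) = (a <= b)%N.
  by rewrite /dyadic ler_pM2r ?invr_gt0// ler_nat.
have level a : creep_level N m a (walk_head a (steps X (2 ^ m)%:R^-1 w)) <->
   [/\ (gq m <= a)%N, x w (dyadic m a) < N.+1%:R^-1 - v0 &
       forall i, (i <= gq m)%N -> x w (dyadic m a) < N.+1%:R^-1 + x w (dyadic m i)].
  rewrite /creep_level /= /S walk_sum_head; split => -[ga H1 H2]; split => //.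
  - by rewrite -S_grid.
  - move=> i ig; have := H2 i ig; rewrite walk_sum_head_le ?(leq_trans ig)//.
    by rewrite -!S_grid.
  - by rewrite -/(S _ _) S_grid.
  - move=> i ig; rewrite walk_sum_head_le ?(leq_trans ig)//.
    by rewrite -!/(S _ _) !S_grid; exact: H2.
have hitk : creep_level N m k (walk_head k (steps X (2 ^ m)%:R^-1 w)).
  have xk : x w (dyadic m k) < c + N.+1%:R^-1.
    have := Hd2 (dyadic m k); rewrite k2 andbT (le_trans sd2 (ltW k1)) => /(_ isT).
    by rewrite ltr_norml ltrBlDl => /andP[].
  apply/level; split; first by rewrite -dyle gqE// (le_trans qd2)// ltW.
    by rewrite (lt_le_trans xk)// addrC lerD2l.
  move=> i ig; rewrite (lt_le_trans xk)// addrC lerD2l cx//.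
  by rewrite dyadic_ge0 -(gqE qm) dyle.
have kT : (k < T * 2 ^ m)%N.
  rewrite -(ltr_nat R) natrM -ltr_pdivrMr//; exact: lt_trans k2 sT.
have : (\bigcup_(a < T * 2 ^ m) [set w | creep_level N m a
   (walk_head a (steps X (2 ^ m)%:R^-1 w))]) w by exists k.
rewrite -bigcup_first_hit => -[a /= aT [/level[ga a1 a2] amin]].
have ak : (a <= k)%N by rewrite leqNgt; apply/negP => /amin; exact.
have xa : x w (dyadic m a) < c + 2 * e1.
  have [H|[i ig xi]] := Hm1 m mm1 qm.
    by apply: (lt_trans a1); move: HN H; move: (N.+1%:R^-1) => z; lra.
  by apply: (lt_trans (a2 i ig)); move: HN xi; move: (N.+1%:R^-1) => z; lra.
have qa : q <= dyadic m a by rewrite -(gqE qm) dyle.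
have as_ : dyadic m a < s by apply: le_lt_trans k2; rewrite dyle.
have a1s : s - d1 < dyadic m a.
  rewrite ltNge; apply/negP => H; have := Heta (dyadic m a).
  by rewrite qa H => /(_ isT); lra.
have [b /andP[b1 b2]] := Hm3 m mm3.
have b3 : dyadic m b < s + e3 by apply: lt_le_trans b2 _; rewrite lerD2l ge_min lexx.
have b4 : dyadic m b < s + dl / 2.
  by apply: lt_le_trans b2 _; rewrite lerD2l ge_min lexx orbT.
have xb : c + 2 * e < x w (dyadic m b).
  have := He3 (dyadic m b); rewrite (ltW b1) b3 => /(_ isT).
  by rewrite ltr_norml => /andP[]; rewrite /x in cs *; lra.
have ab : (a < b)%N by rewrite -dy (lt_trans as_).
exists a => //; split; first by split; [apply/level|].
exists (b - a)%N.
  rewrite -(ler_nat R).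
  have -> : (2 ^ (m - r))%:R = dl * (2 ^ m)%:R :> R.
    rewrite -[in RHS](subnK rm) expnD natrM /dl; field; exact: lt0r_neq0.
  rewrite -ler_pdivrMr// natrB; last exact: ltnW.
  by rewrite mulrBl -!/(dyadic m _); lra.
rewrite /S walk_sum_tail subnKC; last exact: ltnW.
by rewrite -!/(S _ _) !S_grid; rewrite -/e; lra.
Qed.

(** For every [r] the event lies in [L r], which is at most as likely as a rise above [1 / (j + 1)]
    within time [2 ^ -r]; right-continuity at 0 sends this probability to 0. *)
Lemma bad_creep_negligible j T : Pr.-negligible (bad_creep j T).
Proof.
pose L r := lim_inf_sets (fun N => lim_inf_sets (fun m => creep_event j r T N m)).
have mL r : measurable (L r).
  apply: measurable_lim_inf_sets => N; apply: measurable_lim_inf_sets => m.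
  exact: measurable_creep_event.
have PL r : (Pr (L r) <= Pr (U j.+1%:R^-1 r))%E.
  apply: prob_lim_inf_sets_le.
    move=> N; apply: measurable_lim_inf_sets => m; exact: measurable_creep_event.
  exists 0%N => N _; apply: prob_lim_inf_sets_le.
    by move=> m; exact: measurable_creep_event.
  by exists r => m rm; exact: prob_creep_event.
exists (\bigcap_r L r); split.
- exact: bigcapT_measurable.
- apply/eqP; rewrite eq_le measure_ge0 andbT.
  have e0 : 0 < j.+1%:R^-1 :> R by rewrite invr_gt0.
  rewrite -(cvg_lim _ (U_cvg0 e0))//; apply: lime_ge.
    by apply/cvg_ex; eexists; exact: (U_cvg0 e0).
  apply: nearW => r /=; apply: le_trans (PL r).
  by apply: le_measure; rewrite ?inE//; [exact: bigcapT_measurable|move=> w; apply].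
- by move=> w bw r _; exact: bad_creep_sub.
Qed.

(** One null set serves all [c] and [s]. Only [q] is fixed, and as it is dyadic, countably many null
    sets will suffice. *)
Lemma creep_continuous : {ae Pr, forall w, forall c s,
  creeps_to (x w) v0 q c s -> x w s <= c}.
Proof.
have : {ae Pr, forall w, forall j T, ~ bad_creep j T w}.
  apply: ae_foralln => j; apply: ae_foralln => T.
  by apply: negligibleS (bad_creep_negligible j T) => w /= /contrapT.
apply: filterS => w good c s cr; rewrite leNgt; apply/negP => cs.
have [s' [cr' cs' far]] := first_creep (Xcadlag w) cr cs.
have g0 : 0 < (x w s' - c) / 3 by rewrite divr_gt0// subr_gt0.
apply: (good (Num.truncn ((x w s' - c) / 3)^-1) (Num.truncn s').+1).
exists c, s'; split => //; last exact: truncnS_gt.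
set k := Num.truncn _.
have : k.+1%:R^-1 < (x w s' - c) / 3.
  rewrite -[ltRHS]invrK ltf_pV2 ?posrE ?invr_gt0//; exact: truncnS_gt.
by move: (k.+1%:R^-1) => z; lra.
Qed.

End quasi_left_continuity.

(** * Regulators and one-dimensional reflection *)

Section flat_regulators.
Context {R : realType}.
Implicit Types (F V W x : R -> R) (a b c t e p : R).

(* [F b] is the left limit of [F] at [a]: the measure [dF] does not charge the
   closed interval [a, b]. *)
Definition flat F a b : Prop := forall e, 0 < e -> exists2 a', a' < a & F b - F a' < e.

(** The value 0 at negative times makes mass at time 0 visible: [flat F 0 b] forces [F b = 0] for
    [b >= 0]. *)
Definition regulator F : Prop :=
  [/\ forall s t, s <= t -> F s <= F t, forall t, t <= 0 -> F t = 0 &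
      forall t e, 0 < e -> exists2 d, 0 < d & forall s, t <= s < t + d -> F s < F t + e].

(* [dF] is carried by the zeros of [V]. *)
Definition carried F V : Prop := forall a b c, 0 < c -> 0 <= a <= b ->
  (forall s, a <= s <= b -> c <= V s) -> flat F a b.

Lemma regulator_first F a b y : regulator F -> a <= b -> y <= F b ->
  exists s1, [/\ a <= s1 <= b, y <= F s1, forall s, s1 <= s -> y <= F s &
                 forall s, a <= s < s1 -> F s < y].
Proof.
move=> [ndF _ rcF] ab yb.
pose A := [set s | a <= s <= b /\ y <= F s].
have Ab : A b by rewrite /A /= ab lexx.
have infA : has_inf A by split; [exists b|exists a => s [/andP[]]].
have A_ge v : A v -> inf A <= v by move=> Av; apply: ge_inf => //; case: infA.
have ai : a <= inf A by apply: lb_le_inf; [exists b|move=> s [/andP[]]].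
have yi : y <= F (inf A).
  rewrite leNgt; apply/negP => H; have e0 : 0 < y - F (inf A) by rewrite subr_gt0.
  have [d d0 Hd] := rcF (inf A) _ e0.
  have [v Av vd] := inf_adherent d0 infA.
  have := Hd v; rewrite A_ge// vd => /(_ isT); case: Av => _; lra.
exists (inf A); split => //; first by rewrite ai A_ge.
  by move=> s si; rewrite (le_trans yi)// ndF.
move=> s /andP[as_ si]; rewrite ltNge; apply/negP => ys.
have : A s by split => //; rewrite as_ (le_trans (ltW si))// A_ge.
by move=> /A_ge; rewrite leNgt si.
Qed.

Lemma flat_cat F a t b : regulator F -> flat F a t -> flat F t b -> flat F a b.
Proof.
move=> [ndF _ _] f1 f2 e e0; have e20 : 0 < e / 2 by rewrite divr_gt0.
have [a' aa Ha] := f1 _ e20; have [t' tt Ht] := f2 _ e20.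
exists a' => //; have := ndF t' t (ltW tt); lra.
Qed.

(** [G] and [V] belong to the feeding station, [F] and [W] to the fed one. While [V] is away from 0,
    [G] is flat and [W] grows at least as much as [F]. If [F] had mass [e] on [a, b], the first half
    would lift [W] away from 0, and [F], carried by the zeros of [W], could not acquire the second
    half. *)
Lemma carried_fed F G V W p : regulator F -> regulator G -> 0 <= p ->
  carried G V -> carried F W -> (forall t, 0 <= t -> 0 <= W t) ->
  (forall s t, 0 <= s <= t ->
     W s - p * (G t - G s) + (F t - F s) <= W t) ->
  carried F V.
Proof.
move=> rF rG p0 cG cF W0 incr a b c c0 /andP[a0 ab] Vc e e0.
have fG := cG a b c c0 (introT andP (conj a0 ab)) Vc.
have [ndF F0 rcF] := rF; have [ndG G0 _] := rG.
apply: contrapT => no.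
have {no} big a' : a' < a -> e <= F b - F a'.
  by move=> aa; rewrite leNgt; apply/negP => H; apply: no; exists a'.
(* With this bound on the increase of [G], the loss [p * dG] is at most [e / 4], so [W] is at least
   [e / 2 - e / 4] after half of the mass; [p + 1] covers [p = 0]. *)
have h0 : 0 < e / (4 * (p + 1)) by rewrite divr_gt0// mulr_gt0//; lra.
have ph : p * (e / (4 * (p + 1))) <= e / 4.
  have p1 : 0 < 4 * (p + 1) by rewrite mulr_gt0//; lra.
  rewrite mulrA ler_pdivrMr//.
  have -> : e / 4 * (4 * (p + 1)) = p * e + e by field.
  lra.
have [a1 aa1 Ha1] := fG _ h0.
(* The balance of [W] is available from time 0 only. If [a = 0], the left end is 0 itself, and
   nothing is lost as [F] and [G] vanish there. *)
have [a' [a'0 a'a Fa' Ga']] : exists a', [/\ 0 <= a', a' <= a,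
    e <= F b - F a' & G b - G a' < e / (4 * (p + 1))].
  have [a_0|a_0] := eqVneq a 0.
    have F00 : F 0 = 0 by rewrite F0.
    have G00 : G 0 = 0 by rewrite G0.
    have Fm : F (-1) = 0 by rewrite F0//; lra.
    have Ga1 : G a1 = 0 by rewrite G0//; lra.
    have b1 : e <= F b - F (-1) by apply: big; lra.
    by exists 0; rewrite a_0 lexx; split => //; lra.
  have {a_0}a0' : 0 < a by rewrite lt_neqAle eq_sym a_0.
  pose a' := Num.max a1 0.
  have m1 : a1 <= a' by rewrite le_max lexx.
  have m2 : 0 <= a' by rewrite le_max lexx orbT.
  have aa' : a' < a by rewrite gt_max aa1.
  exists a'; split => //; [exact: ltW|exact: big|].
  by have := ndG _ _ m1; lra.
have [|s1 [/andP[as1 s1b] _ Fs Fs']] := @regulator_first F a b (F a' + e / 2) rF ab.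
  by lra.
have e20 : 0 < e / 2 by rewrite divr_gt0.
have [|||s' s's1 Hs'] := cF s1 b (e / 4) _ _ _ _ e20.
- by rewrite divr_gt0.
- by rewrite (le_trans a0 as1).
- move=> s /andP[s1s sb].
  have s0 : 0 <= a' <= s by rewrite a'0 (le_trans a'a)// (le_trans as1).
  have := incr a' s s0; have := Fs s s1s; have := W0 a' a'0.
  have := ndG s b sb; have : p * (G s - G a') <= e / 4.
    apply: le_trans ph; rewrite ler_wpM2l//; have := ndG s b sb; lra.
  lra.
have [s1a|s1a] := eqVneq s1 a.
  by have := big s'; rewrite -s1a => /(_ s's1); lra.
have as1' : a < s1 by rewrite lt_neqAle eq_sym s1a.
pose s2 := Num.max s' a.
have m1 : s' <= s2 by rewrite le_max lexx.
have m2 : a <= s2 by rewrite le_max lexx orbT.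
have := Fs' s2; rewrite m2 gt_max s's1 as1' => /(_ isT).
have := ndF _ _ m1; lra.
Qed.

Definition right_cont V : Prop := forall t e, 0 <= t -> 0 < e ->
  exists2 d, 0 < d & forall s, t <= s < t + d -> `|V s - V t| < e.

(** Real induction with [flat_cat]; the local hypothesis at [u = t] says that [t] itself carries no
    mass, which is what the left rule needs. *)
Lemma flat_local F a b : regulator F -> a <= b ->
  (forall t, a <= t <= b -> exists2 d, 0 < d &
     forall u, t <= u < t + d -> u <= b -> flat F t u) ->
  flat F a b.
Proof.
move=> rF ab loc.
apply: (@real_induction _ a b (flat F a)) => //; last by rewrite lexx ab.
- have [|d d0 Hd] := loc a; first by rewrite lexx.
  by apply: Hd => //; rewrite lexx ltrDl.
- move=> t /andP[at_ tb] Q.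
  have [|d d0 Hd] := loc t; first by rewrite at_ ltW.
  exists (Num.min d (b - t)); first by rewrite lt_min d0 subr_gt0.
  move=> s /andP[ts sd].
  apply: (@flat_cat _ _ t) => //; first by apply: Q; rewrite at_ lexx.
  apply: Hd; first by rewrite (ltW ts) (lt_le_trans sd)// lerD2l ge_min lexx.
  by rewrite ltW// (lt_le_trans sd)// -lerBrDl ge_min lexx orbT.
- move=> t /andP[at_ tb] Q e e0; have e20 : 0 < e / 2 by rewrite divr_gt0.
  have [|d d0 Hd] := loc t; first by rewrite (ltW at_).
  have [||t' tt' Ht'] := Hd t _ _ _ e20 => //; first by rewrite lexx ltrDl.
  pose s := Num.max t' a.
  have m1 : t' <= s by rewrite le_max lexx.
  have m2 : a <= s by rewrite le_max lexx orbT.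
  have [|a' aa' Ha'] := Q s _ _ e20; first by rewrite m2 gt_max tt'.
  by exists a' => //; have [ndF _ _] := rF; have := ndF _ _ m1; lra.
Qed.

(** At each time [W] or [p * V] makes up at least half of the lower bound on the sum, and
    right-continuity keeps it above a quarter for a while, where [F] is flat. *)
Lemma carried_sum F V W p : regulator F -> 0 <= p ->
  right_cont V -> right_cont W ->
  carried F V -> carried F W -> carried F (fun t => W t + p * V t).
Proof.
move=> rF p0 rcV rcW cV cW a b c c0 /andP[a0 ab] Hc.
apply: flat_local => // t /andP[at_ tb]; have t0 := le_trans a0 at_.
have c40 : 0 < c / 4 by rewrite divr_gt0.
have := Hc t; rewrite at_ tb => /(_ isT) Ht.
have [Wt|Wt] := leP (c / 2) (W t).
  have [d d0 Hd] := rcW t _ t0 c40.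
  exists d => // u /andP[tu ud] ub; apply: (cW t u (c / 4)) => //.
    by rewrite t0.
  move=> s /andP[ts su]; have := Hd s; rewrite ts (le_lt_trans su ud) => /(_ isT).
  by rewrite ltr_norml => /andP[]; lra.
have pV : c / 2 < p * V t by lra.
have p0' : 0 < p.
  rewrite lt_neqAle p0 andbT; apply/eqP => p_0.
  by move: pV; rewrite -p_0 mul0r; lra.
have Vt : c / 2 / p < V t by rewrite ltr_pdivrMr// [ltRHS]mulrC.
have q0 : 0 < c / 4 / p by rewrite !divr_gt0.
have [d d0 Hd] := rcV t _ t0 q0.
exists d => // u /andP[tu ud] ub; apply: (cV t u (c / 4 / p)) => //.
  by rewrite t0.
move=> s /andP[ts su]; have := Hd s; rewrite ts (le_lt_trans su ud) => /(_ isT).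
have E : c / 2 / p = c / 4 / p + c / 4 / p.
  by field; exact: lt0r_neq0.
rewrite E in Vt; move: (c / 4 / p) Vt => z.
by rewrite ltr_norml => ? /andP[]; lra.
Qed.

(* One-dimensional Skorokhod reflection [V] of [y + x] at 0, with regulator [L].
   [refl_min] and [refl_flat] replace the condition that [L] increases only when
   [V] vanishes. *)
Record reflection (x : R -> R) (y : R) (L V : R -> R) : Prop := Reflection {
  refl_eq : forall t, 0 <= t -> V t = y + x t + L t;
  refl_ge0 : forall t, 0 <= t -> 0 <= V t;
  refl_nd : forall s t, 0 <= s -> s <= t -> L s <= L t;
  refl_L0 : L 0 = 0;
  refl_min : forall t e, 0 <= t -> 0 < e -> 0 < L t ->
    exists2 s, 0 <= s <= t & y + x s + L t < e;
  refl_flat : forall q s, 0 <= q <= s -> (forall u, q <= u <= s -> 0 < V u) ->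
    L s = L q }.

(** For [refl_min]: were [y + x + F t] at least [e] on [0, t], [V] would be at least [e / 2] from
    the moment [s1] when [F] reaches [F t - e / 2]. Then [F] would not charge [s1, t], although it
    comes from below [F t - e / 2], or from 0 at negative times. *)
Lemma carried_reflection F V x y : regulator F -> carried F V ->
  (forall t, 0 <= t -> V t = y + x t + F t) ->
  (forall t, 0 <= t -> 0 <= V t) -> right_cont V -> reflection x y F V.
Proof.
move=> rF cF VE V0 rcV; have [ndF F0 _] := rF; split => //.
- by move=> s t _; exact: ndF.
- by rewrite F0.
- move=> t e t0 e0 Ft; apply: contrapT => no.
  have {}no s : 0 <= s <= t -> e <= y + x s + F t.
    by move=> st; rewrite leNgt; apply/negP => H; apply: no; exists s.
  have [|s1 [/andP[s10 s1t] _ Fs Fs']] := @regulator_first F 0 t (F t - e / 2) rF t0.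
    by lra.
  have m0 : 0 < Num.min (e / 2) (F t) by rewrite lt_min Ft divr_gt0.
  have [|||s' s's1 Hs'] := cF s1 t (e / 2) _ _ _ _ m0.
  - by rewrite divr_gt0.
  - by rewrite s10.
  - move=> s /andP[s1s st]; rewrite VE; last exact: le_trans s1s.
    have := no s; rewrite st (le_trans s10 s1s) => /(_ isT).
    have := Fs s s1s; lra.
  move: Hs'; rewrite lt_min => /andP[H1 H2].
  have [s'0|s'0] := leP 0 s'.
    by have := Fs' s'; rewrite s'0 s's1 => /(_ isT); lra.
  by move: H2; rewrite (F0 s' (ltW s'0)); lra.
- move=> q s /andP[q0 qs] Vqs; apply/eqP; rewrite eq_le (ndF _ _ qs) andbT.
  have fl : flat F q s.
    apply: flat_local => // t /andP[qt ts]; have t0 := le_trans q0 qt.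
    have v0 : 0 < V t / 2 by rewrite divr_gt0// Vqs// qt.
    have [d d0 Hd] := rcV t _ t0 v0.
    exists d => // u /andP[tu ud] _; apply: (cF t u _ v0); first by rewrite t0.
    move=> z /andP[tz zu]; have := Hd z; rewrite tz (le_lt_trans zu ud) => /(_ isT).
    by rewrite ltr_norml => /andP[]; lra.
  apply/ler_addgt0Pr => e /fl[a' a'q Ha']; have := ndF _ _ (ltW a'q); lra.
Qed.

End flat_regulators.

(** * From Lebesgue-Stieltjes integrals to regulators *)

Section stieltjes.
Context {R : realType}.
Import HBNNSimple.

(** Markov's inequality without measurability of the integrand: [c] times the indicator of [A] is
    one of the simple functions in the supremum. *)
Lemma integral_ge_indic d (T : measurableType d) (mu : {measure set T -> \bar R})
    (D A : set T) (c : R) (f : T -> R) :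
  measurable A -> A `<=` D -> 0 <= c -> (forall x, D x -> 0 <= f x) ->
  (forall x, A x -> c <= f x) ->
  (c%:E * mu A <= \int[mu]_(x in D) (f x)%:E)%E.
Proof.
move=> mA AD c0 f0 Af; rewrite integral_mkcond ge0_integralTE; last first.
  by move=> x; rewrite /patch; case: ifPn => // /set_mem Dx; rewrite lee_fin f0.
pose h := scale_nnsfun (indic_nnsfun R mA) c0.
apply: ereal_sup_ubound; exists h.
  move=> x /=; rewrite /patch.
  have [Ax|nAx] := pselect (A x).
    by rewrite mindicE !mem_set ?mulr1 ?lee_fin//; [exact: Af|exact: AD].
  rewrite mindicE memNset// mulr0; case: ifPn => // /set_mem Dx.
  by rewrite lee_fin f0.
rewrite -integralT_nnsfun.
rewrite (_ : (fun x => _) = (fun x => c%:E * (\1_A x)%:E)%E); last first.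
  by apply/funext => x; rewrite /= mindicE -EFinM.
rewrite ge0_integralZl//; first by rewrite integral_indic// setIT.
by apply/measurable_EFinP; exact: measurable_indic.
Qed.

Variables (F : cumulative R R) (W : R -> R).
Hypothesis W0 : forall t, 0 <= t -> 0 <= W t.
Hypothesis int0 : (\int[lebesgue_stieltjes_measure F]_(t in `[0%R, +oo[) (W t)%:E = 0)%E.

Lemma stieltjes_itv_oc (a b : R) : a <= b ->
  lebesgue_stieltjes_measure F `]a, b]%classic = (F b - F a)%:E.
Proof.
move=> ab; rewrite /lebesgue_stieltjes_measure /measure_extension/=.
rewrite measurable_mu_extE/=; last exact: is_ocitv.
by rewrite wlength_itv_bnd// EFinB.
Qed.

(** By Markov's inequality [a, b] is a null set. The half-open intervals [E k], whose measures are
    increments of [F], decrease to it, and continuity from above yields the left point. *)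
Lemma stieltjes_carried : carried F W.
Proof.
move=> a b c c0 /andP[a0 ab] Wc e e0.
have mu0 : lebesgue_stieltjes_measure F `[a, b]%classic = 0%E.
  apply/eqP; rewrite eq_le measure_ge0 andbT.
  have : (c%:E * lebesgue_stieltjes_measure F `[a, b]%classic <= 0)%E.
    rewrite -int0; apply: integral_ge_indic => //.
    - by move=> t /=; rewrite !in_itv /= andbT => /andP[/(le_trans a0)].
    - exact: ltW.
    - by move=> t /=; rewrite in_itv /= andbT; exact: W0.
  by rewrite pmule_rle0// lte_fin.
pose E k := `]a - k.+1%:R^-1, b]%classic.
have E_meas k : measurable (E k) by exact: measurable_itv.
have EI : \bigcap_k E k = `[a, b]%classic.
  apply/seteqP; split => t /= H; last first.
    move: H; rewrite /= in_itv /= => /andP[at_ tb] k _; rewrite /E /= in_itv /= tb andbT.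
    by apply: lt_le_trans at_; rewrite ltrBlDr ltrDl invr_gt0.
  rewrite in_itv /=; apply/andP; split; last first.
    by have := H 0%N I; rewrite /E /= in_itv /= => /andP[].
  rewrite leNgt; apply/negP => ta.
  have ta0 : 0 < a - t by rewrite subr_gt0.
  have := H (Num.truncn (a - t)^-1) I; rewrite /E /= in_itv /= => /andP[].
  rewrite ltrBlDl -ltrBlDr => + _.
  have : (Num.truncn (a - t)^-1).+1%:R^-1 < a - t.
    by rewrite -[ltRHS]invrK ltf_pV2 ?posrE ?invr_gt0// truncnS_gt.
  by move=> h1 h2; have := lt_trans h1 h2; rewrite ltxx.
have cvg0 : lebesgue_stieltjes_measure F (E k) @[k --> \oo] --> 0%E.
  rewrite -mu0 -EI; apply: nonincreasing_cvg_mu => //.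
  - have H : a - 1%:R^-1 <= b by rewrite (le_trans _ ab)// gerBl.
    by have := ltry (F b - F (a - 1%:R^-1)); rewrite -(stieltjes_itv_oc H).
  - exact: bigcapT_measurable.
  - move=> i j ij; apply/subsetPset => t; rewrite /E /= !in_itv /= => /andP[+ ->].
    rewrite andbT; apply: le_lt_trans.
    by rewrite lerD2l lerN2 lef_pV2 ?posrE// ler_nat.
have /fine_cvgP[_ /cvgrPdist_lt/(_ e e0)[k _ /(_ k (leqnn k))]] := cvg0.
rewrite /= /E stieltjes_itv_oc /=; last by rewrite (le_trans _ ab)// gerBl.
rewrite sub0r normrN => H; exists (a - k.+1%:R^-1); first by rewrite ltrBlDr ltrDl invr_gt0.
exact: le_lt_trans (ler_norm _) H.
Qed.

Lemma cumulative_regulator : (forall t, t <= 0 -> F t = 0) -> regulator F.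
Proof.
move=> F0; split => //; first exact: cumulative_is_nondecreasing.
move=> t e e0; have e20 : 0 < e / 2 by rewrite divr_gt0.
have [d Hd] := nondecreasing_right_continuousP t F e20.
exists d%:num => // s /andP[ts sd].
have := cumulative_is_nondecreasing F _ _ (ltW sd); lra.
Qed.

End stieltjes.

Section cadlag_vectors.
Context {R : realType} {n : nat}.

Lemma cvg_sum_real (I T : Type) (F : set_system T) (s : seq I)
    (f : I -> T -> R) (a : I -> R) : Filter F ->
  (forall i, f i x @[x --> F] --> a i) ->
  \sum_(i <- s) f i x @[x --> F] --> \sum_(i <- s) a i.
Proof.
move=> FF fa; elim: s => [|i s IH].
  rewrite big_nil; under eq_fun do rewrite big_nil; exact: cvg_cst.
rewrite big_cons; under eq_fun do rewrite big_cons; exact: cvgD.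
Qed.

Lemma cadlag_scalar_product (f : R -> 'cV[R]_n) (a : 'I_n -> R) :
  cadlag f -> cadlag (fun t => \sum_k a k * f t k ord0).
Proof.
move=> [rf lf]; split => [t t0|t /lf[l fl]].
  apply: cvg_sum_real => k; apply: cvgM; first exact: cvg_cst.
  apply: (cvg_comp _ (fun v : 'cV[R]_n => v k ord0) (rf t t0)).
  exact: coord_continuous.
exists (\sum_k a k * l k ord0).
apply: cvg_sum_real => k; apply: cvgM; first exact: cvg_cst.
by apply: (cvg_comp _ (fun v : 'cV[R]_n => v k ord0) fl); exact: coord_continuous.
Qed.

Lemma cadlag_mulmx (f : R -> 'cV[R]_n) (M : 'M[R]_n) j :
  cadlag f -> cadlag (fun t => (M *m f t) j ord0).
Proof.
move=> cf; have := cadlag_scalar_product (M j) cf.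
by rewrite (_ : (fun t => (M *m f t) j ord0) = fun t => \sum_k M j k * f t k ord0)//;
  apply/funext => t; rewrite mxE.
Qed.

Lemma cadlag_component (f : R -> 'cV[R]_n) j : cadlag f -> cadlag (component f j).
Proof. by move=> /(cadlag_mulmx 1%:M j); under eq_fun do rewrite mul1mx. Qed.

Lemma cadlag_right_cont (f : R -> R) : cadlag f -> right_cont f.
Proof. by move=> cf t e t0 e0; exact: cadlag_right. Qed.

End cadlag_vectors.

(** * Paths of tree networks *)

Section network_matrix.
Context {R : realType} {n : nat}.
Variables (r : 'cV[R]_n) (P : 'M[R]_n).
Hypothesis hnet : tree_routing r P.

Lemma netmx_unit : netmx P \in unitmx.
Proof.
case: hnet => _ _ [_ P0] _ [Pu _].
have tr : is_trig_mx (netmx P).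
  apply/is_trig_mxP => i j ij; rewrite !mxE Pu// subr0.
  by rewrite (negbTE (_ : i != j))//; apply: contraTneq ij => ->; rewrite ltnn.
rewrite unitmxE det_trig// big1 ?unitr1// => i _.
by rewrite !mxE eqxx P0 subr0.
Qed.

Lemma netmxE (v : 'cV[R]_n) j :
  (netmx P *m v) j ord0 = v j ord0 - \sum_i P i j * v i ord0.
Proof.
rewrite /netmx mulmxBl mul1mx !mxE; congr (_ - _).
by apply: eq_bigr => i _; rewrite mxE.
Qed.

Lemma tree_parent j : (forall i, P i j = 0) \/
  exists i : 'I_n, [/\ (i < j)%N, 0 < P i j & forall i', i' != i -> P i' j = 0].
Proof.
case: hnet => _ _ [P0 Pd] _ [Pu Pp].
have [j0|j0] := eqVneq (j : nat) 0%N.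
  left => i; have [ji|] := ltnP j i; first exact: Pu.
  rewrite j0 leqn0 => /eqP i0; rewrite (_ : i = j) ?Pd//.
  by apply/val_inj; rewrite /= i0 j0.
have [|i [Pi iu]] := Pp j; first by rewrite lt0n.
right; exists i; split => //.
  rewrite ltnNge leq_eqVlt; apply/negP => /orP[/eqP ji|ji].
    by move: Pi; rewrite (_ : i = j) ?Pd ?ltxx//; apply/val_inj.
  by move: Pi; rewrite Pu// ltxx.
move=> i' ii'; apply/eqP; rewrite eq_le P0 andbT leNgt; apply/negP => /iu ii.
by rewrite ii eqxx in ii'.
Qed.

End network_matrix.

Section network_path.
Context {R : realType} {n : nat}.
Variables (r w : 'cV[R]_n) (P : 'M[R]_n) (J W L : R -> 'cV[R]_n).
Hypothesis hnet : tree_routing r P.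
Hypothesis T1 : forall i j, 0 < P i j -> r j ord0 / r i ord0 <= P i j.
Hypothesis Jnd : forall j : 'I_n, (0 < j)%N -> nondecreasing_path (component J j).
Hypothesis sol : skorokhod_solution P w (net_input r P J) W L.

Let V t := invmx (netmx P) *m W t.
Let X := free_process r P J.
Let y := invmx (netmx P) *m w.

Let cW : cadlag W. Proof. by case: sol => -[]. Qed.
Let WE t : 0 <= t -> W t = w + net_input r P J t + netmx P *m L t.
Proof. by case: sol => _ + _ _ _; exact. Qed.
Let W0 t j : 0 <= t -> 0 <= W t j ord0.
Proof. by case: sol => _ _ + _ _; exact. Qed.
Let L0 : L 0 = 0. Proof. by case: sol => _ _ _ []. Qed.

Let VE t : 0 <= t -> V t = y + X t + L t.
Proof.
move=> t0; rewrite /V WE// mulmxDr (mulmxDr _ w) mulmxA mulVmx ?(netmx_unit hnet)// mul1mx.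
congr (_ + _ + _); rewrite /net_input /X /free_process mulmxBr; congr (_ - _).
by rewrite -scalemxAr mulmxA mulVmx ?(netmx_unit hnet)// mul1mx.
Qed.

Let WV t j : W t j ord0 = V t j ord0 - \sum_i P i j * V t i ord0.
Proof. by rewrite -netmxE /V mulmxA mulmxV ?(netmx_unit hnet)// mul1mx. Qed.

(** The balance of station [j]: it gains [P i j * r i] and drains [r j] per unit of time, idleness
    of [i] costs [P i j] times the increase of [L i], and the external input can only add. *)
Let Wincr (i j : 'I_n) s t : 0 < P i j -> (forall i', i' != i -> P i' j = 0) -> (i < j)%N ->
  0 <= s <= t ->
  W s j ord0 - P i j * (L t i ord0 - L s i ord0) + (L t j ord0 - L s j ord0)
   + (P i j * r i ord0 - r j ord0) * (t - s) <= W t j ord0.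
Proof.
move=> Pi Pu ij /andP[s0 st].
have j0 : (0 < j)%N by exact: leq_trans ij.
have := Jnd j0 s0 st; rewrite /component => HJ.
have sumE (v : 'cV[R]_n) : \sum_i0 P i0 j * v i0 ord0 = P i j * v i ord0.
  rewrite (bigD1 i)//= big1 ?addr0// => i' ii'; by rewrite Pu// mul0r.
have WEj u : 0 <= u -> W u j ord0 = w j ord0 +
    (J u j ord0 - u * (r j ord0 - P i j * r i ord0)) +
    (L u j ord0 - P i j * L u i ord0).
  move=> u0; rewrite WE// /net_input !mxE -!sumE -!netmxE !mxE.
  by congr (_ + _ + _).
rewrite (WEj s)// (WEj t) ?(le_trans s0)//; lra.
Qed.

(** The functions are those of [complementarity], where every summand is nonnegative and thus
    vanishes. The induction runs on a bound for the index, as the feeding station has a smaller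
    one. *)
Lemma network_regulators : exists F : 'I_n -> R -> R,
  (forall j t, 0 <= t -> F j t = L t j ord0) /\
  forall j, [/\ regulator (F j), carried (F j) (component V j) &
                carried (F j) (component W j)].
Proof.
case: sol => _ _ _ _ [Lnd [F [FE int0]]].
exists (fun j => F j); split; first by move=> j t t0; rewrite FE t0.
have FW j : (\int[lebesgue_stieltjes_measure (F j)]_(t in `[0%R, +oo[) (W t j ord0)%:E = 0)%E.
  have ge0 k : (0 <= \int[lebesgue_stieltjes_measure (F k)]_(t in `[0%R, +oo[) (W t k ord0)%:E)%E.
    by apply: integral_ge0 => t; rewrite /= in_itv /= andbT lee_fin => ?; exact: W0.
  apply/eqP; rewrite eq_le ge0 andbT -int0 (bigD1 j)//= leeDl//.
  by apply: sume_ge0.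
have reg j : regulator (F j).
  apply: cumulative_regulator => t; rewrite le_eqVlt => /orP[/eqP ->|t0].
    by rewrite FE lexx L0 mxE.
  by rewrite FE leNgt t0.
have cWj j : carried (F j) (component W j).
  by apply: stieltjes_carried => // t t0; exact: W0.
move=> j; split => //.
move: {2}(j : nat) (leqnn j) => m; elim: m j => [|m IH] j jm.
all: have [Pz|[i [ij Pi Pu]]] := tree_parent hnet j.
- rewrite (_ : component V j = component W j)//; apply/funext => t.
  by rewrite /component WV big1 ?subr0// => i _; rewrite Pz mul0r.
- by move: jm; rewrite leqn0 => /eqP jm; rewrite jm in ij.
- rewrite (_ : component V j = component W j)//; apply/funext => t.
  by rewrite /component WV big1 ?subr0// => i _; rewrite Pz mul0r.
have -> : component V j = fun t => component W j t + P i j * component V i t.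
  apply/funext => t; rewrite /component WV (bigD1 i)//= big1 ?addr0 ?subrK//.
  by move=> i' ii'; rewrite Pu// mul0r.
have cV : carried (F i) (component V i).
  by apply: IH; rewrite -ltnS; exact: leq_trans jm.
apply: carried_sum => //; first exact: ltW.
- by apply: cadlag_right_cont; exact: cadlag_mulmx.
- by apply: cadlag_right_cont; exact: cadlag_component.
apply: (@carried_fed _ _ (F i) _ (component W j) (P i j)) => //; first exact: ltW.
  by move=> t t0; exact: W0.
move=> s t st; have [s0 t0] : 0 <= s /\ 0 <= t by move/andP : st => [? ?]; lra.
rewrite !FE s0 t0.
apply: le_trans (Wincr Pi Pu ij st); rewrite lerDl mulr_ge0//; last first.
  by move/andP: st => [_ ?]; lra.
have := T1 Pi; case: hnet => _ r0 _ _ _; rewrite ler_pdivrMr//; lra.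
Qed.

Lemma inv_netmx_ge0 (v : 'cV[R]_n) j : (forall k, 0 <= v k ord0) ->
  0 <= (invmx (netmx P) *m v) j ord0.
Proof.
move=> v0; move: {2}(j : nat) (leqnn j) => m; elim: m j => [|m IH] j jm.
all: have E : v j ord0 = (invmx (netmx P) *m v) j ord0
   - \sum_i P i j * (invmx (netmx P) *m v) i ord0
  by rewrite -netmxE mulmxA mulmxV ?(netmx_unit hnet)// mul1mx.
all: have := v0 j; rewrite E.
all: have [Pz|[i [ij Pi Pu]]] := tree_parent hnet j.
- by rewrite big1 ?subr0// => i _; rewrite Pz mul0r.
- by move: jm; rewrite leqn0 => /eqP jm; rewrite jm in ij.
- by rewrite big1 ?subr0// => i _; rewrite Pz mul0r.
rewrite (bigD1 i)//= big1 ?addr0; last by move=> i' ii'; rewrite Pu// mul0r.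
have Vi : 0 <= (invmx (netmx P) *m v) i ord0.
  by apply: IH; rewrite -ltnS; exact: leq_trans jm.
have := mulr_ge0 (ltW Pi) Vi; lra.
Qed.

Lemma network_reflection j : exists2 F,
  reflection (component X j) (y j ord0) F (component V j) &
  forall t, 0 <= t -> F t = L t j ord0.
Proof.
have [F [FE HF]] := network_regulators; have [rF cV _] := HF j.
exists (F j); last by move=> t; exact: FE.
apply: carried_reflection => //.
  by move=> t t0; rewrite /component VE// !mxE FE.
  by move=> t t0; apply: inv_netmx_ge0 => k; exact: W0.
by apply: cadlag_right_cont; exact: cadlag_mulmx.
Qed.

Hypothesis T1s : forall i j, 0 < P i j -> r j ord0 / r i ord0 < P i j.

Let cVj j : cadlag (component V j). Proof. exact: cadlag_mulmx. Qed.

Let Vpar (i j : 'I_n) t : 0 < P i j -> (forall i', i' != i -> P i' j = 0) ->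
  V t j ord0 = W t j ord0 + P i j * V t i ord0.
Proof.
move=> Pi Pu; rewrite WV (bigD1 i)//= big1 ?addr0 ?subrK//.
by move=> i' ii'; rewrite Pu// mul0r.
Qed.

(** The content [V_i] of the feeding station is positive at [a]. Were its left limit [lam] positive,
    [L_i] would be constant up to [a] and the strict slope would give [W_j(a) > 0]. So [lam] is 0,
    and since [L_i] does not jump at [a], the balance bounds [W_j] before [a] by a quantity tending
    to 0. *)
Lemma empty_station_left j a : 0 < a -> component W j a = 0 ->
  component V j a <> 0 -> left_lim (component V j) a 0.
Proof.
move=> a0 Wa Va.
have [F [FE HF]] := network_regulators.
have [Pz|[i [ij Pi Pu]]] := tree_parent hnet j.
  case: Va; move: Wa; rewrite /component WV big1 ?subr0// => i _.
  by rewrite Pz mul0r.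
have sl : 0 < P i j * r i ord0 - r j ord0.
  have := T1s Pi; case: hnet => _ r0 _ _ _; rewrite ltr_pdivrMr//; lra.
have Via : 0 < component V i a.
  rewrite lt_neqAle; apply/andP; split; last first.
    by apply: inv_netmx_ge0 => k; apply: W0; exact: ltW.
  apply/eqP => E; apply: Va; rewrite /component (Vpar _ Pi Pu).
  by rewrite -/(component W j a) Wa -/(component V i a) -E mulr0 addr0.
have incr s : 0 <= s <= a -> component W j s
    + (F j a - F j s) + (P i j * r i ord0 - r j ord0) * (a - s)
    <= P i j * (F i a - F i s).
  move=> sa; have := Wincr Pi Pu ij sa; rewrite -/(component W j a) Wa.
  case/andP: sa => s0 sa; rewrite !FE// ?(le_trans s0)// /component; lra.
have ndFj s : s <= a -> 0 <= F j a - F j s.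
  by move=> sa; have [[nd _ _] _ _] := HF j; rewrite subr_ge0 nd.
have [[ndFi _ _] cVi _] := HF i.
have [lam Hlam] := cadlag_left (cVj i) a0.
have lam0 : lam <= 0.
  rewrite leNgt; apply/negP => lamp.
  have l20 : 0 < lam / 2 by rewrite divr_gt0.
  have [dd /andP[d0 da] Hd] := Hlam _ l20.
  pose c := Num.min (lam / 2) (component V i a).
  have c0 : 0 < c by rewrite lt_min l20.
  have c1 : c <= lam / 2 by rewrite ge_min lexx.
  have c2 : c <= component V i a by rewrite ge_min lexx orbT.
  have fl : flat (F i) (a - dd) a.
    apply: (cVi _ _ _ c0); first by apply/andP; split; lra.
    move=> s /andP[ds]; rewrite le_eqVlt => /orP[/eqP ->//|sa].
    have := Hd s; rewrite ds sa => /(_ isT); rewrite ltr_norml => /andP[]; lra.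
  have sl0 : 0 < (P i j * r i ord0 - r j ord0) * dd / P i j.
    by rewrite divr_gt0// mulr_gt0.
  have [s' s'd Hs'] := fl _ sl0.
  have := incr (a - dd); rewrite (_ : 0 <= a - dd <= a) => [/(_ isT)|]; last first.
    by apply/andP; split; lra.
  have -> : a - (a - dd) = dd by ring.
  have W1 : 0 <= component W j (a - dd) by apply: W0; lra.
  have := ndFj (a - dd); rewrite (_ : a - dd <= a) => [/(_ isT)|]; last by lra.
  have := ndFi _ _ (ltW s'd).
  rewrite ltr_pdivlMr// mulrC in Hs'.
  have : P i j * (F i a - F i (a - dd)) <= P i j * (F i a - F i s').
    by rewrite ler_pM2l// lerD2l lerN2 ndFi// ltW.
  lra.
move=> e e0.
have e1 : 0 < e / 2 / P i j by rewrite !divr_gt0.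
have fla : flat (F i) a a.
  apply: (cVi _ _ _ Via); first by rewrite (ltW a0) lexx.
  by move=> s /andP[s1 s2]; rewrite (_ : s = a)//; lra.
have [a' a'a Ha'] := fla _ e1.
have [d1 /andP[d10 d1a] Hd1] := Hlam _ e1.
exists (Num.min d1 (a - a')); first by rewrite lt_min d10 subr_gt0 a'a ge_min d1a.
move=> s /andP[sd sa].
have s1 : a - d1 <= s by apply: le_trans sd; rewrite lerD2l lerN2 ge_min lexx.
have s2 : a' <= s.
  have : Num.min d1 (a - a') <= a - a' by rewrite ge_min lexx orbT.
  lra.
have s0 : 0 <= s by lra.
have := incr s; rewrite s0 (ltW sa) => /(_ isT).
have := ndFj s (ltW sa).
have := mulr_ge0 (ltW sl) (_ : 0 <= a - s); rewrite subr_ge0 (ltW sa) => /(_ isT).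
have : P i j * (F i a - F i s) < e / 2.
  rewrite mulrC -ltr_pdivlMr//; have := ndFi _ _ s2; lra.
have : P i j * component V i s < e / 2.
  rewrite mulrC -ltr_pdivlMr//.
  by have := Hd1 s; rewrite s1 sa => /(_ isT); rewrite ltr_norml => /andP[]; lra.
have Vs0 : 0 <= component V i s by apply: inv_netmx_ge0 => k; exact: W0.
have := mulr_ge0 (ltW Pi) Vs0.
have := W0 j s0; rewrite -/(component W j s).
have -> : component V j s = component W j s + P i j * component V i s.
  by rewrite /component (Vpar _ Pi Pu).
by move=> *; rewrite subr0 ger0_norm; lra.
Qed.

(** [V_i] stays positive for a while after [a], which freezes [L_i], and the strict slope fills
    station [j]. *)
Lemma empty_station_right j a : 0 <= a -> component W j a = 0 ->
  component V j a <> 0 ->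
  exists2 e, 0 < e & forall s, a < s < a + e -> component W j s <> 0.
Proof.
move=> a0 Wa Va.
have [F [FE HF]] := network_regulators.
have [Pz|[i [ij Pi Pu]]] := tree_parent hnet j.
  case: Va; move: Wa; rewrite /component WV big1 ?subr0// => i _.
  by rewrite Pz mul0r.
have sl : 0 < P i j * r i ord0 - r j ord0.
  have := T1s Pi; case: hnet => _ r0 _ _ _; rewrite ltr_pdivrMr//; lra.
have Via : 0 < component V i a.
  rewrite lt_neqAle; apply/andP; split; last first.
    by apply: inv_netmx_ge0 => k; exact: W0.
  apply/eqP => E; apply: Va; rewrite /component (Vpar _ Pi Pu).
  by rewrite -/(component W j a) Wa -/(component V i a) -E mulr0 addr0.
have [[ndFi _ _] cVi _] := HF i; have [[ndFj _ _] _ _] := HF j.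
have v2 : 0 < component V i a / 2 by rewrite divr_gt0.
have [e e0 He] := cadlag_right (cVj i) a0 v2.
exists e => // s /andP[as_ se] Ws.
have fl : flat (F i) a s.
  apply: (cVi _ _ _ v2); first by rewrite a0 ltW.
  move=> u /andP[au us]; have := He u; rewrite au (le_lt_trans us se) => /(_ isT).
  by rewrite ltr_norml => /andP[]; lra.
have sl0 : 0 < (P i j * r i ord0 - r j ord0) * (s - a) / P i j.
  by rewrite divr_gt0// mulr_gt0// subr_gt0.
have [a' a'a Ha'] := fl _ sl0.
have as0 : 0 <= a <= s by rewrite a0 ltW.
have := Wincr Pi Pu ij as0; rewrite -/(component W j a) -/(component W j s) Wa Ws.
rewrite -!FE ?(le_trans a0 (ltW as_))//.
have := ndFj _ _ (ltW as_).
have : P i j * (F i s - F i a) <= P i j * (F i s - F i a').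
  by rewrite ler_pM2l// lerD2l lerN2 ndFi// ltW.
rewrite ltr_pdivlMr// mulrC in Ha'; lra.
Qed.

End network_path.

(** * Discretised path functionals and time reversal *)

Section grid_functionals.
Context {R : realType}.
Implicit Types (y : nat -> R) (t : R).

(** Enumerates the dyadic points of [0, 1] through codes of pairs. Invalid codes and too large
    numerators are also sent into [0, 1]; repetitions are harmless. *)
Definition grid (i : nat) : R :=
  let p := odflt (0%N, 0%N) (unpickle i) in dyadic p.1 (minn p.2 (2 ^ p.1)).

Lemma grid_dyadic m k : (k <= 2 ^ m)%N -> exists i, grid i = dyadic m k.
Proof.
move=> km; exists (pickle (m, k)); rewrite /grid pickleK /=.
by rewrite (minn_idPl km).
Qed.

Lemma grid_itv i : 0 <= grid i <= 1.
Proof.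
rewrite /grid; set p := odflt _ _.
have m0 : 0 < (2 ^ p.1)%:R :> R by rewrite ltr0n expn_gt0.
by rewrite /dyadic divr_ge0//= ler_pdivrMr// mul1r ler_nat geq_minr.
Qed.

Lemma grid0 : exists i, grid i = 0.
Proof. by have [i gi] := @grid_dyadic 0 0 isT; exists i; rewrite gi /dyadic mul0r. Qed.

Lemma grid1 : exists i, grid i = 1.
Proof. by have [i gi] := @grid_dyadic 0 1 isT; exists i; rewrite gi /dyadic divr1. Qed.

Lemma grid_dense u v : 0 <= u -> u < v -> v <= 1 -> exists i, u < grid i < v.
Proof.
move=> u0 uv v1; have uv0 : 0 < v - u by rewrite subr_gt0.
have [m Hm] := dyadic_dense u0 uv0.
have [k] := Hm m (leqnn _); rewrite addrC subrK => /andP[uk kv].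
have m0 : 0 < (2 ^ m)%:R :> R by rewrite ltr0n expn_gt0.
have [|i Hi] := @grid_dyadic m k; last by exists i; rewrite Hi uk kv.
rewrite -(ler_nat R) -[leRHS]mul1r -ler_pdivrMr//.
exact: le_trans (ltW kv) v1.
Qed.

(** Puts the times of a cylinder on one mesh, where they are the times of a random walk. *)
Lemma grid_common (s : seq nat) : exists m, forall i, i \in s ->
  exists k, (k <= 2 ^ m)%N /\ grid i = dyadic m k.
Proof.
elim: s => [|i s [m Hm]]; first by exists 0%N.
pose p := odflt (0%N, 0%N) (unpickle i : option (nat * nat)).
have lift a b k : (a <= b)%N -> (k <= 2 ^ a)%N -> exists k', (k' <= 2 ^ b)%N /\
    dyadic a k = dyadic b k' :> R.
  move=> ab ka; exists (k * 2 ^ (b - a))%N; split.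
    by rewrite -[in leqRHS](subnK ab) expnD mulnC leq_mul2l ka orbT.
  rewrite /dyadic -[in (2 ^ b)%N](subnK ab) expnD !natrM.
  have nz c : (2 ^ c)%:R != 0 :> R by rewrite pnatr_eq0 -lt0n expn_gt0.
  by have := nz (b - a)%N; have := nz a => ? ?; field; apply/andP.
exists (maxn p.1 m) => j; rewrite inE => /orP[/eqP ->|/Hm[k [km ->]]].
  have [k' [k'm E]] := lift p.1 (maxn p.1 m) (minn p.2 (2 ^ p.1))
     (leq_maxl _ _) (geq_minr _ _).
  by exists k'; rewrite -E.
have [k' [k'm E]] := lift m (maxn p.1 m) k (leq_maxr _ _) km.
by exists k'; rewrite -E.
Qed.

Definition grid_sup y : \bar R := ereal_sup (range (fun i => (y i)%:E)).

Definition grid_supl y i : \bar R :=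
  ereal_sup (range (fun j => if grid j <= grid i then (y j)%:E else -oo%E)).

Definition grid_supr y i : \bar R :=
  ereal_sup (range (fun j => if grid i <= grid j then (y j)%:E else -oo%E)).

(* Counterparts of [path_G] and [path_H] for values [y i] at the times
   [t * grid i] of [0, t]; they involve countably many times only, so that they
   are measurable. *)
Definition grid_G t y : \bar R := ereal_inf (range (fun i =>
  if grid_supl y i == grid_sup y then (t * grid i)%:E else t%:E)).

Definition grid_H t y : \bar R := ereal_inf (range (fun i =>
  if (y i)%:E != grid_supr y i then (t * grid i)%:E else t%:E)).

Lemma grid_supP y (b : R) : (forall i, y i <= b) ->
  (forall e, 0 < e -> exists i, b - e < y i) -> grid_sup y = b%:E.
Proof.
move=> yb yb'; apply/eqP; rewrite eq_le; apply/andP; split.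
  by apply: ge_ereal_sup => _ [i _ <-]; rewrite lee_fin.
apply/lee_addgt0Pr => e e0; have [i yi] := yb' e e0.
apply: (@le_trans _ _ ((y i)%:E + e%:E)%E); first by rewrite -EFinD lee_fin; lra.
by rewrite leeD2r//; apply: ereal_sup_ubound; exists i.
Qed.

Lemma grid_supl_eq y (b : R) i : (forall j, y j <= b) -> grid_sup y = b%:E ->
  (grid_supl y i == grid_sup y) <->
  (forall e, 0 < e -> exists j, grid j <= grid i /\ b - e < y j).
Proof.
move=> yb ->; split => [/eqP E e e0|H].
  have : ((b - e)%:E < grid_supl y i)%E by rewrite E lte_fin; lra.
  move=> /ereal_sup_gt[_ [j _ <-]]; case: ifP => // ji.
  by rewrite lte_fin => yj; exists j.
rewrite eq_le; apply/andP; split.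
  by apply: ge_ereal_sup => _ [j _ <-]; case: ifP => _; rewrite ?lee_fin ?leNye.
apply/lee_addgt0Pr => e e0; have [j [ji yj]] := H e e0.
apply: (@le_trans _ _ ((y j)%:E + e%:E)%E); first by rewrite -EFinD lee_fin; lra.
by rewrite leeD2r//; apply: ereal_sup_ubound; exists j => //; rewrite ji.
Qed.

Lemma grid_supr_neq y i : ((y i)%:E != grid_supr y i) <->
  exists j, grid i <= grid j /\ y i < y j.
Proof.
have le_sup : ((y i)%:E <= grid_supr y i)%E.
  by apply: ereal_sup_ubound; exists i => //; rewrite lexx.
split => [ne|[j [ij yj]]].
  have : ((y i)%:E < grid_supr y i)%E by rewrite lt_neqAle ne.
  move=> /ereal_sup_gt[_ [j _ <-]]; case: ifP => // ji.
  by rewrite lte_fin => yj; exists j.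
rewrite lt_eqF//; apply: (@lt_le_trans _ _ (y j)%:E); first by rewrite lte_fin.
by apply: ereal_sup_ubound; exists j => //; rewrite ij.
Qed.

End grid_functionals.

Section reflected_zeros.
Context {R : realType}.
Variables (x : R -> R) (v0 : R) (L V : R -> R).
Hypothesis refl : reflection x v0 L V.

Lemma refl_lower s s' : 0 <= s -> s <= s' -> - v0 - L s' <= x s.
Proof.
move=> s0 ss'; have := refl_ge0 refl s0; rewrite (refl_eq refl s0).
by have := refl_nd refl s0 ss'; lra.
Qed.

Lemma refl_L_ge0 s : 0 <= s -> 0 <= L s.
Proof. by move=> s0; rewrite -(refl_L0 refl) (refl_nd refl). Qed.

(** Without such a zero, [L] is constant on [q, a] for a dyadic [q] after [u]. There [V] is a
    translate of [x], so [x] creeps to [- v0 - L q] at [a]; hence [x a] is at most this level, and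
    [V a] is not positive. *)
Lemma zeros_before_left_lim a u :
  (forall m k c s, creeps_to x v0 (dyadic m k) c s -> x s <= c) ->
  0 < a -> left_lim V a 0 -> 0 < V a -> u < a ->
  exists2 z, 0 <= z < a /\ u < z & V z = 0.
Proof.
move=> creep a0 ll Va ua; apply: contrapT => no.
have m0 : 0 <= Num.max u 0 by rewrite le_max lexx orbT.
have ma : 0 < a - Num.max u 0 by rewrite subr_gt0 gt_max ua.
have [m' /(_ m' (leqnn _))[k']] := dyadic_dense m0 ma.
rewrite [_ + (a - _)]addrC subrK; set q := dyadic m' k' => /andP[mq qa].
have uq : u < q by apply: le_lt_trans mq; rewrite le_max lexx.
have q0 : 0 < q by exact: le_lt_trans mq.
have Vpos s : q <= s <= a -> 0 < V s.
  move=> /andP[qs]; rewrite le_eqVlt => /orP[/eqP ->//|sa].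
  have s0 := le_trans (ltW q0) qs.
  rewrite lt_neqAle (refl_ge0 refl)// andbT; apply/eqP => Vs; apply: no.
  by exists s => //; rewrite s0 sa (lt_le_trans uq).
have Lq s : q <= s <= a -> L s = L q.
  move=> /andP[qs sa]; apply: (refl_flat refl); first by rewrite (ltW q0).
  by move=> r /andP[qr rs]; apply: Vpos; rewrite qr (le_trans rs).
have : creeps_to x v0 q (- v0 - L q) a.
  split.
  - by rewrite (ltW q0).
  - split; last by have := refl_L_ge0 (ltW q0); lra.
    by move=> s /andP[]; exact: refl_lower.
  - move=> e e0; have [L0|L0] := leP (L q) 0.
      by left; have := refl_L_ge0 (ltW q0); lra.
    by right; have [s sq Hs] := refl_min refl (ltW q0) e0 L0; exists s => //; lra.
  - move=> s /andP[qs sa]; have s0 := le_trans (ltW q0) qs.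
    have sa' : q <= s <= a by rewrite qs ltW.
    by have := Vpos s sa'; rewrite (refl_eq refl s0) (Lq s sa'); lra.
  move=> e e0; have [d /andP[d0 da] Hd] := ll e e0.
  exists (Num.min d (a - q)); first by rewrite lt_min d0 subr_gt0 qa ge_min da.
  move=> s /andP[sd sa].
  have m1 : Num.min d (a - q) <= d by rewrite ge_min lexx.
  have m2 : Num.min d (a - q) <= a - q by rewrite ge_min lexx orbT.
  have qs : q <= s by lra.
  have sa' : q <= s <= a by rewrite qs ltW.
  have := Hd s; rewrite sa andbT (_ : a - d <= s); last by lra.
  move=> /(_ isT); rewrite subr0 (refl_eq refl (le_trans (ltW q0) qs)) (Lq s sa').
  by rewrite (_ : x s - (- v0 - L q) = v0 + x s + L q)//; ring.
move=> /creep; have qa' : q <= a <= a by rewrite lexx ltW.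
by have := Va; rewrite (refl_eq refl (ltW a0)) (Lq a qa'); lra.
Qed.

(** [refl_min] with a precision below [V t] yields a point [s] other than [t], and nonnegativity of
    [V] at [s] bounds [L t - L s]. *)
Lemma refl_no_jump t e : 0 < t -> 0 < V t -> 0 < e ->
  exists2 s, 0 <= s < t & L t - L s < e.
Proof.
move=> t0 Vt e0; apply: contrapT => no.
have big s : 0 <= s < t -> e <= L t - L s.
  by move=> st; rewrite leNgt; apply/negP => H; apply: no; exists s.
have Lt : 0 < L t.
  by have := big 0; rewrite lexx t0 (refl_L0 refl) => /(_ isT); lra.
have m0 : 0 < Num.min e (V t) by rewrite lt_min e0.
have [s /andP[s0]] := refl_min refl (ltW t0) m0 Lt.
rewrite le_eqVlt => /orP[/eqP ->|st]; rewrite lt_min => /andP[H1 H2].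
  by move: H2; rewrite (refl_eq refl (ltW t0)) ltxx.
have := big s; rewrite s0 st => /(_ isT).
by have := refl_ge0 refl s0; rewrite (refl_eq refl s0); lra.
Qed.

End reflected_zeros.

Section reversed_path.
Context {R : realType}.
Variables (x : R -> R) (v0 : R) (L V : R -> R) (t : R).
Hypotheses (cx : cadlag x) (x0 : x 0 = 0) (v00 : 0 <= v0) (t0 : 0 < t).
Hypothesis refl : reflection x v0 L V.
Hypothesis rcV : right_cont V.
Hypothesis creep : forall m k c s, creeps_to x v0 (dyadic m k) c s -> x s <= c.

(* The initial content [v0] enters as a jump at time [t], the reversed time 0. *)
Definition reversed (i : nat) : R :=
  x t - x (t - t * grid i) + (if grid i == 1 :> R then v0 else 0).

Let s_ i : R := t - t * grid i.
(** The path with its initial value lowered to [- v0]; its infimum on [0, t] is [m]. So [reversed]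
    is [x t - z], with supremum [x t - m = V t]. *)
Let z s := if s == 0 then - v0 else x s.
Let m := - v0 - L t.

Let s_itv i : 0 <= s_ i <= t.
Proof.
have /andP[g0 g1] := @grid_itv R i; rewrite /s_.
have := mulr_ge0 (ltW t0) g0; have : t * grid i <= t by rewrite ler_piMr// ltW.
by move=> ? ?; apply/andP; split; lra.
Qed.

Let s_eq0 i : (s_ i == 0) = (grid i == 1 :> R).
Proof.
rewrite /s_ subr_eq0 eq_sym -[X in _ == X]mulr1.
by rewrite (inj_eq (mulfI (lt0r_neq0 t0))).
Qed.

Let s_le i j : (s_ i <= s_ j) = (grid j <= grid i :> R).
Proof. by rewrite /s_ lerD2l lerN2 ler_pM2l. Qed.

Let yE i : reversed i = x t - z (s_ i).
Proof.
rewrite /reversed /z s_eq0; case: ifP => [/eqP E|_]; last by rewrite addr0.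
by rewrite E mulr1 subrr x0 subr0 opprK.
Qed.

Let s_t : exists i, s_ i = t.
Proof. by have [i gi] := @grid0 R; exists i; rewrite /s_ gi mulr0 subr0. Qed.

Let s_0 : exists i, s_ i = 0.
Proof. by have [i gi] := @grid1 R; exists i; rewrite /s_ gi mulr1 subrr. Qed.

Let s_dense u v : 0 <= u -> u < v -> v <= t -> exists i, u < s_ i < v.
Proof.
move=> u0 uv vt.
have [|||i /andP[g1 g2]] := @grid_dense R (1 - v / t) (1 - u / t).
- by rewrite subr_ge0 ler_pdivrMr// mul1r.
- by rewrite ltrD2l ltrN2 ltr_pM2r// invr_gt0.
- by rewrite gerBl divr_ge0// ltW.
exists i; rewrite /s_; apply/andP; split.
  have : grid i * t < (1 - u / t) * t by rewrite ltr_pM2r.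
  rewrite mulrBl mul1r divfK ?lt0r_neq0//; lra.
have : (1 - v / t) * t < grid i * t by rewrite ltr_pM2r.
rewrite mulrBl mul1r divfK ?lt0r_neq0//; lra.
Qed.

Let VE s : 0 <= s -> V s = v0 + x s + L s. Proof. exact: refl_eq refl s. Qed.
Let V0 s : 0 <= s -> 0 <= V s. Proof. exact: refl_ge0 refl s. Qed.
Let Lnd s s' : 0 <= s -> s <= s' -> L s <= L s'. Proof. exact: refl_nd refl s s'. Qed.
Let L_ge0 s : 0 <= s -> 0 <= L s.
Proof. by move=> s0; rewrite -(refl_L0 refl) Lnd. Qed.

(** The exception is time 0, where [z] and [x] differ. *)
Let to_grid a b y i : s_ i = b -> 0 <= a <= b -> x a < y ->
  (exists j, [/\ a <= s_ j, s_ j <= b & z (s_ j) < y]) \/ (a = b /\ a = 0).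
Proof.
move=> ib /andP[a0 ab] xa.
have [bt|] := eqVneq a b.
  have [b0|b0] := eqVneq b 0; first by right; rewrite bt b0.
  by left; exists i; rewrite ib -bt lexx /z bt (negbTE b0) -bt.
move=> nab; have lab : a < b by rewrite lt_neqAle nab.
left; have e0 : 0 < y - x a by rewrite subr_gt0.
have [d d0 Hd] := cadlag_right cx a0 e0.
have bt : b <= t by rewrite -ib; case/andP: (s_itv i).
have [||j /andP[aj jb]] := @s_dense a (Num.min b (a + d)) a0.
- by rewrite lt_min lab ltrDl.
- by rewrite ge_min bt.
exists j; split; [exact: ltW|by rewrite (le_trans (ltW jb))// ge_min lexx|].
rewrite /z gt_eqF; last exact: le_lt_trans aj.
have := Hd (s_ j); rewrite (ltW aj) (lt_le_trans jb) ?ge_min ?lexx ?orbT//.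
by move=> /(_ isT); rewrite ltr_norml => /andP[_]; lra.
Qed.

Let z_ge s s' : 0 <= s -> s <= s' -> - v0 - L s' <= z s.
Proof.
move=> s0 ss'; rewrite /z; case: eqP => [_|_].
  by have := L_ge0 (le_trans s0 ss'); lra.
by have := V0 s0; rewrite VE//; have := Lnd s0 ss'; lra.
Qed.

Let approx i e : 0 < e -> exists j, s_ j <= s_ i /\ z (s_ j) < - v0 - L (s_ i) + e.
Proof.
move=> e0; have /andP[si0 sit] := s_itv i.
have [j0 j00] := s_0.
have [Ls|Ls] := leP (L (s_ i)) 0.
  by exists j0; rewrite j00 /z eqxx si0; split=> //; lra.
have [s /andP[s0 ssi] Hs] := refl_min refl si0 e0 Ls.
have xs : x s < - v0 - L (s_ i) + e by lra.
have [|[j [_ ji zj]]|[_ ss]] := @to_grid s (s_ i) _ i (erefl _) _ xs.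
- by rewrite s0.
- by exists j.
exists j0; rewrite j00 /z eqxx si0; split => //.
by move: xs v00; rewrite ss x0; lra.
Qed.

Let y_le i : reversed i <= V t.
Proof.
have /andP[s0 st] := s_itv i.
by rewrite yE VE ?(ltW t0)//; have := z_ge s0 st; lra.
Qed.

Lemma reversed_sup : grid_sup reversed = (V t)%:E.
Proof.
apply: grid_supP => // e e0.
have [i it] := s_t; have [j [_ zj]] := approx i e0.
by exists j; rewrite yE VE ?(ltW t0)//; rewrite it in zj; lra.
Qed.

Let cond i : (grid_supl reversed i == grid_sup reversed) <->
  (forall e, 0 < e -> exists j, s_ i <= s_ j /\ z (s_ j) < m + e).
Proof.
rewrite (grid_supl_eq i y_le reversed_sup); split => H e /H[j [ij Hj]]; exists j.
  split; first by rewrite s_le.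
  by move: Hj; rewrite yE VE ?(ltW t0)// /m; lra.
split; first by rewrite -s_le.
by move: Hj; rewrite yE VE ?(ltW t0)// /m; lra.
Qed.

Let ZV : set R := [set s | [/\ 0 <= s, s <= t & V s = 0]].

Let ubZ : has_ubound ZV. Proof. by exists t => s []. Qed.

Let supZ_ge0 : 0 <= sup ZV.
Proof.
have [[s Zs]|/nonemptyPn ->] := pselect (ZV !=set0); last by rewrite sup0.
by case: (Zs) => s0 _ _; apply: (le_trans s0); exact: ub_le_sup.
Qed.

Let supZ_le s : ZV s -> s <= sup ZV. Proof. exact: ub_le_sup. Qed.

Let supZ_lt u : 0 <= u -> u < sup ZV -> exists2 s, ZV s & u < s.
Proof.
move=> u0 uz.
have [ne|/nonemptyPn E] := pselect (ZV !=set0); last by move: uz; rewrite E sup0; lra.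
have d0 : 0 < sup ZV - u by rewrite subr_gt0.
have [s Zs] := sup_adherent d0 (conj ne ubZ).
by rewrite subKr => us; exists s.
Qed.

(** For [s_ i > 0], the infimum [m] is a value or a left limit of [x] on [s_i, t]. Where it is a
    value [V] vanishes; where it is a left limit and [V] is positive, the exclusion of upward jumps
    provides zeros of [V] just before. *)
Let claimA i : (forall e, 0 < e -> exists j, s_ i <= s_ j /\ z (s_ j) < m + e) ->
  s_ i <= sup ZV.
Proof.
move=> H; have /andP[si0 sit] := s_itv i.
have [->//|sin0] := eqVneq (s_ i) 0.
have sip : 0 < s_ i by rewrite lt_neqAle eq_sym sin0.
have xge s : 0 < s -> s <= t -> m <= x s.
  by move=> s0 st; have := z_ge (ltW s0) st; rewrite /z gt_eqF.
have zero v : s_ i <= v -> v <= t -> x v <= m -> s_ i <= sup ZV.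
  move=> iv vt xv; have vp := le_trans si0 iv.
  apply: (le_trans iv); apply: supZ_le; split => //.
  apply/eqP; rewrite eq_le V0// andbT VE//; have := Lnd vp vt; rewrite /m in xv; lra.
have [||s /andP[is_ st]|v /andP[iv vt] [xv|[iv' Hv]]] :=
    @cadlag_inf_attained _ x (s_ i) t m cx.
- by rewrite si0.
- move=> e /H[j [ij zj]]; have /andP[_ jt] := s_itv j; exists (s_ j).
    by rewrite ij.
  by move: zj; rewrite /z gt_eqF//; exact: lt_le_trans ij.
- by apply: xge => //; exact: lt_le_trans is_.
- by apply: (zero v) => //; rewrite xv.
have [xvm|mxv] := leP (x v) m; first exact: (zero v).
have vp : 0 < v by exact: lt_trans iv'.
have [Vv|Vv] := leP (V v) 0.
  apply: (le_trans iv); apply: supZ_le; split => //; first exact: ltW.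
  by apply/eqP; rewrite eq_le Vv V0// ltW.
have ll : left_lim V v 0.
  move=> e /Hv[d /andP[d0 dv] Hd]; exists d; first by rewrite d0; lra.
  move=> s sv; have := Hd s sv; case/andP: sv => sd sv.
  have sp : 0 <= s by lra.
  rewrite subr0 (ger0_norm (V0 sp)) ltr_norml VE// => /andP[_].
  by have := Lnd sp (le_trans (ltW sv) vt); rewrite /m; lra.
rewrite leNgt; apply/negP => zi.
have [z' [/andP[z'0 z'v] z'i] Vz'] := zeros_before_left_lim refl creep vp ll Vv iv'.
have : ZV z' by split => //; exact: ltW (lt_le_trans z'v vt).
by move=> /supZ_le; lra.
Qed.

(** Take a zero [z'] of [V] after [s_ i]. Either [L] does not grow after [z'], and the path is at
    [m] there, or [refl_min] places the infimum after [z']. *)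
Let claimB i : s_ i < sup ZV ->
  forall e, 0 < e -> exists j, s_ i <= s_ j /\ z (s_ j) < m + e.
Proof.
move=> iz e e0; have /andP[si0 sit] := s_itv i.
have [it iteq] := s_t.
have [z' [z'0 z't Vz'] iz'] := supZ_lt si0 iz.
have [s /andP[is_ st] xs] : exists2 s, s_ i < s <= t & x s < m + e.
  have [Lz|Lz] := leP (L t) (L z').
    exists z'; first by rewrite iz'.
    by move: Vz'; rewrite VE// /m; lra.
  have e1 : 0 < Num.min e (L t - L z') by rewrite lt_min e0 subr_gt0.
  have Lt : 0 < L t by apply: le_lt_trans Lz; exact: L_ge0.
  have [s /andP[s0 st]] := refl_min refl (ltW t0) e1 Lt.
  rewrite lt_min => /andP[H1 H2]; exists s; last by rewrite /m; lra.
  rewrite st andbT; apply: (lt_trans iz'); rewrite ltNge; apply/negP => sz.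
  by have := V0 s0; rewrite VE//; have := Lnd s0 sz; lra.
have [|[j [sj _ zj]]|[_ ss]] := @to_grid s t _ it iteq _ xs.
- by rewrite st andbT; exact: ltW (le_lt_trans si0 is_).
- by exists j; split => //; apply: le_trans sj; exact: ltW.
- by move: is_; rewrite ss; lra.
Qed.

Lemma reversed_G : grid_G t reversed = (busy_age V t)%:E.
Proof.
have -> : busy_age V t = t - sup ZV by [].
apply/eqP; rewrite eq_le; apply/andP; split; last first.
  apply: le_ereal_inf_tmp => _ [i _ <-].
  case: ifPn => [/cond/claimA|_]; rewrite lee_fin /s_; first by lra.
  by have := supZ_ge0; lra.
apply/lee_addgt0Pr => e e0; rewrite -EFinD.
(* Without a zero after time 0 the age is [t], which is also the largest possible value of
   [grid_G]. *)
have [iz|iz] := leP (sup ZV) 0.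
  apply: (@le_trans _ _ t%:E); last by rewrite lee_fin; lra.
  have [i gi] := @grid1 R; apply: ereal_inf_lbound; exists i => //.
  by rewrite gi mulr1; case: ifP.
have zt : sup ZV <= t.
  have [ne|/nonemptyPn ->] := pselect (ZV !=set0); last by rewrite sup0 ltW.
  by apply: ge_sup => // s [].
have [||i /andP[i1 i2]] := @s_dense (Num.max 0 (sup ZV - e)) (sup ZV) _ _ zt.
- by rewrite le_max lexx.
- by rewrite gt_max iz /= ltrBlDr ltrDl.
apply: (@le_trans _ _ (t * grid i)%:E); last first.
  rewrite lee_fin; move: i1; rewrite gt_max /s_ => /andP[_]; lra.
by apply: ereal_inf_lbound; exists i => //; rewrite ((cond i).2 (claimB i2)).
Qed.

Let NV : set R := [set s | [/\ 0 <= s, s <= t & V s <> 0]].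

(** On the original clock: [z] is above its running infimum [- v0 - L] exactly when [V] is positive.
    Time 0 has no earlier point to be compared with. *)
Let condH i : ((reversed i)%:E != grid_supr reversed i) <->
  (0 < s_ i /\ V (s_ i) <> 0).
Proof.
rewrite grid_supr_neq; have /andP[si0 sit] := s_itv i; split.
  move=> [j [ij]]; rewrite !yE ltrD2l ltrN2 => zz; have /andP[sj0 _] := s_itv j.
  rewrite -s_le in ij.
  have sip : 0 < s_ i.
    rewrite lt_neqAle si0 andbT; apply/eqP => E.
    by move: zz; rewrite /z -E eqxx (_ : s_ j = 0) ?eqxx ?ltxx//; lra.
  split => // Vi; move: zz; rewrite {2}/z gt_eqF//.
  have := z_ge sj0 ij; move: Vi; rewrite VE//; lra.
move=> [sip Vi].
have e0 : 0 < V (s_ i) by rewrite lt_neqAle V0// andbT eq_sym; apply/eqP.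
have [j [ji zj]] := approx i e0; exists j; split; first by rewrite -s_le.
rewrite !yE ltrD2l ltrN2; apply: (lt_le_trans zj).
by rewrite /z gt_eqF// VE//; lra.
Qed.

Lemma reversed_H : grid_H t reversed = (idle_age V t)%:E.
Proof.
have -> : idle_age V t = t - sup NV by [].
have ubN : has_ubound NV by exists t => s [].
have N0 : 0 <= sup NV.
  have [[s Ns]|/nonemptyPn ->] := pselect (NV !=set0); last by rewrite sup0.
  by case: (Ns) => s0 _ _; apply: (le_trans s0); exact: ub_le_sup.
apply/eqP; rewrite eq_le; apply/andP; split; last first.
  apply: le_ereal_inf_tmp => _ [i _ <-]; have /andP[si0 sit] := s_itv i.
  case: ifPn => [/condH[_ Vi]|_]; rewrite lee_fin; last by lra.
  have : s_ i <= sup NV by apply: ub_le_sup.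
  by rewrite /s_; lra.
apply/lee_addgt0Pr => e e0; rewrite -EFinD.
have [ne|/nonemptyPn ->] := pselect (NV !=set0); last first.
  rewrite sup0 subr0; apply: (@le_trans _ _ t%:E); last by rewrite lee_fin; lra.
  have [i gi] := @grid1 R; apply: ereal_inf_lbound; exists i => //.
  by rewrite gi mulr1; case: ifP.
have [s [s0 st Vs] Hs] := sup_adherent e0 (conj ne ubN).
suff [i [si Vi]] : exists i, [/\ 0 < s_ i /\ s <= s_ i & V (s_ i) <> 0].
  apply: (@le_trans _ _ (t * grid i)%:E); last first.
    by rewrite lee_fin; case: si => _; rewrite /s_; lra.
  by apply: ereal_inf_lbound; exists i => //; rewrite ((condH i).2 _)//; case: si.
(* [s] may be 0 or off the grid; unless [s = t], right-continuity of [V] moves it to a grid time on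
   its right. *)
have [E|nst] := eqVneq s t.
  by have [i it] := s_t; exists i; rewrite it -{2 3}E; split => //; split; rewrite ?E.
have lst : s < t by rewrite lt_neqAle nst.
have Vp : 0 < V s by rewrite lt_neqAle V0// andbT eq_sym; apply/eqP.
have [d d0 Hd] := rcV s0 Vp.
have [||i /andP[i1 i2]] := @s_dense s (Num.min t (s + d)) s0.
- by rewrite lt_min lst ltrDl.
- by rewrite ge_min lexx.
exists i; split; first by split; [exact: le_lt_trans i1|exact: ltW].
have := Hd (s_ i); rewrite (ltW i1) (lt_le_trans i2) ?ge_min ?lexx ?orbT//.
by move=> /(_ isT); rewrite ltr_norml => /andP[+ _] Vi; rewrite Vi; lra.
Qed.

End reversed_path.

(** * Path functionals on [0, t] as t grows *)

Section forward_path.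
Context {R : realType}.
Variables (x : R -> R) (v0 C e0 : R).
Hypotheses (cx : cadlag x) (x0 : x 0 = 0) (v00 : 0 <= v0) (e00 : 0 < e0).
Hypothesis xC : forall t, 0 <= t -> x t + e0 * t <= C.

(** [v0] is added at the end to match [reversed], so that both have the same law; it disappears in
    the limit because the path drifts to minus infinity. *)
Definition forward (t : R) (i : nat) : R :=
  x (t * grid i) + (if grid i == 1 :> R then v0 else 0).

Let far (K : R) : exists2 T, 0 < T & forall t, T <= t -> x t + v0 < K.
Proof.
pose T := Num.max 1 ((C + v0 - K) / e0 + 1).
have T1 : 1 <= T by rewrite le_max lexx.
have T2 : (C + v0 - K) / e0 + 1 <= T by rewrite le_max lexx orbT.
exists T; first by apply: lt_le_trans T1.
move=> t Tt; have t0 : 0 <= t by lra.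
have : (C + v0 - K) / e0 < t by lra.
rewrite ltr_pdivrMr//; have := xC t0; lra.
Qed.

Let b := fine (path_sup x).

Let supE : path_sup x = b%:E.
Proof.
rewrite /b fineK//; rewrite fin_numElt; apply/andP; split.
  apply: (@lt_le_trans _ _ 0%E); first exact: ltNyr.
  by apply: ereal_sup_ubound; exists 0; rewrite /= ?lexx ?x0.
apply: (@le_lt_trans _ _ C%:E); last exact: ltry.
apply: ge_ereal_sup => _ [s /= s0 <-]; rewrite lee_fin.
by have := xC s0; have := mulr_ge0 (ltW e00) s0; lra.
Qed.

Let x_le s : 0 <= s -> x s <= b.
Proof. by move=> s0; rewrite -lee_fin -supE; apply: ereal_sup_ubound; exists s. Qed.

Let b0 : 0 <= b. Proof. by rewrite -x0 x_le. Qed.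

Let x_near e : 0 < e -> exists2 s, 0 <= s & b - e < x s.
Proof.
move=> e1; have : ((b - e)%:E < path_sup x)%E by rewrite supE lte_fin; lra.
by move=> /ereal_sup_gt[_ [s /= s0 <-]]; rewrite lte_fin; exists s.
Qed.

Definition top_time (v : R) : Prop := 0 <= v /\ (x v = b \/ left_lim x v b /\ 0 < v).

Let path_GE : path_G x = ereal_inf [set v%:E | v in top_time].
Proof.
rewrite /path_G; congr ereal_inf; congr image; apply/funext => v; apply/propext.
rewrite supE; split => -[v1 [xv|H]]; split => //; [left|right|left|right].
- by case: xv.
- case: H => vp Hv; split => // e e1.
  have /fine_cvgP[_ /cvgrPdist_lt/(_ e e1)] := Hv.
  rewrite near_withinE => -[d /= d0 Hd].
  exists (Num.min (d / 2) v); first by rewrite lt_min vp divr_gt0//= ge_min lexx orbT.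
  move=> s /andP[s1 s2]; rewrite distrC; apply: Hd => //=.
  have : Num.min (d / 2) v <= d / 2 by rewrite ge_min lexx.
  by rewrite ltr_norml => ?; apply/andP; split; lra.
- by rewrite xv.
- case: H => Hv vp; split => //; apply/fine_cvgP; split; first exact: nearW.
  apply/cvgrPdist_lt => e e1; rewrite near_withinE.
  have [d /andP[d0 dv] Hd] := Hv e e1.
  exists d => //= s /= + sv; rewrite {1}ltr_norml => /andP[s1 s2]; rewrite distrC.
  by apply: Hd; apply/andP; split; lra.
Qed.

Section late.
Variables (T0 t : R).
Hypotheses (T00 : 0 < T0) (HT0 : forall s, T0 <= s -> x s + v0 < -1) (tT : T0 < t).

Let t0 : 0 < t. Proof. exact: lt_trans tT. Qed.

Let u_ i : R := t * grid i.

Let u_itv i : 0 <= u_ i <= t.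
Proof.
have /andP[g0 g1] := @grid_itv R i; rewrite /u_ mulr_ge0 ?(ltW t0)//=.
by rewrite ler_piMr// ltW.
Qed.

Let u_le i j : (u_ i <= u_ j) = (grid i <= grid j :> R).
Proof. by rewrite /u_ ler_pM2l. Qed.

Let u_eqt i : (grid i == 1 :> R) = (u_ i == t).
Proof.
rewrite /u_ -{2}[t]mulr1.
by rewrite (inj_eq (mulfI (lt0r_neq0 t0))).
Qed.

Let u_dense u v : 0 <= u -> u < v -> v <= t -> exists i, u < u_ i < v.
Proof.
move=> u0 uv vt.
have [|||i /andP[g1 g2]] := @grid_dense R (u / t) (v / t).
- by rewrite divr_ge0// ltW.
- by rewrite ltr_pM2r// invr_gt0.
- by rewrite ler_pdivrMr// mul1r.
exists i; rewrite /u_ [t * _]mulrC; apply/andP; split.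
  by rewrite -ltr_pdivrMr.
by rewrite -ltr_pdivlMr.
Qed.

Let y_eq i : u_ i < t -> forward t i = x (u_ i).
Proof. by move=> ut; rewrite /forward u_eqt lt_eqF// addr0. Qed.

Let y_end i : u_ i = t -> forward t i = x t + v0.
Proof. by move=> ut; rewrite /forward u_eqt -/(u_ i) ut eqxx. Qed.

Let y_late i : T0 <= u_ i -> forward t i < -1.
Proof.
move=> Tu; have /andP[_] := u_itv i; rewrite le_eqVlt => /orP[/eqP ut|ut].
  by rewrite y_end// HT0// ltW.
by rewrite y_eq//; have := HT0 Tu; move: v00; lra.
Qed.

Let y_le i : forward t i <= b.
Proof.
have [Tu|uT] := leP T0 (u_ i); first by have := y_late Tu; move: b0; lra.
rewrite y_eq ?(lt_trans uT)//; apply: x_le; by case/andP: (u_itv i).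
Qed.

Let to_grid a c y : 0 <= a -> a < c -> c <= t -> y < x a ->
  exists i, [/\ a < u_ i, u_ i < c & y < x (u_ i)].
Proof.
move=> a0 ac ct ya; have e1 : 0 < x a - y by rewrite subr_gt0.
have [d d0 Hd] := cadlag_right cx a0 e1.
have [||i /andP[i1 i2]] := @u_dense a (Num.min c (a + d)) a0.
- by rewrite lt_min ac ltrDl.
- by rewrite ge_min ct.
exists i; split => //; first by rewrite (lt_le_trans i2)// ge_min lexx.
have := Hd (u_ i); rewrite (ltW i1) (lt_le_trans i2) ?ge_min ?lexx ?orbT//.
by move=> /(_ isT); rewrite ltr_norml => /andP[+ _]; lra.
Qed.

(** As [x 0 = 0], the supremum [b] is nonnegative; after [T0], where [x + v0] is below -1, no value
    comes within 1 of it. The added [v0] thus never competes for the supremum. *)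
Let early s e : e <= 1 -> b - e < x s -> 0 <= s -> s < T0.
Proof.
move=> e1 xs s0; rewrite ltNge; apply/negP => Ts; have := HT0 Ts.
by move: b0 v00; lra.
Qed.

Lemma forward_sup : grid_sup (forward t) = b%:E.
Proof.
apply: grid_supP => // e e1.
have m0 : 0 < Num.min e 1 by rewrite lt_min e1 ltr01.
have m1 : Num.min e 1 <= 1 by rewrite ge_min lexx orbT.
have m2 : Num.min e 1 <= e by rewrite ge_min lexx.
have [s s0 xs] := x_near m0.
have sT := early m1 xs s0.
have [i [i1 i2 xi]] := to_grid s0 (lt_trans sT tT) (lexx t) xs; exists i.
by rewrite y_eq//; lra.
Qed.

Let cond i : (grid_supl (forward t) i == grid_sup (forward t)) <->
  (forall e, 0 < e -> exists j, u_ j <= u_ i /\ b - e < forward t j).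
Proof.
rewrite (grid_supl_eq i y_le forward_sup).
by split => H e /H[j [ji Hj]]; exists j; split => //; move: ji; rewrite u_le.
Qed.

Let top_before c : 0 <= c ->
  (forall e, 0 < e -> exists2 s, 0 <= s <= c & b - e < x s) ->
  exists2 v, top_time v & v <= c.
Proof.
move=> c0 H.
have cNx : cadlag (fun s => - x s).
  case: cx => rx lx; split => [s s0|s /lx[l Hl]]; first exact: cvgN (rx s s0).
  by exists (- l); exact: cvgN.
have [|||v /andP[v0' vc] [xv|[vp Hv]]] := @cadlag_inf_attained _ (fun s => - x s) 0 c (- b) cNx.
- by rewrite lexx.
- by move=> e /H[s sc xs]; exists s => //; lra.
- by move=> s /andP[s0 _]; rewrite lerN2 x_le.
- by exists v => //; split => //; left; lra.
exists v => //; split => //; right; split => // e /Hv[d /andP[d0 dv] Hd].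
exists d; first by rewrite d0; lra.
by move=> s /Hd; rewrite opprK addrC distrC.
Qed.

Let top_early v : top_time v -> v <= T0.
Proof.
move=> [v1 [xv|[Hv vp]]].
  by apply: ltW; apply: (@early v 1) => //; rewrite xv; lra.
rewrite leNgt; apply/negP => Tv.
have [d /andP[d0 dv] Hd] := Hv 1 ltr01.
pose s := Num.max T0 (v - d).
have s1 : T0 <= s by rewrite le_max lexx.
have s2 : v - d <= s by rewrite le_max lexx orbT.
have sv : s < v by rewrite gt_max Tv; lra.
have := Hd s; rewrite s2 sv => /(_ isT); rewrite ltr_norml => /andP[+ _].
by have := HT0 s1; move: b0 v00; lra.
Qed.

(** A grid time before [t] and after a [top_time] has a complete running supremum, by
    right-continuity or the left limit; conversely [cadlag_inf_attained], applied to [- x], finds a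
    [top_time] not after such a grid time. *)
Lemma forward_G : grid_G t (forward t) = path_G x.
Proof.
rewrite path_GE; apply/eqP; rewrite eq_le; apply/andP; split.
  apply: le_ereal_inf_tmp => _ [v tv <-].
  have vT := top_early tv; have [v1 _] := tv.
  apply/lee_addgt0Pr => e e1; rewrite -EFinD.
  have [||i /andP[i1 i2]] := @u_dense v (Num.min t (v + e)) v1.
  - by rewrite lt_min ltrDl e1 (le_lt_trans vT).
  - by rewrite ge_min lexx.
  apply: (@le_trans _ _ (t * grid i)%:E); last first.
    by rewrite lee_fin ltW// (lt_le_trans i2)// ge_min lexx orbT.
  apply: ereal_inf_lbound; exists i => //; rewrite ((cond i).2 _)// => e' e'1.
  have ut : u_ i < t by rewrite (lt_le_trans i2)// ge_min lexx.
  have [a [a0 ai xa]] : exists a, [/\ 0 <= a, a < u_ i & b - e' < x a].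
    case: tv => _ [xv|[Hv vp]]; first by exists v; split => //; rewrite xv; lra.
    have [d /andP[d0 dv] Hd] := Hv e' e'1; exists (v - d); split; [lra|lra|].
    have := Hd (v - d); rewrite lexx => /(_ _); rewrite ltr_norml.
    by rewrite ltrBlDr ltrDl d0 => /(_ isT)/andP[]; lra.
  have [j [j1 j2 xj]] := to_grid a0 ai (ltW ut) xa.
  by exists j; split; [exact: ltW|rewrite y_eq// (lt_trans j2)].
apply: le_ereal_inf_tmp => _ [i _ <-]; have /andP[u0 ut] := u_itv i.
have le c : (exists2 v, top_time v & v <= c) ->
    (ereal_inf [set v%:E | v in top_time] <= c%:E)%E.
  move=> [v tv vc]; apply: (@le_trans _ _ v%:E); last by rewrite lee_fin.
  by apply: ereal_inf_lbound; exists v.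
case: ifPn => [/cond H|_]; apply: le.
  apply: top_before => // e e1.
  have m0 : 0 < Num.min e 1 by rewrite lt_min e1 ltr01.
  have m1 : Num.min e 1 <= 1 by rewrite ge_min lexx orbT.
  have m2 : Num.min e 1 <= e by rewrite ge_min lexx.
  have [j [ji yj]] := H _ m0; have /andP[j0 jt] := u_itv j.
  have uT : u_ j < T0.
    by rewrite ltNge; apply/negP => /y_late; move: b0; lra.
  exists (u_ j); first by rewrite j0.
  by rewrite y_eq ?(lt_trans uT)// in yj; lra.
apply: top_before; first exact: ltW.
move=> e /x_near[s s0 xs].
have [st|ts] := leP s t; first by exists s => //; rewrite s0.
exists 0; first by rewrite lexx ltW.
by have := HT0 (ltW (lt_trans tT ts)); rewrite x0; move: v00; lra.
Qed.

Lemma forward_H_le v s : 0 <= v -> v < s -> s < t -> x v < x s ->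
  (grid_H t (forward t) <= v%:E)%E.
Proof.
move=> v1 vs st xvs.
apply/lee_addgt0Pr => e e1; rewrite -EFinD.
have g0 : 0 < (x s - x v) by rewrite subr_gt0.
have [d d0 Hd] := cadlag_right cx v1 g0.
have [||i /andP[i1 i2]] := @u_dense v (Num.min s (Num.min (v + d) (v + e))) v1.
- by rewrite !lt_min vs !ltrDl d0 e1.
- by rewrite ge_min (ltW st).
have is_ : u_ i < s by rewrite (lt_le_trans i2)// ge_min lexx.
have id : u_ i < v + d by rewrite (lt_le_trans i2)// !ge_min lexx orbT.
have ie : u_ i < v + e by rewrite (lt_le_trans i2)// !ge_min lexx !orbT.
have xi : x (u_ i) < x s.
  have := Hd (u_ i); rewrite (ltW i1) id => /(_ isT).
  by rewrite ltr_norml => /andP[_]; lra.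
have s0 : 0 <= s by lra.
have [j [j1 j2 xj]] := to_grid s0 st (lexx t) xi.
apply: (@le_trans _ _ (t * grid i)%:E); last by rewrite lee_fin ltW.
apply: ereal_inf_lbound; exists i => //.
rewrite ((grid_supr_neq _ i).2 _)//; exists j; split.
  by rewrite -u_le ltW// (lt_trans is_).
by rewrite !y_eq// (lt_trans is_).
Qed.

(** The end value, raised by [v0], might exceed earlier values of a path that is at its future
    supremum. The last hypothesis rules this out on [0, K]; it holds for large [t], since the path
    is bounded on [0, K] and drifts down. *)
Lemma forward_H_ge K c : (c%:E <= path_H x)%E -> c <= K -> K < t ->
  (forall s, 0 <= s <= K -> x t + v0 < x s) ->
  (c%:E <= grid_H t (forward t))%E.
Proof.
move=> cH cK Kt HK; apply: le_ereal_inf_tmp => _ [i _ <-].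
case: ifPn => [/grid_supr_neq[j [ij yij]]|_]; rewrite lee_fin; last first.
  by rewrite ltW// (le_lt_trans cK).
rewrite leNgt; apply/negP => ic; rewrite -/(u_ i) in ic.
have /andP[ui0 _] := u_itv i; have /andP[uj0] := u_itv j.
have : path_sup_from x (u_ i) = (x (u_ i))%:E.
  apply: contrapT => ne.
  suff : (path_H x <= (u_ i)%:E)%E by rewrite leNgt (lt_le_trans _ cH)// lte_fin.
  by apply: ereal_inf_lbound; exists (u_ i).
move=> E.
rewrite y_eq in yij; last by lra.
rewrite le_eqVlt => /orP[/eqP ut|ut].
  move: yij; rewrite y_end//; have := HK (u_ i); rewrite ui0 (le_trans (ltW ic))// => /(_ isT).
  lra.
rewrite y_eq// in yij.
have : ((x (u_ j))%:E <= path_sup_from x (u_ i))%E.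
  by apply: ereal_sup_ubound; exists (u_ j); rewrite //= u_le.
by rewrite E lee_fin leNgt yij.
Qed.

End late.

Lemma forward_sup_near : \forall t \near +oo, grid_sup (forward t) = path_sup x.
Proof.
have [T0 T00 HT0] := far (-1); exists T0; split; first by rewrite num_real.
by move=> t tT; rewrite (forward_sup T00 HT0).
Qed.

Lemma forward_G_near : \forall t \near +oo, grid_G t (forward t) = path_G x.
Proof.
have [T0 T00 HT0] := far (-1); exists T0; split; first by rewrite num_real.
by move=> t tT; rewrite (forward_G T00 HT0).
Qed.

Lemma path_H_ge0 : (0 <= path_H x)%E.
Proof. by apply: le_ereal_inf_tmp => _ [v [v1 _] <-]; rewrite lee_fin. Qed.

Let H_ge c : (c%:E <= path_H x)%E -> \forall t \near +oo, (c%:E <= grid_H t (forward t))%E.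
Proof.
move=> cH; have [T0 T00 HT0] := far (-1).
pose K := Num.max c 0.
have K0 : 0 <= K by rewrite le_max lexx orbT.
have cK : c <= K by rewrite le_max lexx.
have [B HB] := cadlag_bounded cx K0.
have [T1 T10 HT1] := far (- B).
exists (Num.max T0 (Num.max T1 K)); split; first by rewrite num_real.
move=> t; rewrite gt_max => /andP[tT0]; rewrite gt_max => /andP[tT1 tK].
apply: (forward_H_ge T00 tT0 cH cK tK) => s sK.
apply: (lt_le_trans (HT1 t (ltW tT1))).
by have := HB s sK; rewrite ler_norml => /andP[].
Qed.

Let H_le v : 0 <= v -> path_sup_from x v <> (x v)%:E ->
  \forall t \near +oo, (grid_H t (forward t) <= v%:E)%E.
Proof.
move=> v1 ne; have [T0 T00 HT0] := far (-1).
have : ((x v)%:E < path_sup_from x v)%E.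
  rewrite lt_neqAle; apply/andP; split; first by apply/eqP => E; apply: ne; rewrite E.
  by apply: ereal_sup_ubound; exists v; rewrite /= ?lexx.
move=> /ereal_sup_gt[_ [s /= vs <-]]; rewrite lte_fin => xvs.
have {}vs : v < s.
  by rewrite lt_neqAle vs andbT; apply/eqP => E; move: xvs; rewrite E ltxx.
exists (Num.max T0 s); split; first by rewrite num_real.
move=> t; rewrite gt_max => /andP[tT ts].
exact: (forward_H_le T00 tT v1 vs ts xvs).
Qed.

(** Eventual equality cannot be expected: [path_H] may be +oo, whereas [grid_H] is at most [t]. *)
Lemma forward_H_cvg : grid_H t (forward t) @[t --> +oo] --> path_H x.
Proof.
case E : (path_H x) => [h| |]; last by have := path_H_ge0; rewrite E.
  have upper e : 0 < e -> \forall t \near +oo, (grid_H t (forward t) <= (h + e)%:E)%E.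
    move=> e1; have : (path_H x < (h + e)%:E)%E by rewrite E lte_fin; lra.
    move=> /ereal_inf_lt[_ [v [v1 ne] <-]]; rewrite lte_fin => vh.
    by apply: filterS (H_le v1 ne) => t /le_trans; apply; rewrite lee_fin ltW.
  have lower : \forall t \near +oo, (h%:E <= grid_H t (forward t))%E.
    by apply: H_ge; rewrite E.
  apply/fine_cvgP; split.
    near=> t; rewrite fin_numElt; apply/andP; split.
      by apply: (@lt_le_trans _ _ h%:E); [exact: ltNyr|near: t].
    apply: (@le_lt_trans _ _ (h + 1)%:E); last exact: ltry.
    by near: t; exact: upper.
  apply/cvgrPdist_le => e e1; near=> t.
  have lo : (h%:E <= grid_H t (forward t))%E by near: t.
  have up : (grid_H t (forward t) <= (h + e)%:E)%E by near: t; exact: upper.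
  rewrite /=; case: (grid_H t (forward t)) lo up => [g| |]//=.
  by rewrite !lee_fin => ? ?; rewrite ler_norml; apply/andP; split; lra.
apply/cvgeyPge => A; apply: H_ge; rewrite E; exact: leey.
Unshelve. all: by end_near. Qed.

End forward_path.

(** * Laws of the reversed and of the forward paths *)

Section countable_codes.
Context {R : realType} {d : measure_display} {T : measurableType d}.

Lemma measurable_fun_ereal_sup (f : nat -> T -> \bar R) :
  (forall i, measurable_fun setT (f i)) ->
  measurable_fun setT (fun x => ereal_sup (range (f^~ x))).
Proof.
move=> mf; rewrite (_ : (fun x => _) = (fun x => esups (f^~ x) 0%N)).
  exact: measurable_fun_esups.
apply/funext => x; rewrite /esups /=; congr ereal_sup.
by apply/seteqP; split => _ [i _ <-]; exists i.
Qed.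

Lemma measurable_fun_ereal_inf (f : nat -> T -> \bar R) :
  (forall i, measurable_fun setT (f i)) ->
  measurable_fun setT (fun x => ereal_inf (range (f^~ x))).
Proof.
move=> mf; rewrite (_ : (fun x => _) = (fun x => einfs (f^~ x) 0%N)).
  exact: measurable_fun_einfs.
apply/funext => x; rewrite /einfs /=; congr ereal_inf.
by apply/seteqP; split => _ [i _ <-]; exists i.
Qed.

Lemma measurable_code (K : finType) (c : T -> {ffun K -> int}) (h : {ffun K -> int} -> R) :
  (forall v, measurable [set x | c x = v]) -> measurable_fun setT (h \o c).
Proof.
move=> mc _ B mB; rewrite setTI.
rewrite (_ : (h \o c) @^-1` B = \bigcup_i (if unpickle i is Some v then
    if `[< B (h v) >] then [set x | c x = v] else set0 else set0)).
  apply: bigcupT_measurable => i; case: (unpickle i) => // v.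
  by case: ifP.
apply/seteqP; split => x /=.
  by move=> Bx; exists (pickle (c x)) => //; rewrite pickleK; case: asboolP.
move=> [i _]; case: (unpickle i) => // v; case: asboolP => // Bv /= ->.
exact: Bv.
Qed.

Definition dyadic_floor (m : nat) (x : R) : R := (Num.floor (x * 2 ^+ m))%:~R / 2 ^+ m.

Lemma dyadic_floor_cvg (x : R) : dyadic_floor m x @[m --> \oo] --> x.
Proof.
apply/cvgrPdist_lt => e e0.
have [m0 Hm0] : exists m0, e^-1 < (2 ^ m0)%:R :> R.
  exists (Num.truncn e^-1).+1.
  apply: lt_trans (truncnS_gt _) _; rewrite ltr_nat; exact: ltn_expl.
exists m0 => // m /= m0m.
have m2 : 0 < 2 ^+ m :> R by rewrite exprn_gt0.
have em : 1 < e * 2 ^+ m.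
  rewrite mulrC -ltr_pdivrMr// div1r; apply: lt_le_trans Hm0 _.
  by rewrite natrX ler_weXn2l// ler1n.
have := floor_le (x * 2 ^+ m); have := floorD1_gt (x * 2 ^+ m).
rewrite intrD rmorph1 /dyadic_floor; set k := (Num.floor _)%:~R => h1 h2.
have k1 : k / 2 ^+ m <= x by rewrite ler_pdivrMr.
have k2 : x - k / 2 ^+ m < e.
  rewrite ltrBlDl -ltrBlDr ltr_pdivlMr// mulrBl; lra.
by rewrite ger0_norm ?subr_ge0.
Qed.

(* Sequential continuity suffices for measurability: discretise the coordinates
   at scale [2 ^ -m], so that only countably many values remain. *)
Lemma measurable_seq_continuous (K : finType) (U : K -> T -> R)
    (g : {ffun K -> R} -> R) :
  (forall k, measurable_fun setT (U k)) ->
  (forall (u : nat -> {ffun K -> R}) (v : {ffun K -> R}), (forall k, u m k @[m --> \oo] --> v k) ->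
     g (u m) @[m --> \oo] --> g v) ->
  measurable_fun setT (fun x => g [ffun k => U k x]).
Proof.
move=> mU gc.
pose c m x : {ffun K -> int} := [ffun k => Num.floor (U k x * 2 ^+ m)].
pose h m (v : {ffun K -> int}) := g [ffun k => (v k)%:~R / 2 ^+ m].
apply: (@measurable_fun_cvg _ _ _ _ (fun m => h m \o c m)).
  move=> m; apply: measurable_code => v.
  rewrite (_ : [set x | _] = \bigcap_(k in [set k | k \in enum K])
    (fun x => Num.floor (U k x * 2 ^+ m)) @^-1` [set v k]).
    apply: fin_bigcap_measurable; first exact: finite_finset.
    move=> k _; rewrite (_ : _ @^-1` _ = (fun x => U k x * 2 ^+ m) @^-1`
        `[(v k)%:~R, (v k + 1)%:~R[).
      apply: measurable_preimage => //; apply: measurable_funM => //.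
    apply/seteqP; split => x /=; rewrite in_itv /=.
      by move=> <-; rewrite floor_le floorD1_gt.
    by move=> /andP[h1 h2]; apply/floor_def; rewrite h1.
  apply/seteqP; split => x /=.
    by move=> <- k _; rewrite /c /= ffunE.
  by move=> H; apply/ffunP => k; rewrite ffunE; apply: (H k); rewrite /= mem_enum.
move=> x _; apply: gc => k; rewrite ffunE.
under eq_fun do rewrite !ffunE; exact: dyadic_floor_cvg.
Qed.

End countable_codes.

Section measurable_grid_functionals.
Context {R : realType} {d : measure_display} {T : measurableType d}.
Variable (y : T -> nat -> R).
Hypothesis my : forall i, measurable_fun setT (y^~ i).

Let myE i : measurable_fun setT (fun x => (y x i)%:E).
Proof. exact/measurable_EFinP. Qed.

Lemma measurable_grid_sup : measurable_fun setT (fun x => grid_sup (y x)).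
Proof. exact: (measurable_fun_ereal_sup myE). Qed.

Lemma measurable_grid_supl i : measurable_fun setT (fun x => grid_supl (y x) i).
Proof.
apply: (@measurable_fun_ereal_sup _ _ _ (fun j x =>
   if grid j <= (grid i : R) then (y x j)%:E else -oo%E)) => j.
by case: (grid j <= (grid i : R)).
Qed.

Lemma measurable_grid_supr i : measurable_fun setT (fun x => grid_supr (y x) i).
Proof.
apply: (@measurable_fun_ereal_sup _ _ _ (fun j x =>
   if grid i <= (grid j : R) then (y x j)%:E else -oo%E)) => j.
by case: (grid i <= (grid j : R)).
Qed.

Lemma measurable_grid_G t : measurable_fun setT (fun x => grid_G t (y x)).
Proof.
apply: (@measurable_fun_ereal_inf _ _ _ (fun i x =>
   if grid_supl (y x) i == grid_sup (y x) then (t * grid i)%:E else t%:E)) => i.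
apply: measurable_fun_ifT => //.
by apply: measurable_fun_eqe; [exact: measurable_grid_supl|exact: measurable_grid_sup].
Qed.

Lemma measurable_grid_H t : measurable_fun setT (fun x => grid_H t (y x)).
Proof.
apply: (@measurable_fun_ereal_inf _ _ _ (fun i x =>
   if (y x i)%:E != grid_supr (y x) i then (t * grid i)%:E else t%:E)) => i.
under eq_fun do rewrite if_neg.
apply: measurable_fun_ifT => //.
by apply: measurable_fun_eqe => //; exact: measurable_grid_supr.
Qed.

End measurable_grid_functionals.

Lemma grid_G_fin {R : realType} (t : R) y : 0 <= t -> grid_G t y \is a fin_num.
Proof.
move=> t0; rewrite fin_numElt; apply/andP; split.
  apply: (@lt_le_trans _ _ 0%E); first exact: ltNyr.
  apply: le_ereal_inf_tmp => _ [i _ <-]; have /andP[g0 _] := @grid_itv R i.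
  by case: ifP => _; rewrite lee_fin// mulr_ge0.
apply: (@le_lt_trans _ _ t%:E); last exact: ltry.
have [i gi] := @grid1 R; apply: ereal_inf_lbound; exists i => //.
by rewrite gi mulr1; case: ifP.
Qed.

Lemma grid_H_fin {R : realType} (t : R) y : 0 <= t -> grid_H t y \is a fin_num.
Proof.
move=> t0; rewrite fin_numElt; apply/andP; split.
  apply: (@lt_le_trans _ _ 0%E); first exact: ltNyr.
  apply: le_ereal_inf_tmp => _ [i _ <-]; have /andP[g0 _] := @grid_itv R i.
  by case: ifP => _; rewrite lee_fin// mulr_ge0.
apply: (@le_lt_trans _ _ t%:E); last exact: ltry.
have [i gi] := @grid1 R; apply: ereal_inf_lbound; exists i => //.
by rewrite gi mulr1; case: ifP.
Qed.

Section time_reversal.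
Context {R : realType} {d : measure_display} {Omega : measurableType d}.
Variables (Pr : probability Omega R) (n : nat) (X : Omega -> R -> 'I_n -> R).
Hypothesis walkX : walk_process Pr X.
Variables (v : 'I_n -> R) (t : R).
Hypothesis t0 : 0 < t.

Local Notation paths := (path_space R (nat * 'I_n)%type).

Definition forward_grid (w : Omega) : paths :=
  fun p => forward (X w ^~ p.2) (v p.2) t p.1.

Definition reversed_grid (w : Omega) : paths :=
  fun p => reversed (X w ^~ p.2) (v p.2) t p.1.

Let grid_time i : 0 <= t * grid i <= t.
Proof.
have /andP[g0 g1] := @grid_itv R i.
by rewrite mulr_ge0 ?(ltW t0)//= ler_piMr// ltW.
Qed.

Lemma measurable_forward_grid : measurable_fun setT forward_grid.
Proof.
case: walkX => mX _ _; apply: measurable_path => p; apply: measurable_funD => //.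
by apply: mX; case/andP: (grid_time p.1).
Qed.

Lemma measurable_reversed_grid : measurable_fun setT reversed_grid.
Proof.
case: walkX => mX _ _; apply: measurable_path => p; apply: measurable_funD => //.
apply: measurable_funB; apply: mX; first exact: ltW.
by rewrite subr_ge0; case/andP: (grid_time p.1).
Qed.

(** On a cylinder all times lie on one mesh, and both grids are the same function [psi] of the
    steps, taken in the given or in the reversed order, so exchangeability applies. *)
Lemma reversed_grid_law B : measurable B ->
  Pr (reversed_grid @^-1` B) = Pr (forward_grid @^-1` B).
Proof.
move=> mB; have mf := measurable_forward_grid; have mr := measurable_reversed_grid.
apply: (@path_measure_unique _ _
  (measure_function_pushforward__canonical__measure_function_Measure Pr mr)
  (measure_function_pushforward__canonical__measure_function_Measure Pr mf)) => //.
  by rewrite /= /pushforward preimage_setT probability_setT ltry.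
move=> s A mA; rewrite /= /pushforward.
have [m Hm] := @grid_common R [seq p.1 | p <- s].
pose N := (2 ^ m)%N; pose h : R := t / N%:R.
have N0 : 0 < N%:R :> R by rewrite ltr0n expn_gt0.
have h0 : 0 <= h by rewrite divr_ge0// ltW.
(* For the grid points in [s] the product is an integer and nothing is truncated. *)
pose kappa (i : nat) := Num.truncn (grid i * N%:R : R).
pose psi (x : path_space R (nat * 'I_n)%type) : paths := fun p =>
  walk_sum p.2 0 (kappa p.1) x + (if grid p.1 == 1 :> R then v p.2 else 0).
have mpsi : measurable_fun setT psi.
  by apply: measurable_path => p; apply: measurable_funD => //; exact: measurable_walk_sum.
pose sigma i := if (i < N)%N then (N.-1 - i)%N else i.
have sigmaK : involutive sigma.
  move=> i; rewrite /sigma; case: (ltnP i N) => iN; last by rewrite ltnNge iN.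
  by rewrite ifT; lia.
have sigmaN M : (N <= M)%N -> forall i, (sigma i < M)%N = (i < M)%N.
  move=> NM i; rewrite /sigma; case: (ltnP i N) => iN //.
  by rewrite !(leq_trans _ NM)//; lia.
have kappaE p : p \in s -> (kappa p.1 <= N)%N /\ t * grid p.1 = (kappa p.1)%:R * h.
  move=> ps; have [|k [kN gk]] := Hm p.1; first by apply/mapP; exists p.
  have -> : kappa p.1 = k.
    by rewrite /kappa gk /dyadic divfK ?lt0r_neq0// natrK.
  by split => //; rewrite gk /dyadic /h; field; exact: lt0r_neq0.
have tN : t = N%:R * h by rewrite /h mulrC divfK ?lt0r_neq0.
have WS k w l : walk_sum l 0 k (steps X h w) = X w (k%:R * h) l.
  by have := walk_sum_steps walkX l h 0 k w; rewrite !mul0r addr0.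
pose rsteps (w : Omega) : path_space R (nat * 'I_n)%type :=
  fun p => steps X h w (sigma p.1, p.2).
have WR k w l : (k <= N)%N -> walk_sum l 0 k (rsteps w) =
    X w (N%:R * h) l - X w ((N - k)%:R * h) l.
  elim: k => [|k IH] kN; first by rewrite /walk_sum big_ord0 subn0 subrr.
  rewrite /walk_sum big_ord_recr /= -/(walk_sum l 0 k _) (IH (ltnW kN)) addr0.
  rewrite /rsteps /steps /sigma /= kN.
  have -> : (N.-1 - k).+1 = (N - k)%N by lia.
  have -> : (N.-1 - k)%N = (N - k.+1)%N by lia.
  ring.
have F1 : forward_grid @^-1` cylinder s A = steps X h @^-1` (psi @^-1` cylinder s A).
  by apply/seteqP; split => w /= H p ps; have := H p ps;
    rewrite /psi WS /forward_grid /forward (kappaE p ps).2.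
have F2 : reversed_grid @^-1` cylinder s A = rsteps @^-1` (psi @^-1` cylinder s A).
  apply/seteqP; split => w /= H p ps; have := H p ps; have [kN kE] := kappaE p ps;
  rewrite /psi WR// /reversed_grid /reversed kE.
    by rewrite natrB// mulrBl -tN.
  by rewrite natrB// mulrBl -tN.
rewrite F1 F2 (steps_law_perm walkX h0 sigmaK sigmaN)//.
by apply: measurable_preimage => //; exact: measurable_cylinder.
Qed.

End time_reversal.

(** * Levy processes *)

Section fixed_time_jump.
Context {R : realType} {d : measure_display} {Omega : measurableType d}.
Variables (Pr : probability Omega R) (n : nat) (X : Omega -> R -> 'I_n -> R).
Hypothesis walkX : walk_process Pr X.
Variables (l : 'I_n) (t : R).
Hypothesis t0 : 0 < t.
Hypothesis Xcadlag : forall w, cadlag (fun s => X w s l).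

(** A mesh on which [t - h k] and [t] are consecutive, so that the increment between them is
    distributed like [X (h k)]. *)
Let h k : R := t / (2 ^ k)%:R.

Let h0 k : 0 < h k. Proof. by rewrite divr_gt0// ltr0n expn_gt0. Qed.

Let h_le k : h k <= t.
Proof.
rewrite ler_pdivrMr ?ltr0n ?expn_gt0//.
by rewrite ler_peMr ?(ltW t0)// ler1n expn_gt0.
Qed.

Let h_small e : 0 < e -> exists k0, forall k, (k0 <= k)%N -> h k < e.
Proof.
move=> e0; have et : 0 < e / t by rewrite divr_gt0.
exists (Num.truncn (e / t)^-1).+1 => k k0k.
have m0 : 0 < (2 ^ k)%:R :> R by rewrite ltr0n expn_gt0.
rewrite /h ltr_pdivrMr// mulrC -ltr_pdivrMr//.
have : (e / t)^-1 < (2 ^ k)%:R.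
  apply: lt_le_trans (truncnS_gt _) _; rewrite ler_nat.
  by apply: (leq_trans k0k); apply: ltnW; exact: ltn_expl.
by rewrite invf_div.
Qed.

Section scale.
Variable e : R.
Hypothesis e0 : 0 < e.

Let B k := [set w | e < `|X w t l - X w (t - h k) l|].
Let C k := [set w | e < `|X w (h k) l|].
Let D k := \bigcup_(j in [set j | (k <= j)%N]) C j.

Let mabs (f : Omega -> R) : measurable_fun setT f -> measurable [set w | e < `|f w|].
Proof.
move=> mf; rewrite (_ : [set w | _] = (fun w => `|f w|) @^-1` `]e, +oo[).
  by apply: measurable_preimage => //; exact: measurableT_comp.
by apply/seteqP; split => w /=; rewrite in_itv /= andbT.
Qed.

Let mB k : measurable (B k).
Proof.
case: walkX => mX _ _; apply: mabs; apply: measurable_funB; apply: mX.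
  exact: ltW.
by rewrite subr_ge0.
Qed.

Let mC k : measurable (C k).
Proof. by case: walkX => mX _ _; apply: mabs; apply: mX; exact: ltW. Qed.

Let mD k : measurable (D k). Proof. by apply: bigcup_measurable => j _. Qed.

Let BC k : Pr (B k) = Pr (C k).
Proof.
pose A : set (path_space R (nat * 'I_n)%type) := [set x | e < `|x (0%N, l)|].
have mA : measurable A.
  rewrite (_ : A = (fun x => `|x (0%N, l)|) @^-1` `]e, +oo[).
    apply: measurable_preimage => //; apply: measurableT_comp => //.
    exact: (measurable_coord (0%N, l)).
  by apply/seteqP; split => w /=; rewrite /A /= in_itv /= andbT.
have N0 : (0 < 2 ^ k)%N by rewrite expn_gt0.
have N0' : (2 ^ k)%:R != 0 :> R by rewrite pnatr_eq0 -lt0n.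
have tN : (2 ^ k)%:R * h k = t by rewrite /h mulrC divfK.
have pE : (2 ^ k).-1%:R = (2 ^ k)%:R - 1 :> R by rewrite -subn1 natrB.
have := steps_indep walkX (2 ^ k).-1 (ltW (h0 k)) (@measurableT _ _) mA.
rewrite [X in (_ = X * _)%E](_ : _ = 1%E) ?mul1e; last first.
  by rewrite (_ : [set w | _] = setT) ?probability_setT//; apply/seteqP; split.
case: walkX => _ X0 _.
have -> : [set w | [set: path_space R (nat * 'I_n)%type] (walk_head (2 ^ k).-1 (steps X (h k) w))
     /\ A (walk_tail (2 ^ k).-1 (steps X (h k) w))] = B k.
  apply/seteqP; split => w; rewrite /A /B /walk_tail /steps /= add0n prednK// tN.
    by move=> [_]; rewrite pE mulrBl tN mul1r.
  by move=> H; split => //; rewrite pE mulrBl tN mul1r.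
have -> // : [set w | A (steps X (h k) w)] = C k.
by apply/seteqP; split => w; rewrite /A /C /steps /= mul1r mul0r X0 subr0.
Qed.

Let D_cvg0 : (Pr \o D) @ \oo --> 0%E.
Proof.
have D0 : \bigcap_k D k = set0.
  apply/seteqP; split => // w Dw; case: walkX => _ X0 _.
  have [dl dl0 Hdl] := cadlag_right (Xcadlag w) (lexx 0) e0.
  have [k0 Hk0] := h_small dl0.
  have [j /= kj] := Dw k0 I; rewrite /C /=.
  have := Hdl (h j); rewrite (ltW (h0 j)) add0r (Hk0 j kj) => /(_ isT).
  by rewrite X0 subr0; lra.
have <- : Pr (\bigcap_k D k) = 0%E by rewrite D0 measure0.
apply: nonincreasing_cvg_mu => //.
- by rewrite (le_lt_trans (probability_le1 _ _)) ?ltry.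
- exact: bigcapT_measurable.
- move=> a b ab; apply/subsetPset => w [j /= bj Hj].
  by exists j => //=; exact: leq_trans bj.
Qed.

Let jump_null : Pr.-negligible (lim_inf_sets B).
Proof.
have mL : measurable (lim_inf_sets B) by exact: measurable_lim_inf_sets.
exists (lim_inf_sets B); split => //.
apply/eqP; rewrite eq_le measure_ge0 andbT -(cvg_lim _ D_cvg0)//.
apply: lime_ge; first by apply/cvg_ex; eexists; exact: D_cvg0.
apply: nearW => m /=; apply: prob_lim_inf_sets_le => //.
exists m => k mk; rewrite BC; apply: le_measure; rewrite ?inE//.
by move=> w Cw; exists k.
Qed.

(** Almost surely the increment over [[t - h k, t]] is at most [e] for infinitely many [k], as it
    has the law of [X (h k)], which tends to 0. The other [e] is the distance of [X (t - h k)] from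
    the left limit. *)
Lemma no_big_jump : {ae Pr, forall w, forall lam,
  left_lim (fun s => X w s l) t lam -> `|X w t l - lam| <= 2 * e}.
Proof.
apply: negligibleS jump_null => w /= H; apply: contrapT => nL; apply: H => lam ll.
rewrite leNgt; apply/negP => big; apply: nL.
have [dl /andP[dl0 dlt] Hdl] := ll e e0.
have [k0 Hk0] := h_small dl0.
exists k0 => // k /= k0k; rewrite /B /=.
have hk := Hk0 k k0k.
have := Hdl (t - h k); rewrite lerD2l lerN2 (ltW hk) ltrBlDr ltrDl h0 => /(_ isT).
have := ler_normD (X w t l - X w (t - h k) l) (X w (t - h k) l - lam).
by rewrite addrA subrK; lra.
Qed.

End scale.

Lemma continuous_at_time : {ae Pr, forall w,
  left_lim (fun s => X w s l) t (X w t l)}.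
Proof.
have : {ae Pr, forall w, forall k lam, left_lim (fun s => X w s l) t lam ->
    `|X w t l - lam| <= 2 * k.+1%:R^-1}.
  by apply: ae_foralln => k; apply: no_big_jump; rewrite invr_gt0.
apply: filterS => w H; have [lam Hlam] := cadlag_left (Xcadlag w) t0.
suff -> : X w t l = lam by [].
apply/eqP; rewrite -subr_eq0 -normr_eq0 eq_le normr_ge0 andbT.
rewrite leNgt; apply/negP => J.
have J2 : 0 < `|X w t l - lam| / 2 by rewrite divr_gt0.
have := H (Num.truncn (`|X w t l - lam| / 2)^-1) lam Hlam.
have : (Num.truncn (`|X w t l - lam| / 2)^-1).+1%:R^-1 < `|X w t l - lam| / 2.
  by rewrite -[ltRHS]invrK ltf_pV2 ?posrE ?invr_gt0// truncnS_gt.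
move: (Num.truncn _).+1%:R^-1 => z; lra.
Qed.

End fixed_time_jump.

Section borel_preimages.
Context {R : realType} {n : nat}.

Lemma borel_set_preimage (S : topologicalType) (phi : S -> R) (A : set R) :
  continuous phi -> measurable A -> borel_set (phi @^-1` A).
Proof.
move=> cphi mA.
have sA : (@RGenOpens.G R).-sigma.-measurable A by rewrite -RGenOpens.measurableE.
suff : <<s @RGenOpens.G R >> `<=` [set B | borel_set (phi @^-1` B)] by exact.
apply: smallest_sub.
  split.
  - by rewrite /= preimage_set0; exact: sigma_algebra0.
  - move=> B /= sB; rewrite setTD preimage_setC -setTD; exact: sigma_algebraCD.
  - by move=> F /= sF; rewrite preimage_bigcup; exact: sigma_algebra_bigcup.
move=> _ [a [b ->]]; apply: sub_sigma_algebra.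
by move/continuousP : cphi; apply; exact: interval_open.
Qed.

Lemma borel_set_forall (phi : 'I_n -> 'cV[R]_n -> R) (A : 'I_n -> set R) :
  (forall l, continuous (phi l)) -> (forall l, measurable (A l)) ->
  borel_set [set u | forall l, A l (phi l u)].
Proof.
move=> cphi mA.
rewrite (_ : [set u | _] = ~` \bigcup_(i in [set: nat])
   (if insub i is Some l then phi l @^-1` (~` A l) else set0)).
  rewrite -setTD; apply: sigma_algebraCD; apply: sigma_algebra_bigcup => i.
  case: insub => [l|]; last exact: sigma_algebra0.
  by apply: borel_set_preimage => //; exact: measurableC.
apply/seteqP; split => u /=.
  by move=> H [i _]; case: insub => // l; apply; exact: H.
move=> H l; apply: contrapT => nA; apply: H; exists (l : nat) => //.
by rewrite valK.
Qed.

End borel_preimages.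

Section levy_walk.
Context {R : realType} {d : measure_display} {Omega : measurableType d}.
Variables (Pr : probability Omega R) (n : nat) (J : Omega -> R -> 'cV[R]_n).
Variables (r : 'cV[R]_n) (P : 'M[R]_n).
Hypothesis levyJ : levy_process Pr J.

Local Notation M := (invmx (netmx P)).
Definition free_coord (w : Omega) (t : R) (l : 'I_n) : R :=
  component (free_process r P (J w)) l t.

Lemma free_coordE w t l :
  free_coord w t l = (M *m J w t) l ord0 + - r l ord0 * t.
Proof. by rewrite /free_coord /component /free_process !mxE mulrC mulNr. Qed.

Lemma free_coord_cadlag w l : cadlag (fun t => free_coord w t l).
Proof.
under eq_fun do rewrite free_coordE.
apply: cadlag_add_linear; apply: cadlag_mulmx.
by case: levyJ => _ _ + _ _; exact.
Qed.

Lemma free_coord_walk : walk_process Pr free_coord.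
Proof.
case: levyJ => mJ J0 _ indJ statJ; split.
- move=> t l t0; under eq_fun do rewrite free_coordE mxE.
  apply: measurable_funD => //; apply: measurable_sum => k.
  by apply: measurable_funM => //; exact: mJ.
- by move=> w l; rewrite free_coordE J0 mulmx0 mxE mulr0 addr0.
move=> h N A h0 mA.
(* The affine map from an increment of [J] over a time [h] to that of [X]; by its continuity, boxes
   pull back to Borel sets. *)
pose phi l (u : 'cV[R]_n) := (M *m u) l ord0 + - r l ord0 * h.
have cphi l : continuous (phi l).
  rewrite (_ : phi l = (fun u : 'cV[R]_n => \sum_k M l k * u k ord0) \+
      cst (- r l ord0 * h)); last by apply/funext => u; rewrite /phi mxE.
  move=> u; have FF : Filter (nbhs u) := nbhs_filter u.
  apply: (@cvgD _ _ _ _ FF); last exact: cvg_cst.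
  apply: (@cvg_sum_real R 'I_n _ (nbhs u) _ (fun k v => M l k * v k ord0)
    (fun k => M l k * u k ord0)) => k.
  by apply: cvgM; [exact: cvg_cst|exact: (@coord_continuous R n 1 k ord0 u)].
pose A' i : set 'cV[R]_n := [set u | forall l, A i l (phi l u)].
have bA' i : borel_set (A' i) by exact: borel_set_forall.
pose t i : R := i%:R * h.
have t_ge0 i : 0 <= t i by rewrite mulr_ge0.
have tS i : t i.+1 = t i + h by rewrite /t -natr1 mulrDl mul1r.
have stepE w i l : steps free_coord h w (i, l) = phi l (increment J (t i) (t i.+1) w).
  rewrite /steps /= !free_coordE /phi /increment mulmxBr !mxE -!/(t _) tS; ring.
have := @indJ N t A' (t_ge0 0%N) _ bA'.
have tle i : t i <= t i.+1 by rewrite tS lerDl.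
move=> /(_ tle).
have -> : \bigcap_(i < N) (increment J (t i) (t i.+1) @^-1` A' i) =
   [set w | forall i, (i < N)%N -> forall l, A i l (steps free_coord h w (i, l))].
  apply/seteqP; split => w /= H i iN; first by move=> l; rewrite stepE; exact: H.
  by move=> l; rewrite -stepE; exact: H.
move=> ->; apply: eq_bigr => i _.
rewrite tS statJ//; congr (Pr _).
by apply/seteqP; split => w /= H l; have := H l; rewrite free_coordE.
Qed.

Hypothesis intJ : integrable_process Pr J.

Let intMJ l k : Pr.-integrable setT (fun w => (M l k * J w 1 k ord0)%:E).
Proof.
under eq_fun do rewrite EFinM.
by apply: integrableZl => //; exact: intJ.
Qed.

Let coordE l : (fun w => (free_coord w 1 l)%:E) =
  (fun w => (\sum_k (M l k * J w 1 k ord0)%:E) + (cst (- r l ord0)%:E w))%E.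
Proof.
by apply/funext => w; rewrite free_coordE mxE mulr1 EFinD sumEFin.
Qed.

Lemma free_coord_integrable l : Pr.-integrable setT (fun w => (free_coord w 1 l)%:E).
Proof.
rewrite coordE; apply: integrableD => //.
  by apply: integrable_sum => // k _; exact: intMJ.
exact: finite_measure_integrable_cst.
Qed.

Lemma free_coord_mean l : (\int[Pr]_w (free_coord w 1 l)%:E =
  ((M *m mean_vector Pr (fun w => J w 1)) l ord0 - r l ord0)%:E)%E.
Proof.
rewrite coordE integralD//; last 2 first.
- by apply: integrable_sum => // k _; exact: intMJ.
- exact: finite_measure_integrable_cst.
rewrite integral_cst//= probability_setT mule1 EFinB; congr (_ + _)%E.
rewrite integral_sum//.
rewrite mxE -sumEFin; apply: eq_bigr => k _.
rewrite !mxE EFinM unlock fineK.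
  by under eq_integral do rewrite EFinM; rewrite integralZl//; exact: intJ.
by apply: integrable_fin_num => //; exact: intJ.
Qed.

End levy_walk.

(** * Convergence in distribution *)

Lemma cvg_mx {T : topologicalType} {m n : nat} {U : Type} (F : set_system U)
    (f : U -> 'M[T]_(m, n)) (M : 'M[T]_(m, n)) : Filter F ->
  (forall i j, f x i j @[x --> F] --> M i j) -> f x @[x --> F] --> M.
Proof.
move=> FF fM A [Q nQ sQ].
have : F [set x | forall i, forall j, Q i j (f x i j)].
  apply: (@filter_forall U 'I_m (fun i => [set x | forall j, Q i j (f x i j)])) => i.
  apply: (@filter_forall U 'I_n (fun j => [set x | Q i j (f x i j)])) => j.
  exact: (fM i j (Q i j) (nQ i j)).
by move=> HF; apply: (@filterS U F FF _ _ _ HF) => x Hx; exact: sQ.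
Qed.

Lemma cvg_continuous {S S' : topologicalType} {U : Type} (F : set_system U)
    (f : S -> S') (g : U -> S) (a : S) : continuous f ->
  g x @[x --> F] --> a -> f (g x) @[x --> F] --> f a.
Proof. by move=> fc ga A /fc; exact: ga. Qed.

Lemma cvg_triple {S1 S2 S3 : topologicalType} {U : Type} (F : set_system U)
    (f1 : U -> S1) (f2 : U -> S2) (f3 : U -> S3) (a1 : S1) (a2 : S2) (a3 : S3) : Filter F ->
  f1 x @[x --> F] --> a1 -> f2 x @[x --> F] --> a2 -> f3 x @[x --> F] --> a3 ->
  (f1 x, f2 x, f3 x) @[x --> F] --> (a1, a2, a3).
Proof. by move=> FF h1 h2 h3; exact: (cvg_pair (cvg_pair h1 h2) h3). Qed.

Section limit_law.
Context {R : realType} {d : measure_display} {Omega : measurableType d}.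
Variables (Pr : probability Omega R) (n : nat) (X : Omega -> R -> 'I_n -> R).
Variables (P : 'M[R]_n) (v : 'I_n -> R).
Hypothesis walkX : walk_process Pr X.
Hypothesis Xcadlag : forall w l, cadlag (fun t => X w t l).
Hypothesis v_ge0 : forall l, 0 <= v l.
Hypothesis drifts : forall l, exists2 e, 0 < e &
  {ae Pr, forall w, exists c, forall t, 0 <= t -> X w t l + e * t <= c}.

Local Notation paths := (path_space R (nat * 'I_n)%type).
Local Notation state := ('cV[R]_n * 'cV[\bar R]_n * 'cV[\bar R]_n)%type.

Definition grid_triple (t : R) (x : paths) : state :=
  (netmx P *m \col_k fine (grid_sup (fun i => x (i, k))),
   \col_k grid_G t (fun i => x (i, k)), \col_k grid_H t (fun i => x (i, k))).

Definition sup_triple (w : Omega) : state :=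
  (netmx P *m \col_k fine (path_sup (X w ^~ k)),
   \col_k path_G (X w ^~ k), \col_k path_H (X w ^~ k)).

Section test_function.
Variables (f : state -> R) (C : R).
Hypotheses (fc : continuous f) (fC : forall x, `|f x| <= C).

(** For a fixed [t] the ages are finite, so [f] is read as a sequentially continuous function of 3n
    real coordinates, and no sigma-algebra on [state] is needed. *)
Lemma measurable_grid_triple t : 0 < t -> measurable_fun setT (f \o grid_triple t).
Proof.
move=> t0.
pose U (k : 'I_n + 'I_n + 'I_n) (x : paths) : R :=
  match k with
  | inl (inl k) => fine (grid_sup (fun i => x (i, k)))
  | inl (inr k) => fine (grid_G t (fun i => x (i, k)))
  | inr k => fine (grid_H t (fun i => x (i, k)))
  end.
pose g (u : {ffun 'I_n + 'I_n + 'I_n -> R}) : R :=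
  f (netmx P *m \col_k u (inl (inl k)), \col_k (u (inl (inr k)))%:E,
     \col_k (u (inr k))%:E).
have -> : f \o grid_triple t = fun x => g [ffun k => U k x].
  apply/funext => x; rewrite /g /= /grid_triple; congr (f (_ *m _, _, _));
    apply/matrixP => i j; rewrite !mxE ffunE//= fineK//.
  - exact/grid_G_fin/ltW.
  - exact/grid_H_fin/ltW.
apply: measurable_seq_continuous.
  have my k i : measurable_fun setT (fun x : paths => x (i, k)).
    exact: (measurable_coord (i, k)).
  by move=> [[k|k]|k]; apply: measurableT_comp => //;
    [exact: measurable_grid_sup|exact: measurable_grid_G|exact: measurable_grid_H].
move=> u w uw; rewrite /g.
apply: (cvg_continuous fc).
apply: cvg_triple.
- apply: cvg_mx => i j; rewrite mxE.
  under eq_fun do rewrite mxE; apply: cvg_sum_real => k.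
  by apply: cvgM; [exact: cvg_cst|under eq_fun do rewrite mxE; rewrite mxE; exact: uw].
- apply: cvg_mx => i j; rewrite mxE; under eq_fun do rewrite mxE.
  by apply: cvg_EFin; [exact: nearW|exact: uw].
- apply: cvg_mx => i j; rewrite mxE; under eq_fun do rewrite mxE.
  by apply: cvg_EFin; [exact: nearW|exact: uw].
Qed.

Let F t w : R := f (grid_triple t (forward_grid X v t w)).

Let mF t : 0 < t -> measurable_fun setT (F t).
Proof.
move=> t0; apply: (measurableT_comp (measurable_grid_triple t0)).
exact: (measurable_forward_grid walkX v t0).
Qed.

Let bounded_integrable (g : Omega -> R) : measurable_fun setT g ->
  (forall w, `|g w| <= C) -> Pr.-integrable setT (EFin \o g).
Proof.
move=> mg gC; apply: (@le_integrable _ _ _ Pr setT measurableT _ (cst C%:E)).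
- exact/measurable_EFinP.
- move=> w _ /=; rewrite lee_fin (le_trans (gC w))// ler_norm//.
- exact: finite_measure_integrable_cst.
Qed.

Lemma integral_reversed_forward t : 0 < t ->
  (\int[Pr]_w (f (grid_triple t (reversed_grid X v t w)))%:E =
   \int[Pr]_w (F t w)%:E)%E.
Proof.
move=> t0; have mr := measurable_reversed_grid walkX v t0.
have mf := measurable_forward_grid walkX v t0.
have mg : measurable_fun setT (EFin \o (f \o grid_triple t)).
  by apply/measurable_EFinP; exact: measurable_grid_triple.
have ir : Pr.-integrable (reversed_grid X v t @^-1` setT)
    ((EFin \o (f \o grid_triple t)) \o reversed_grid X v t).
  rewrite preimage_setT; apply: bounded_integrable; last by move=> w; exact: fC.
  exact: (measurableT_comp (measurable_grid_triple t0) mr).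
have iF : Pr.-integrable (forward_grid X v t @^-1` setT)
    ((EFin \o (f \o grid_triple t)) \o forward_grid X v t).
  rewrite preimage_setT; apply: bounded_integrable; last by move=> w; exact: fC.
  exact: (measurableT_comp (measurable_grid_triple t0) mf).
have := integral_pushforward mr mg ir measurableT; rewrite preimage_setT => <-.
have := integral_pushforward mf mg iF measurableT; rewrite preimage_setT => <-.
apply: eq_measure_integral => B mB _; exact: reversed_grid_law.
Qed.

Let F_cvg : {ae Pr, forall w, F t w @[t --> +oo] --> f (sup_triple w)}.
Proof.
have : {ae Pr, forall w, forall l, exists e c, 0 < e /\
    forall t, 0 <= t -> X w t l + e * t <= c}.
  apply: filter_forall => l; have [e e0 H] := drifts l.
  by apply: filterS H => w [c Hc]; exists e, c.
apply: filterS => w H.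
have X0 l : X w 0 l = 0 by case: walkX.
apply: (cvg_continuous fc).
apply: cvg_triple.
- apply: cvg_mx => i j; rewrite mxE.
  under eq_fun do rewrite mxE; apply: cvg_sum_real => k.
  apply: cvgM; first exact: cvg_cst.
  under eq_fun do rewrite mxE; rewrite mxE.
  apply: cvg_near_cst; have [e [c [e0 Hc]]] := H k.
  have := forward_sup_near (Xcadlag w k) (X0 k) (v_ge0 k) e0 Hc.
  by apply: filterS => t Ht; rewrite -Ht.
- apply: cvg_mx => i j; rewrite mxE; under eq_fun do rewrite mxE.
  apply: cvg_near_cst; have [e [c [e0 Hc]]] := H i.
  have := forward_G_near (Xcadlag w i) (X0 i) (v_ge0 i) e0 Hc.
  by apply: filterS => t Ht; rewrite -Ht.
- apply: cvg_mx => i j; rewrite mxE; under eq_fun do rewrite mxE.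
  have [e [c [e0 Hc]]] := H i.
  exact: (forward_H_cvg (v i) (Xcadlag w i) e0 Hc).
Qed.

Lemma integral_forward_cvg (u : nat -> R) :
  (forall k, 0 < u k) -> u k @[k --> \oo] --> +oo%R ->
  (\int[Pr]_w (f (sup_triple w))%:E \is a fin_num)%E /\
  (\int[Pr]_w (F (u k) w)%:E @[k --> \oo] --> \int[Pr]_w (f (sup_triple w))%:E)%E.
Proof.
move=> u0 uoo.
pose fk k w := (F (u k) w)%:E.
have cv : {ae Pr, forall w, fk k w @[k --> \oo] --> (f (sup_triple w))%:E}.
  apply: filterS F_cvg => w Hw; apply: cvg_EFin; first exact: nearW.
  exact: (cvg_comp _ _ uoo Hw).
(* [path_G] and [path_H] involve uncountably many times, so measurability of the limit is not at
   hand; the upper limit is an almost surely equal measurable function. *)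
pose h w := limn_esup (fk ^~ w).
have hE : {ae Pr, forall w, h w = (f (sup_triple w))%:E}.
  apply: filterS cv => w Hw; rewrite /h.
  by have [_ ->] := cvg_limn_einf_sup Hw.
rewrite -(ae_eq_integral_any hE).
have [|||||ih _ H] := @dominated_convergence _ _ _ Pr setT measurableT fk h (cst C%:E).
- by move=> k; apply/measurable_EFinP; exact: (mF (u0 _)).
- by apply: measurable_fun_limn_esup => k; apply/measurable_EFinP; exact: (mF (u0 _)).
- apply: filterS2 cv hE => w Hw -> _; exact: Hw.
- exact: finite_measure_integrable_cst.
- by apply: aeW => w k _; rewrite /fk /= lee_fin; exact: fC.
split; [exact: (integrable_fin_num measurableT ih)|exact: H].
Qed.

Lemma integral_forward_fin t : 0 < t -> (\int[Pr]_w (F t w)%:E \is a fin_num)%E.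
Proof.
move=> t0; apply: (integrable_fin_num measurableT).
by apply: bounded_integrable; [exact: mF|move=> w; exact: fC].
Qed.

End test_function.

(** The null set may depend on [t]: only the law at each fixed time is compared. *)
Lemma limit_law (Z : R -> Omega -> state) :
  (forall t, 0 < t -> {ae Pr, forall w, Z t w = grid_triple t (reversed_grid X v t w)}) ->
  cvg_in_distribution Pr Z sup_triple.
Proof.
move=> HZ f fc [C fC].
have EZ t : 0 < t -> 'E_Pr[f \o Z t]%E =
    (\int[Pr]_w (f (grid_triple t (forward_grid X v t w)))%:E)%E.
  move=> t0; rewrite unlock -(integral_reversed_forward fc fC t0).
  by apply: ae_eq_integral_any; apply: filterS (HZ t t0) => w /= ->.
pose u0 (k : nat) : R := k.+1%:R.
have u00 k : 0 < u0 k by [].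
have u0oo : u0 k @[k --> \oo] --> +oo%R.
  apply/cvgryPge => A; exists (Num.truncn A).+1 => // k /= Ak.
  by rewrite (le_trans (ltW (truncnS_gt A)))// ler_nat (leq_trans Ak).
have EZoo : 'E_Pr[f \o sup_triple]%E = (\int[Pr]_w (f (sup_triple w))%:E)%E.
  by rewrite unlock.
have [fin _] := integral_forward_cvg fc fC u00 u0oo.
rewrite EZoo -(fineK fin); apply/fine_cvgP; split.
  near=> t; rewrite EZ; last by near: t; exact: nbhs_pinfty_gt.
  by apply: integral_forward_fin => //; near: t; exact: nbhs_pinfty_gt.
apply/cvg_pinftyP => u uoo.
(* Equal to [u] eventually, and positive throughout, as the integrals at time [u' k] require. *)
pose u' k := Num.max (u k) 1.
have u'0 k : 0 < u' k by rewrite lt_max ltr01 orbT.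
have u'oo : u' k @[k --> \oo] --> +oo%R.
  apply/cvgryPge => A; have /cvgryPge/(_ A) := uoo.
  by apply: filterS => k Ak; rewrite le_max Ak.
have [_ H] := integral_forward_cvg fc fC u'0 u'oo.
rewrite -(fineK fin) in H; apply: cvg_trans (fine_cvg H).
apply: near_eq_cvg; near=> k.
have uk : 1 <= u k by near: k; move/cvgryPge : uoo; exact.
by rewrite /= EZ ?(lt_le_trans ltr01)// /u' (max_idPl uk).
Unshelve. all: by end_near. Qed.

End limit_law.

(** * Ages of busy and idle periods *)

Section ages.
Context {R : realType}.

(** The sets are cofinal in each other except possibly for the point 0, which does not matter
    because [sup set0 = 0]. *)
Lemma sup_intertwined (A B : set R) (t : R) :
  A `<=` `[0, t]%classic -> B `<=` `[0, t]%classic ->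
  (forall a u, A a -> 0 <= u < a -> exists2 b, B b & u < b) ->
  (forall b u, B b -> 0 <= u < b -> exists2 a, A a & u < a) -> sup A = sup B.
Proof.
have sup_ge0 (S : set R) : S `<=` `[0, t]%classic -> 0 <= sup S.
  move=> St; have [->|/set0P[s Ss]] := eqVneq S set0; first by rewrite sup0.
  have := St s Ss; rewrite /= in_itv /= => /andP[s0 _]; apply: le_trans s0 _.
  by apply: ub_le_sup => //; exists t => u /St; rewrite /= in_itv /= => /andP[].
have le (S S' : set R) : S `<=` `[0, t]%classic -> S' `<=` `[0, t]%classic ->
    (forall s u, S s -> 0 <= u < s -> exists2 b, S' b & u < b) -> sup S <= sup S'.
  move=> St S't H; have [->|/set0P S0] := eqVneq S set0; first by rewrite sup0 sup_ge0.
  apply: ge_sup => // s Ss; rewrite leNgt; apply/negP => lts.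
  have [|b S'b] := H s (sup S') Ss; first by rewrite sup_ge0.
  rewrite ltNge => /negP; apply; apply: ub_le_sup => //.
  by exists t => u /S't; rewrite /= in_itv /= => /andP[].
by move=> At Bt AB BA; apply/eqP; rewrite eq_le !le.
Qed.

(** By [refl_no_jump] and continuity of [x], [V] loses less than two thirds of [V t] just before
    [t]; the remaining third contradicts a left limit 0. *)
Lemma refl_left_lim_neq0 (x : R -> R) v0 (L V : R -> R) t : reflection x v0 L V ->
  0 < t -> 0 < V t -> left_lim x t (x t) -> ~ left_lim V t 0.
Proof.
move=> refl t0 Vt xt Vt0; have e0 : 0 < V t / 3 by lra.
have [s /andP[s0 st] Ls] := refl_no_jump refl t0 Vt e0.
have [d /andP[d0 dt] Hd] := Vt0 _ e0.
have [d' /andP[d'0 d't] Hd'] := xt _ e0.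
pose u := Num.max s (Num.max (t - d) (t - d')).
have su : s <= u by rewrite le_max lexx.
have du : t - d <= u by rewrite !le_max lexx orbT.
have d'u : t - d' <= u by rewrite !le_max lexx !orbT.
have ut : u < t by rewrite !gt_max st; apply/andP; split => //; apply/andP; split; lra.
have u0 := le_trans s0 su.
have := Hd u; rewrite du ut subr0 => /(_ isT); rewrite ltr_norml => /andP[_ Vu].
have := Hd' u; rewrite d'u ut => /(_ isT); rewrite ltr_norml => /andP[xu _].
have := refl_nd refl s0 su.
by move: Vu; rewrite (refl_eq refl u0); have := refl_eq refl (ltW t0); lra.
Qed.

End ages.

(** * Ages in the network *)

Section network_ages.
Context {R : realType} {n : nat}.
Variables (r w : 'cV[R]_n) (P : 'M[R]_n) (J W L : R -> 'cV[R]_n).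
Hypothesis hnet : tree_routing r P.
Hypothesis T1 : forall i j, 0 < P i j -> r j ord0 / r i ord0 <= P i j.
Hypothesis Jnd : forall j : 'I_n, (0 < j)%N -> nondecreasing_path (component J j).
Hypothesis w_ge0 : forall j, 0 <= w j ord0.
Hypothesis sol : skorokhod_solution P w (net_input r P J) W L.

Let V t := invmx (netmx P) *m W t.
Let x j := component (free_process r P J) j.
Let v j := (invmx (netmx P) *m w) j ord0.

Hypothesis cx : forall j, cadlag (x j).
Hypothesis x0 : forall j, x j 0 = 0.
Hypothesis creep : forall j m k c s, creeps_to (x j) (v j) (dyadic m k) c s -> x j s <= c.

Lemma age_triple_reversed t : 0 < t -> age_triple W V t =
  grid_triple P t (fun p => reversed (x p.2) (v p.2) t p.1).
Proof.
move=> t0.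
have v0 j : 0 <= v j by exact: (inv_netmx_ge0 hnet j w_ge0).
have [[cW _] _ _ _ _] := sol.
have rcV j : right_cont (component V j).
  by apply: cadlag_right_cont; apply: cadlag_mulmx.
have refl j := network_reflection hnet T1 Jnd sol j.
rewrite /age_triple /grid_triple; congr (_, _, _).
- rewrite (_ : \col_k _ = V t); first by rewrite /V mulKVmx// (netmx_unit hnet).
  apply/matrixP => j i; rewrite mxE ord1; have [F rF _] := refl j.
  by rewrite (reversed_sup (cx j) (x0 j) (v0 j) t0 rF).
- apply/matrixP => j i; rewrite !mxE; have [F rF _] := refl j.
  by rewrite (reversed_G (cx j) (x0 j) (v0 j) t0 rF (@creep j)).
- apply/matrixP => j i; rewrite !mxE; have [F rF _] := refl j.
  by rewrite (reversed_H (cx j) (x0 j) (v0 j) t0 rF).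
Qed.

Hypothesis T1s : forall i j, 0 < P i j -> r j ord0 / r i ord0 < P i j.

Let V_ge0 s j : 0 <= s -> 0 <= component V j s.
Proof.
by move=> s0; apply: (inv_netmx_ge0 hnet) => k; case: sol => _ _ + _ _; exact.
Qed.

Let V_eq0 s j : 0 <= s -> component V j s = 0 -> component W j s = 0.
Proof.
move=> s0 Vs; have [_ _ /(_ s j s0) Ws _ _] := sol.
apply/eqP; rewrite eq_le {2}/component Ws andbT.
have -> : component W j s = component (fun t => netmx P *m V t) j s.
  by rewrite /component /V mulKVmx// (netmx_unit hnet).
rewrite {1}/component netmxE -/(component V j s) Vs sub0r oppr_le0.
have [_ _ [P0 _] _ _] := hnet.
by apply: sumr_ge0 => i _; apply: mulr_ge0 => //; exact: V_ge0.
Qed.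

(** At a positive time with [W_j = 0 < V_j] the left limit of [V_j] is 0, so zeros of [V_j]
    accumulate before it; conversely [V_j = 0] forces [W_j = 0]. *)
Lemma busy_age_network t j : busy_age (component W j) t = busy_age (component V j) t.
Proof.
congr (_ - _); apply: (@sup_intertwined _ _ _ t).
- by move=> s /= [s0 st _]; rewrite in_itv /= s0.
- by move=> s /= [s0 st _]; rewrite in_itv /= s0.
- move=> a u [a0 at_ Wa] /andP[u0 ua].
  have [Va|/eqP Va] := eqVneq (component V j a) 0; first by exists a.
  have {}a0 := le_lt_trans u0 ua.
  have [F rF _] := network_reflection hnet T1 Jnd sol j.
  have Vp : 0 < component V j a by rewrite lt_neqAle eq_sym V_ge0 ?ltW// andbT; apply/eqP.
  have ll := empty_station_left hnet T1 Jnd sol T1s a0 Wa Va.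
  have [z [/andP[z0 za] uz] Vz] := zeros_before_left_lim rF (@creep j) a0 ll Vp ua.
  by exists z => //; split => //; rewrite ltW// (lt_le_trans za).
- by move=> b u [b0 bt Vb] /andP[_ ub]; exists b => //; split => //; exact: V_eq0.
Qed.

(** If [W_j] vanishes at [b < t] and [V_j] does not, [W_j] is nonzero just after [b]. At [b = t]
    this would give [V_j] the left limit 0 below a positive value, against continuity of [x j] at
    [t]. *)
Lemma idle_age_network t j : 0 < t -> left_lim (x j) t (x j t) ->
  idle_age (component W j) t = idle_age (component V j) t.
Proof.
move=> t0 xt; congr (_ - _); apply: (@sup_intertwined _ _ _ t).
- by move=> s /= [s0 st _]; rewrite in_itv /= s0.
- by move=> s /= [s0 st _]; rewrite in_itv /= s0.
- move=> a u [a0 at_ Wa] /andP[u0 ua]; exists a => //; split => // Va.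
  by apply: Wa; exact: V_eq0.
move=> b u [b0 bt Vb] /andP[u0 ub].
have [Wb|/eqP Wb] := eqVneq (component W j b) 0; last by exists b.
move: bt; rewrite le_eqVlt => /orP[/eqP bt|bt].
  have [F rF _] := network_reflection hnet T1 Jnd sol j.
  have Vp : 0 < component V j t.
    by rewrite lt_neqAle eq_sym V_ge0 ?(ltW t0)// andbT -bt; apply/eqP.
  exfalso; apply: (refl_left_lim_neq0 rF t0 Vp xt).
  by rewrite bt in Wb Vb; exact: (empty_station_left hnet T1 Jnd sol T1s t0 Wb Vb).
have [e e0 He] := empty_station_right hnet T1 Jnd sol T1s b0 Wb Vb.
pose s := Num.min t (b + e / 2).
have bs : b < s by rewrite lt_min bt; lra.
have se : s < b + e by rewrite gt_min; apply/orP; right; lra.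
exists s; last exact: lt_trans bs.
split; [lra|by rewrite ge_min lexx|by apply: He; rewrite bs].
Qed.

End network_ages.

Section network_limit.
Context {R : realType} {d : measure_display} {Omega : measurableType d}.
Variables (Pr : probability Omega R) (n : nat).
Variables (J : Omega -> R -> 'cV[R]_n) (r : 'cV[R]_n) (P : 'M[R]_n).
Hypothesis hnet : tree_routing r P.
Hypothesis T2 : forall j : 'I_n, (0 < j)%N ->
  {ae Pr, forall omega, nondecreasing_path (component (J omega) j)}.
Hypothesis T3 : levy_process Pr J.
Hypothesis T4int : integrable_process Pr J.
Hypothesis T4stab : forall i : 'I_n,
  (invmx (netmx P) *m mean_vector Pr (fun omega => J omega 1)) i ord0 < r i ord0.

Lemma ae_nondecreasing_inputs : {ae Pr, forall omega, forall j : 'I_n, (0 < j)%N ->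
  nondecreasing_path (component (J omega) j)}.
Proof.
apply: filter_forall => j; have [j0|j0] := posnP j.
  by apply: aeW.
by apply: filterS (T2 j0) => omega + _.
Qed.

Lemma ae_creep (v : 'I_n -> R) : {ae Pr, forall omega, forall j m k c s,
  creeps_to (component (free_process r P (J omega)) j) (v j) (dyadic m k) c s ->
  component (free_process r P (J omega)) j s <= c}.
Proof.
apply: filter_forall => j; apply: ae_foralln => m; apply: ae_foralln => k.
apply: (creep_continuous (free_coord_walk r P T3)) => omega.
exact: (free_coord_cadlag r P T3).
Qed.

Lemma network_drifts l : exists2 e, 0 < e &
  {ae Pr, forall w, exists c, forall t, 0 <= t -> free_coord J r P w t l + e * t <= c}.
Proof.
pose m := (invmx (netmx P) *m mean_vector Pr (fun omega => J omega 1)) l ord0.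
have ml : m < r l ord0 by exact: T4stab.
(* Half of the gap in the stability condition, so that the mean stays negative after the drift is
   added. *)
exists ((r l ord0 - m) / 2); first by lra.
apply: (drift (free_coord_walk r P T3)).
- by move=> omega; exact: (free_coord_cadlag r P T3).
- exact: free_coord_integrable.
- by rewrite free_coord_mean// -EFinD lte_fin -/m; lra.
Qed.

Section solution.
Hypothesis T1 : forall i j, 0 < P i j -> r j ord0 / r i ord0 <= P i j.
Variables (w : 'cV[R]_n) (W L : Omega -> R -> 'cV[R]_n).
Hypothesis w_ge0 : forall j, 0 <= w j ord0.
Hypothesis sol : forall omega,
  skorokhod_solution P w (net_input r P (J omega)) (W omega) (L omega).

Let v j := (invmx (netmx P) *m w) j ord0.
Let V omega s := invmx (netmx P) *m W omega s.

(** Stated for any [Z] agreeing almost surely at each fixed time, since the ages of [W] and of [V]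
    coincide only in this sense. *)
Lemma network_limit (Z : R -> Omega -> 'cV[R]_n * 'cV[\bar R]_n * 'cV[\bar R]_n) :
  (forall t, 0 < t ->
    {ae Pr, forall omega, Z t omega = age_triple (W omega) (V omega) t}) ->
  cvg_in_distribution Pr Z
    (fun omega => limit_triple P (free_process r P (J omega))).
Proof.
move=> HZ; apply: (@limit_law _ _ _ Pr n (free_coord J r P) P v).
- exact: free_coord_walk.
- exact: (free_coord_cadlag r P T3).
- by move=> l; exact: (inv_netmx_ge0 hnet l w_ge0).
- exact: network_drifts.
move=> t t0; have H := ae_creep v.
apply: filterS3 (HZ t t0) ae_nondecreasing_inputs H => omega -> Jnd creep.
apply: (age_triple_reversed hnet T1 Jnd w_ge0 (sol omega)) => // j.
  exact: (free_coord_cadlag r P T3).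
by case: (free_coord_walk r P T3) => _ + _; exact.
Qed.

Lemma network_limit_weak : cvg_in_distribution Pr
  (fun t omega => age_triple (W omega) (V omega) t)
  (fun omega => limit_triple P (free_process r P (J omega))).
Proof. by apply: network_limit => t _; exact: aeW. Qed.

Lemma network_limit_strict :
  (forall i j, 0 < P i j -> r j ord0 / r i ord0 < P i j) ->
  cvg_in_distribution Pr
    (fun t omega => age_triple (W omega) (W omega) t)
    (fun omega => limit_triple P (free_process r P (J omega))).
Proof.
move=> T1s; apply: network_limit => t t0; have Hc := ae_creep v.
have Ht : {ae Pr, forall omega, forall j, left_lim
    (component (free_process r P (J omega)) j) t
    (component (free_process r P (J omega)) j t)}.
  apply: filter_forall => j.
  apply: (continuous_at_time (free_coord_walk r P T3) t0) => omega.
  exact: (free_coord_cadlag r P T3).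
apply: filterS3 Hc ae_nondecreasing_inputs Ht => omega creep Jnd Xt.
congr (_, _, _); apply/matrixP => j i; rewrite !mxE; congr (_%:E).
  exact: (busy_age_network hnet T1 Jnd (sol omega) creep T1s).
exact: (idle_age_network hnet T1 Jnd (sol omega) T1s t0).
Qed.

End solution.
End network_limit.
Theorem proposition5p2 (R : realType) (d : measure_display)
    (Omega : measurableType d) (Pr : probability Omega R) (n : nat)
    (J : Omega -> R -> 'cV[R]_n) (r : 'cV[R]_n) (P : 'M[R]_n)
    (hnet : tree_routing r P)
    (T2 : forall j : 'I_n, (0 < j)%N ->
      {ae Pr, forall omega, nondecreasing_path (component (J omega) j)})
    (T3 : levy_process Pr J)
    (T4int : integrable_process Pr J)
    (T4stab : forall i : 'I_n,
      (invmx (netmx P) *m mean_vector Pr (fun omega => J omega 1)) i ord0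
        < r i ord0) :
  ((forall i j : 'I_n, 0 < P i j -> r j ord0 / r i ord0 < P i j) ->
   forall (w : 'cV[R]_n) (W L : Omega -> R -> 'cV[R]_n),
     (forall j, 0 <= w j ord0) ->
     (forall omega, skorokhod_solution P w (net_input r P (J omega))
        (W omega) (L omega)) ->
     cvg_in_distribution Pr
       (fun t omega => age_triple (W omega) (W omega) t)
       (fun omega => limit_triple P (free_process r P (J omega)))) /\
  ((forall i j : 'I_n, 0 < P i j -> r j ord0 / r i ord0 <= P i j) ->
   forall (w : 'cV[R]_n) (W L : Omega -> R -> 'cV[R]_n),
     (forall j, 0 <= w j ord0) ->
     (forall omega, skorokhod_solution P w (net_input r P (J omega))
        (W omega) (L omega)) ->
     cvg_in_distribution Pr
       (fun t omega =>
          age_triple (W omega) (fun s => invmx (netmx P) *m W omega s) t)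
       (fun omega => limit_triple P (free_process r P (J omega)))).
Proof.
split=> T1 w W L w_ge0 sol; last first.
  exact: (network_limit_weak hnet T2 T3 T4int T4stab T1 w_ge0 sol).
have T1w i j : 0 < P i j -> r j ord0 / r i ord0 <= P i j by move=> /T1/ltW.
exact: (network_limit_strict hnet T2 T3 T4int T4stab T1w w_ge0 sol T1).
Qed.
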